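(* Let $n\ge 1$, and let $\sigma_j,\tau_j$ ($1\le j\le n$) and $\theta_{j\alpha}$ ($1\le\alpha\le j\le n-1$) be complex numbers such that $$\operatorname{Re}\theta_{j\alpha}>0,\qquad \operatorname{Re}\sigma_j>0,\qquad \operatorname{Re}\tau_j>\operatorname{Re}\sigma_j+\sum_{\alpha=1}^{j-1}\operatorname{Re}\theta_{(j-1)\alpha}$$ for all admissible indices. Then the following integral over the space $\mathcal R_n[0,\infty)$ of Rayleigh triangles converges absolutely and $$\int_{\mathcal R_n[0,\infty)}\ \prod_{j=1}^{n-1}\prod_{\alpha=1}^{j}\frac{\lambda_{j\alpha}^{\sigma_j-\sigma_{j+1}-\theta_{j\alpha}}}{(1+\lambda_{j\alpha})^{\tau_j-\tau_{j+1}+\theta_{j\alpha}}}\cdot\prod_{p=1}^{n}\frac{\lambda_{np}^{\sigma_n-1}}{(1+\lambda_{np})^{\tau_n}}\cdot\prod_{j=1}^{n-1}\frac{\prod_{1\le\alpha\le j,\,1\le p\le j+1}|\lambda_{j\alpha}-\lambda_{(j+1)p}|^{\theta_{j\alpha}-1}}{\prod_{1\le\alpha<\beta\le j}(\lambda_{j\beta}-\lambda_{j\alpha})^{\theta_{j\alpha}+\theta_{j\beta}-2}}\cdot\prod_{1\le p<q\le n}(\lambda_{nq}-\lambda_{np})\,d\mathcal L$$ $$=\prod_{1\le\alpha\le j\le n-1}\Gamma(\theta_{j\alpha})\cdot\prod_{j=1}^{n}\frac{\Gamma(\sigma_j)\,\Gamma\bigl(\tau_j-\sigma_j-\sum_{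\alpha=1}^{j-1}\theta_{(j-1)\alpha}\bigr)}{\Gamma(\tau_j)}.$$
   Context: A Rayleigh triangle $\mathcal L$ of size $n$ is a collection of $n(n+1)/2$ real numbers $\lambda_{jk}$, $1\le k\le j\le n$, satisfying $\lambda_{(j+1)k}\le\lambda_{jk}\le\lambda_{(j+1)(k+1)}$ for all $1\le k\le j\le n-1$. $\mathcal R_n[0,\infty)$ is the set of Rayleigh triangles of size $n$ with all entries in $[0,\infty)$, and $d\mathcal L=\prod_{1\le\alpha\le j\le n}d\lambda_{j\alpha}$ is Lebesgue measure. Complex powers of positive numbers are $x^s=e^{s\ln x}$; empty sums are $0$ and empty products are $1$. *)

(* Defs.v *)
From HB Require Import structures.
From mathcomp Require Import all_boot all_order all_algebra.
From mathcomp Require Import all_classical all_reals all_analysis.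
From mathcomp Require Import complex.

Set Implicit Arguments.
Unset Strict Implicit.
Unset Printing Implicit Defensive.

Import Order.TTheory GRing.Theory Num.Theory.
Import numFieldNormedType.Exports.

Local Open Scope classical_set_scope.
Local Open Scope ring_scope.

Section tuple_cons.
Variable R : realType.
Variable m : nat.
Local Notation T := (measurableTypeR R).

Definition tuple_cons (x : T * m.-tuple T) : m.+1.-tuple T :=
  [tuple of x.1 :: x.2].

Definition tuple_uncons (t : m.+1.-tuple T) : T * m.-tuple T :=
  (thead t, [tuple of behead t]).

Lemma tuple_consK : cancel tuple_cons tuple_uncons.
Proof. by case=> x t; congr pair; apply: val_inj. Qed.

Lemma tuple_unconsK : cancel tuple_uncons tuple_cons.
Proof. by move=> t; apply: val_inj; rewrite [t in RHS]tuple_eta. Qed.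

Lemma measurable_tuple_cons : measurable_fun setT tuple_cons.
Proof. exact: (measurable_cons (f := fst) (g := snd)). Qed.

Lemma measurable_tuple_uncons : measurable_fun setT tuple_uncons.
Proof.
apply/measurable_fun_pairP; split => /=; first exact: measurable_tnth.
exact: measurable_behead.
Qed.

End tuple_cons.
Arguments tuple_cons {R m}.
Arguments tuple_uncons {R m}.

(* The library's instance of this fact is shadowed, in canonical structure
   inference, by the one on products of subprobabilities. *)
Lemma product_sigma_finite d1 d2 (T1 : measurableType d1)
    (T2 : measurableType d2) (R : realType)
    (m1 : {sigma_finite_measure set T1 -> \bar R})
    (m2 : {sigma_finite_measure set T2 -> \bar R}) :
  sigma_finite setT (m1 \x m2)%E.
Proof.
have /sigma_finiteP[F [TF ndF Foo]] := sigma_finiteT m1.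
have /sigma_finiteP[G [TG ndG Goo]] := sigma_finiteT m2.
exists (fun n => F n `*` G n).
  rewrite -setXTT TF TG predeqE => -[x y]; split.
    move=> [/= [n _ Fnx] [k _ Gky]]; exists (maxn n k) => //; split.
    - by move: x Fnx; exact/subsetPset/ndF/leq_maxl.
    - by move: y Gky; exact/subsetPset/ndG/leq_maxr.
  by move=> [n _ []/= ? ?]; split; exists n.
move=> k; have [? ?] := Foo k; have [? ?] := Goo k.
split; first exact: measurableX.
by rewrite product_measure1E// lte_mul_pinfty// ge0_fin_numE.
Qed.

Section cons_measure.
Local Open Scope ereal_scope.
Variables (R : realType) (m : nat).
Local Notation T := (measurableTypeR R).
Variable nu : {sigma_finite_measure set (m.-tuple T) -> \bar R}.

Let pi : {measure set (T * m.-tuple T)%type -> \bar R} :=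
  (@lebesgue_measure R \x nu).
Definition cons_measure : set (m.+1.-tuple T) -> \bar R :=
  pushforward pi tuple_cons.

Let mpre A : measurable A -> measurable (@tuple_cons R m @^-1` A).
Proof.
by move=> mA; rewrite -[X in measurable X]setTI; exact: measurable_tuple_cons.
Qed.

Let cons0 : cons_measure set0 = 0.
Proof. by rewrite /cons_measure /pushforward preimage_set0 measure0. Qed.

Let cons_ge0 A : 0 <= cons_measure A.
Proof. exact: (measure_ge0 pi). Qed.

Let cons_additive : semi_sigma_additive cons_measure.
Proof.
move=> F mF tF mUF; rewrite /cons_measure /pushforward preimage_bigcup.
apply: measure_semi_sigma_additive.
- by move=> n; exact: mpre.
- apply/trivIsetP => /= i j _ _ ij; rewrite -preimage_setI.
  by move/trivIsetP : tF => /(_ _ _ _ _ ij) ->//; rewrite preimage_set0.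
- by rewrite -preimage_bigcup; exact: mpre.
Qed.

HB.instance Definition _ := isMeasure.Build _ _ _ cons_measure
  cons0 cons_ge0 cons_additive.

Let cons_sigma_finite : sigma_finite setT cons_measure.
Proof.
have [F FT Foo] : sigma_finite setT pi by exact: product_sigma_finite.
exists (fun k => @tuple_uncons R m @^-1` F k).
  by rewrite -preimage_bigcup -FT preimage_setT.
move=> k; have [mF Fk] := Foo k; split.
  by rewrite -[X in measurable X]setTI; exact: measurable_tuple_uncons.
rewrite /cons_measure /pushforward -comp_preimage.
suff -> : tuple_uncons \o @tuple_cons R m = id by [].
by apply/funext => x; exact: tuple_consK.
Qed.

HB.instance Definition _ := Measure_isSigmaFinite.Build _ _ _ cons_measure
  cons_sigma_finite.

End cons_measure.

(* Lebesgue measure on R^m, whose points are m-tuples with the product Borel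
   sigma-algebra: the m-fold product of the one-dimensional measure. *)
Fixpoint tuple_lebesgue (R : realType) (m : nat) :
    set (m.-tuple (measurableTypeR R)) -> \bar R :=
  match m with
  | 0 => \d_ ([tuple] : 0.-tuple (measurableTypeR R))
  | m'.+1 =>
      pushforward (@lebesgue_measure R \x @tuple_lebesgue R m')%E tuple_cons
  end.

Section tuple_lebesgue_measure.
Local Open Scope ereal_scope.
Variables (R : realType) (m : nat).
Local Notation T := (measurableTypeR R).

Let tuple_lebesgueE :
  exists mu : {sigma_finite_measure set (m.-tuple T) -> \bar R},
    mu = @tuple_lebesgue R m :> (set _ -> \bar R).
Proof.
elim: m => [|k [mu muE]]; first by exists (\d_ ([tuple] : 0.-tuple T)).
by exists (cons_measure mu); rewrite /= -muE.
Qed.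

Let tuple_lebesgue0 : @tuple_lebesgue R m set0 = 0.
Proof. by have [mu <-] := tuple_lebesgueE. Qed.

Let tuple_lebesgue_ge0 A : 0 <= @tuple_lebesgue R m A.
Proof. by have [mu <-] := tuple_lebesgueE. Qed.

Let tuple_lebesgue_additive : semi_sigma_additive (@tuple_lebesgue R m).
Proof. by have [mu <-] := tuple_lebesgueE; exact: measure_semi_sigma_additive. Qed.

HB.instance Definition _ := isMeasure.Build _ _ _ (@tuple_lebesgue R m)
  tuple_lebesgue0 tuple_lebesgue_ge0 tuple_lebesgue_additive.

Let tuple_lebesgue_sigma_finite : sigma_finite setT (@tuple_lebesgue R m).
Proof. by have [mu <-] := tuple_lebesgueE; exact: sigma_finiteT. Qed.

HB.instance Definition _ := Measure_isSigmaFinite.Build _ _ _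
  (@tuple_lebesgue R m) tuple_lebesgue_sigma_finite.

End tuple_lebesgue_measure.

Lemma tuple_lebesgue_box (R : realType) (m : nat)
    (A : 'I_m -> set (measurableTypeR R)) :
  (forall i, measurable (A i)) ->
  tuple_lebesgue [set x | forall i, A i (tnth x i)]
  = (\prod_(i < m) lebesgue_measure (A i))%E.
Proof.
elim: m A => [|m IH] A mA.
  rewrite big_ord0 /= diracE mem_set//=; by case.
rewrite big_ord_recl -IH//= /pushforward.
rewrite -product_measure1E//=; last first.
  rewrite (_ : [set x | _] =
    \bigcap_i ((fun x : m.-tuple (measurableTypeR R) => tnth x i)
                @^-1` A (lift ord0 i))).
    apply: fin_bigcap_measurable => // i _.
    by rewrite -[X in measurable X]setTI; exact: measurable_tnth.
  by apply/seteqP; split=> [x h i _|x h i]; exact: h.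
congr (_ _); apply/seteqP; split=> -[x t] /=.
- move=> h; split=> [|i]; first by have := h ord0.
  by have := h (lift ord0 i); rewrite tnthS.
- move=> [Ax At] i; case: (unliftP ord0 i) => [j ->|->] //.
  by rewrite tnthS.
Qed.

Section complex_analysis.
Variable R : realType.

Definition cexp (z : R[i]) : R[i] :=
  (expR (complex.Re z))%:C%C
  * (cos (complex.Im z) +i* sin (complex.Im z))%C.

(* x^s = e^{s ln x}, meaningful for 0 < x only; since ln 0 = 0 in the library,
   0^s takes the value 1. *)
Definition cpow (x : R) (s : R[i]) : R[i] := cexp (s * (ln x)%:C%C).

Section integral.
Context d (T : measurableType d) (mu : {measure set T -> \bar R}).
Variables (D : set T) (f : T -> R[i]).

Definition abs_integrable : Prop :=
  [/\ measurable_fun D (fun x => complex.Re (f x)),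
      measurable_fun D (fun x => complex.Im (f x))
    & (\int[mu]_(x in D) (complex.Re `|f x|)%:E < +oo)%E].

Definition cintegral : R[i] :=
  ((\int[mu]_(x in D) complex.Re (f x))
     +i* (\int[mu]_(x in D) complex.Im (f x)))%C.

End integral.

(* Euler's integral, which represents the Gamma function for 0 < Re s. *)
Definition cGamma (s : R[i]) : R[i] :=
  cintegral (@lebesgue_measure R) `]0, +oo[
    (fun t => cpow t (s - 1) * (expR (- t))%:C%C).

End complex_analysis.

(* A triangle of size n is stored row after row as a tuple of length
   n(n+1)/2 = 'C(n.+1, 2); its entry lambda_{jk}, 1 <= k <= j <= n, sits at
   position j(j-1)/2 + (k-1) = 'C(j, 2) + k.-1. *)
Notation triangle R n := (('C(n.+1, 2)).-tuple (measurableTypeR R)).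

Definition entry (R : realType) (n : nat) (L : triangle R n) (j k : nat) : R :=
  nth 0 (L : seq R) ('C(j, 2) + k.-1)%N.

Definition rayleigh (R : realType) (n : nat) (L : triangle R n) : Prop :=
  forall j k, (1 <= k <= j)%N -> (j <= n.-1)%N ->
    entry L j.+1 k <= entry L j k <= entry L j.+1 k.+1.

Definition rayleigh_nneg (R : realType) (n : nat) : set (triangle R n) :=
  [set L | rayleigh L /\
    forall j k, (1 <= k <= j)%N -> (j <= n)%N -> 0 <= entry L j k].

Section rayleigh_beta.
Variables (R : realType) (n : nat).
Variables (sigma tau : nat -> R[i]) (theta : nat -> nat -> R[i]).
Local Open Scope complex_scope.

Definition rayleigh_integrand (L : triangle R n) : R[i] :=
  let l := entry L in
  (\prod_(1 <= j < n) \prod_(1 <= a < j.+1)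
     (cpow (l j a) (sigma j - sigma j.+1 - theta j a)
      / cpow (1 + l j a) (tau j - tau j.+1 + theta j a)))
  * (\prod_(1 <= p < n.+1)
       (cpow (l n p) (sigma n - 1) / cpow (1 + l n p) (tau n)))
  * (\prod_(1 <= j < n)
       ((\prod_(1 <= a < j.+1) \prod_(1 <= p < j.+2)
           cpow `|l j a - l j.+1 p| (theta j a - 1))
        / (\prod_(1 <= b < j.+1) \prod_(1 <= a < b)
             cpow (l j b - l j a) (theta j a + theta j b - 2))))
  * (\prod_(1 <= q < n.+1) \prod_(1 <= p < q) (l n q - l n p)%:C).

Definition rayleigh_beta_value : R[i] :=
  (\prod_(1 <= j < n) \prod_(1 <= a < j.+1) cGamma (theta j a))
  * \prod_(1 <= j < n.+1)
      (cGamma (sigma j)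
       * cGamma (tau j - sigma j - \sum_(1 <= a < j) theta j.-1 a)
       / cGamma (tau j)).

End rayleigh_beta.

(* Main.v *)
Require Import Defs.
From HB Require Import structures.
From mathcomp Require Import all_boot all_order all_algebra.
From mathcomp Require Import all_classical all_reals all_analysis.
From mathcomp Require Import measurable_realfun complex ring lra.

Set Implicit Arguments.
Unset Strict Implicit.
Unset Printing Implicit Defensive.

Import Order.TTheory GRing.Theory Num.Theory.
Import numFieldNormedType.Exports.

Local Open Scope classical_set_scope.
Local Open Scope ring_scope.

(** The rows are integrated out from the last one upwards.  Put
    (a_0, ..., a_n) = (0, lambda_{n1}, ..., lambda_{nn}); the condition on the
    entries l_0, ..., l_n of row n + 1 is that l interlaces a.  For fixed a, the
    partial fraction expansion
      prod_p (l_p - t) / prod_i (a_i - t) = 1 + sum_i w_i / (a_i - t)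
    is a bijection between the interlacing l and the w with positive entries, of
    Jacobian dw / dl = V(l) / V(a), V being the Vandermonde product.  The residues
    give w_i = prod_p |l_p - a_i| / prod_{j <> i} |a_j - a_i|, and t = -1 gives
    prod_p (1 + l_p) = prod_i (1 + a_i) (1 + sum_i w_i / (1 + a_i)).  In the
    coordinates w the integral over row n + 1 is thus the Dirichlet integral
      int prod_i w_i^(s_i - 1) (1 + sum_i w_i / (1 + a_i))^(- tau) dw,
    with s = (sigma_{n+1}, theta_{n1}, ..., theta_{nn}) and tau = tau_{n+1}, and its
    dependence on a exactly cancels against the factors at row n: what is left is
    prod_i Gamma(s_i) Gamma(tau - sum_i s_i) / Gamma(tau) times the integrand of
    size n.  Replacing exponents by their real parts gives the absolute convergence. *)

(** * Change of variables on the line *)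

(** The passage from l to w involves no Jacobian determinant: nodes are split off one at a time, and
    with the weights of the other nodes held fixed the weight of the smallest node is an increasing
    function of the single entry next to it, so that one-variable substitution and Tonelli suffice.
    Both are applied to nonnegative integrands; complex ones pass through by the positive and
    negative parts of their real and imaginary parts. Where Fubini is applied to complex integrands,
    the modulus of a product of powers is the same product at the real parts of the exponents, so
    its integral is given by the same formula. The Dirichlet integral comes out multiplied by
    Gamma(tau); removing this factor requires that Gamma has no zero in the right half-plane, which
    is derived from Euler's integral. The computation lives on strictly interlacing triangles with
    positive entries, where every base of a power is positive; the other Rayleigh triangles have a
    repeated entry or an entry 0 and form a null set. *)

Section density.
Local Open Scope ereal_scope.
Context d1 d2 (X : measurableType d1) (Y : measurableType d2) (R : realType).
Variables (mu : {measure set X -> \bar R}) (nu : {measure set Y -> \bar R}).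
Variables (phi : X -> Y) (rho : X -> R) (D : set Y).
Hypotheses (mphi : measurable_fun setT phi) (mrho : measurable_fun setT rho).
Hypotheses (rho0 : forall x, (0 <= rho x)%R) (mD : measurable D).
Hypothesis density_set : forall A, measurable A ->
  \int[mu]_x (rho x * \1_A (phi x))%:E = nu (A `&` D).

Import HBNNSimple.

Let msec A : measurable A -> measurable_fun setT (fun x => \1_A (phi x) : R).
Proof. by move=> mA; apply: measurableT_comp => //; exact: measurable_indic. Qed.

Let sfun_density (f : {nnsfun Y >-> R}) :
  \int[mu]_x ((rho x)%:E * (f (phi x))%:E) = \int[nu]_(y in D) (f y)%:E.
Proof.
under [LHS]eq_integral.
  move=> x xD; rewrite fimfunE -fsumEFin// ge0_mule_fsumr; last first.
    by move=> r; rewrite EFinM nnfun_muleindic_ge0.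
  over.
under [RHS]eq_integral do rewrite fimfunE -fsumEFin//.
rewrite [LHS]ge0_integral_fsum//; last 2 first.
- move=> r; apply: emeasurable_funM; first exact/measurable_EFinP.
  apply/measurable_EFinP; apply: measurable_funM => //.
  exact: msec.
- move=> r x _; rewrite mule_ge0 ?lee_fin// -lee_fin.
  by rewrite EFinM; exact: nnfun_muleindic_ge0.
rewrite [RHS]ge0_integral_fsum//; last 2 first.
- by move=> r; apply/measurable_EFinP; exact: measurable_funM.
- by move=> r x _; rewrite EFinM; exact: nnfun_muleindic_ge0.
apply: eq_fsbigr => r _.
have mr : measurable (f @^-1` [set r]) by exact: measurable_funPTI.
have [r0|r0] := ltP r 0%R.
  have -> : f @^-1` [set r] = set0 by exact: preimage_nnfun0.
  by rewrite !integral0_eq// => x _; rewrite indic0 /= mulr0 // mule0.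
transitivity (r%:E * nu (f @^-1` [set r] `&` D)).
  rewrite -density_set//.
  rewrite -ge0_integralZl//; last 2 first.
  - by apply/measurable_EFinP; apply: measurable_funM => //; exact: msec.
  - by move=> x _; rewrite lee_fin mulr_ge0.
  by apply: eq_integral => x _; rewrite -!EFinM; congr EFin; rewrite mulrCA.
rewrite -integral_indic// -ge0_integralZl//.
by apply/measurable_EFinP.
Qed.

(** Linearity extends the hypothesis from indicators to simple functions, and monotone convergence
    extends it to all nonnegative measurable functions. *)
Lemma ge0_integral_density (G : Y -> \bar R) :
  measurable_fun setT G -> (forall y, 0 <= G y) ->
  \int[mu]_x ((rho x)%:E * G (phi x)) = \int[nu]_(y in D) G y.
Proof.
move=> mG G0; pose f_ := nnsfun_approx measurableT mG.
have f_cvg y : limn (fun n => (f_ n y)%:E) = G y.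
  by apply/cvg_lim => //; apply: cvg_nnsfun_approx => // *; exact: G0.
have f_nd y : {homo (fun n => (f_ n y)%:E) : m n / (m <= n)%N >-> m <= n}.
  by move=> m n mn; rewrite lee_fin; exact/lefP/nd_nnsfun_approx.
transitivity (limn (fun n => \int[nu]_(x in D) (f_ n x)%:E)); last first.
  rewrite -monotone_convergence//.
  - by apply: eq_integral => y _; rewrite f_cvg.
  - by move=> n; apply/measurable_EFinP; exact: measurable_funTS.
  - by move=> n y _; rewrite lee_fin.
rewrite [X in _ = limn X](_ : _ =
    fun n => \int[mu]_x ((rho x)%:E * (f_ n (phi x))%:E)); last first.
  by apply/funext => n; rewrite sfun_density.
rewrite -monotone_convergence//.
- apply: eq_integral => x _; rewrite -f_cvg; apply/esym/cvg_lim => //.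
  apply: cvgeZl => //; rewrite f_cvg.
  by apply: cvg_nnsfun_approx => // *; exact: G0.
- move=> n; apply: emeasurable_funM; first exact/measurable_EFinP.
  by apply/measurable_EFinP; exact: measurableT_comp.
- by move=> n x _; rewrite mule_ge0// lee_fin.
- by move=> x _ m n mn; rewrite lee_wpmul2l ?lee_fin//; exact/lefP/nd_nnsfun_approx.
Qed.

End density.

Section substitution.
Local Open Scope ereal_scope.
Variable R : realType.
Local Notation mu := (@lebesgue_measure R).
Variables (a : R) (b : \bar R) (h h' : measurableTypeR R -> measurableTypeR R).
Hypothesis hd : forall x : R, (a <= x)%R -> x%:E < b -> is_derive x 1%R h (h' x).
Hypothesis h'c : forall x : R, (a <= x)%R -> x%:E < b -> {for x, continuous h'}.
Hypothesis h'0 : forall x : R, (a <= x)%R -> x%:E < b -> (0 < h' x)%R.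
Hypothesis ha : h a = 0%R.
Hypothesis hb : forall y : R, (0 <= y)%R ->
  exists x : R, [/\ (a <= x)%R, x%:E < b & (y <= h x)%R].
Hypothesis mh : measurable_fun setT h.
Hypothesis mh' : measurable_fun setT h'.

(** Cutting [h'] off outside (a, b) turns the substitution into an integral over the whole line,
    whatever default values [h] takes elsewhere. *)
Definition subst_density (x : R) : R :=
  if (a < x)%R && (x%:E < b) then h' x else 0%R.
Local Notation rho := subst_density.

Let down (x y : R) : (x <= y)%R -> y%:E < b -> x%:E < b.
Proof. by move=> xy; apply: le_lt_trans; rewrite lee_fin. Qed.

Lemma measurable_subst_density : measurable_fun setT rho.
Proof.
apply: measurable_fun_ifT => //=.
apply: measurable_and; first exact: measurable_fun_ltr.
exact: (measurable_fun_lte (f := EFin) (g := cst b)).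
Qed.

Lemma subst_density_ge0 x : (0 <= rho x)%R.
Proof. by rewrite /rho; case: ifP => // /andP[ax xb]; exact/ltW/h'0/xb/ltW. Qed.

Let hcont x : (a <= x)%R -> x%:E < b -> {for x, continuous h}.
Proof.
move=> ax xb; apply: differentiable_continuous.
by apply/derivable1_diffP; have [] := hd ax xb.
Qed.

Let hcont_within x y : (a <= x)%R -> y%:E < b -> {within `[x, y], continuous h}.
Proof.
move=> ax yb; apply: continuous_in_subspaceT => z; rewrite inE/= in_itv/= => /andP[xz zy].
by apply: hcont; [exact: le_trans xz|exact: down yb].
Qed.

Let h_incr x y : (a <= x)%R -> (x < y)%R -> y%:E < b -> (h x < h y)%R.
Proof.
move=> ax xy yb.
have [||c] := @MVT _ h h' x y xy.
- move=> c; rewrite in_itv/= => /andP[xc cy].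
  by apply: hd; [exact/ltW/(le_lt_trans ax)|exact/(down (ltW cy))].
- exact: hcont_within.
rewrite in_itv/= => /andP[xc cy] E; rewrite -subr_gt0 E mulr_gt0 ?subr_gt0//.
by apply: h'0; [exact/ltW/(le_lt_trans ax)|exact/(down (ltW cy))].
Qed.

Let h_le x y : (a <= x)%R -> (x <= y)%R -> y%:E < b -> (h x <= h y)%R.
Proof.
by move=> ax; rewrite le_eqVlt => /predU1P[->//|xy] yb; exact/ltW/h_incr.
Qed.

Let h_surj c : (0 <= c)%R -> exists x : R, [/\ (a <= x)%R, x%:E < b & h x = c].
Proof.
move=> c0; have [y [ay yb cy]] := hb c0.
have [|x] := @IVT _ h a y c ay (hcont_within (lexx a) yb).
  by rewrite ha min_l ?max_r ?c0// (le_trans c0).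
rewrite in_itv/= => /andP[ax xy] hx; exists x; split => //.
exact: down yb.
Qed.

Let hlt x y : (a <= x)%R -> (a <= y)%R -> x%:E < b -> y%:E < b ->
  (h x < h y)%R = (x < y)%R.
Proof.
move=> ax ay xb yb; have [xy|yx] := ltP x y; first exact: h_incr.
by apply/negbTE; rewrite -leNgt; exact: h_le.
Qed.

Let hpos x : (a < x)%R -> x%:E < b -> (0 < h x)%R.
Proof. by move=> ax xb; rewrite -ha h_incr. Qed.

Let ftc x y : (a <= x)%R -> (x <= y)%R -> y%:E < b ->
  \int[mu]_(z in `]x, y]) (h' z)%:E = (h y - h x)%:E.
Proof.
move=> ax; rewrite le_eqVlt => /predU1P[->|xy] yb.
  by rewrite set_itv_ge ?bnd_simp ?ltxx// integral_set0 subrr.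
rewrite integral_itv_obnd_cbnd; last exact/measurable_EFinP/measurable_funTS.
rewrite (@continuous_FTC2 _ h' h)//.
- apply: continuous_in_subspaceT => z; rewrite inE/= in_itv/= => /andP[xz zy].
  by apply: h'c; [exact: le_trans xz|exact: down yb].
- split.
  + move=> z; rewrite in_itv/= => /andP[xz zy].
    have [] := @hd z => //; first exact/ltW/(le_lt_trans ax).
    exact/(down (ltW zy)).
  + by apply/cvg_at_right_filter/hcont => //; exact: down (ltW xy) yb.
  + by apply/cvg_at_left_filter/hcont => //; exact/(le_trans ax)/ltW.
- move=> z; rewrite in_itv/= => /andP[xz zy].
  rewrite derive1E; have [] := @hd z => //; first exact/ltW/(le_lt_trans ax).
  exact/(down (ltW zy)).
Qed.

Let m1 (A : set (measurableTypeR R)) := \int[mu]_(x in h @^-1` A) (rho x)%:E.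

Let mpre A : measurable A -> measurable (h @^-1` A).
Proof. by move=> mA; rewrite -[X in measurable X]setTI; exact: mh. Qed.

Let m10 : m1 set0 = 0.
Proof. by rewrite /m1 preimage_set0 integral_set0. Qed.

Let m1_ge0 A : 0 <= m1 A.
Proof. by apply: integral_ge0 => x _; rewrite lee_fin subst_density_ge0. Qed.

Let m1_additive : semi_sigma_additive m1.
Proof.
move=> F mF tF mUF; rewrite /m1 preimage_bigcup.
apply: (@semi_sigma_additive_nng_induced _ _ _ mu (EFin \o rho)).
- apply/measurable_EFinP; exact: measurable_subst_density.
- by move=> x; rewrite /= lee_fin subst_density_ge0.
- by move=> n; exact: mpre.
- apply/trivIsetP => /= i j _ _ ij; rewrite -preimage_setI.
  by move/trivIsetP : tF => /(_ _ _ _ _ ij) ->//; rewrite preimage_set0.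
- by rewrite -preimage_bigcup; exact: mpre.
Qed.

HB.instance Definition _ := isMeasure.Build _ _ _ m1 m10 m1_ge0 m1_additive.

(** [m1] is the image under [h] of the measure with density [rho]. The ends are truncated at 0
    because [h] maps [a, b) onto [0, oo): on (a, b) the condition y1 < h x <= y2 reads x1 < x <= x2
    with h xi = max yi 0. *)
Let m1_itv (y1 y2 : R) : (y1 <= y2)%R ->
  m1 `]y1, y2]%classic = (Num.max y2 0 - Num.max y1 0)%:E.
Proof.
move=> y12.
have [x1 [ax1 x1b hx1]] : exists x : R, [/\ (a <= x)%R, x%:E < b & h x = Num.max y1 0%R].
  by apply: h_surj; rewrite le_max lexx orbT.
have [x2 [ax2 x2b hx2]] : exists x : R, [/\ (a <= x)%R, x%:E < b & h x = Num.max y2 0%R].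
  by apply: h_surj; rewrite le_max lexx orbT.
have x12 : (x1 <= x2)%R.
  by rewrite leNgt -hlt// -leNgt hx1 hx2 ge_max !le_max y12 lexx !orbT.
rewrite -hx1 -hx2 -ftc// /m1 [LHS]integral_mkcond [RHS]integral_mkcond.
apply: eq_integral => x _; rewrite !patchE /=.
have -> : (x \in h @^-1` `]y1, y2]) = (y1 < h x <= y2)%R.
  by apply/idP/idP; rewrite inE /= in_itv.
have -> : (x \in `]x1, x2]%classic) = (x1 < x <= x2)%R.
  by apply/idP/idP; rewrite inE /= in_itv.
rewrite /rho; have [/andP[ax xb]|axb] := boolP ((a < x)%R && (x%:E < b)).
  have hx0 := hpos ax xb; have ax' := ltW ax.
  have -> : (y1 < h x <= y2)%R = (x1 < x <= x2)%R => //.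
  rewrite -(hlt ax1 ax')// [(x <= x2)%R]leNgt -(hlt ax2 ax')// -leNgt hx1 hx2.
  by rewrite gt_max hx0 andbT le_max [(h x <= 0)%R]leNgt hx0 orbF.
rewrite if_same; case: ifPn => // /andP[xx1 xx2].
by move: axb; rewrite (le_lt_trans ax1 xx1) (down xx2 x2b).
Qed.

(** [m1] charges only the positive half-line. To use the uniqueness of Lebesgue measure, its
    restriction to ]-oo, 0] is added to [m1], and the sum is compared with Lebesgue measure on
    half-open intervals. *)
Let m1_density A : measurable A ->
  \int[mu]_x (rho x * \1_A (h x))%:E = mu (A `&` `]0%R, +oo[).
Proof.
move=> mA.
have m2 : measurable (`]-oo, 0%R]%classic : set R) by exact: measurable_itv.
have E B : measurable B -> mu B = measure_add m1 (mrestr mu m2) B.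
  apply: lebesgue_measure_unique => _ [[y1 y2] _ <-].
  rewrite /= /msum 2!big_ord_recl/= big_ord0 adde0 /mrestr -set_itvI /=.
  have [y12|y21] := leP y1 y2; last first.
    rewrite set_itv_ge ?bnd_simp -?leNgt ?ltW// measure0.
    rewrite m10 add0e (_ : [set` _] = set0) ?measure0//.
    rewrite set_itvI set_itv_ge ?set0I// bnd_simp -leNgt ltW//.
  rewrite m1_itv// !lebesgue_measure_itv/=.
  rewrite !lte_fin meetEtotal -EFinD /Num.max /Order.min; case: (ltrP y1 y2) => [y12'|y21].
    have [y20|y20] := ltP y2 0%R; have [y10|y10] := ltP y1 0%R; rewrite ?y12'.
    - by rewrite -!EFinD; congr EFin; ring.
    - by exfalso; lra.
    - by rewrite ?y10 -!EFinD; congr EFin; ring.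
    - by rewrite ?(ltNge y1) ?y10 /= -!EFinD; congr EFin; ring.
  have -> : y1 = y2 by apply/eqP; rewrite eq_le y12.
  rewrite subrr add0r; have [y20|y20] := ltP y2 0%R; rewrite ?ltxx//.
  by rewrite ltNge y20.
have := E _ (measurableI _ _ mA (measurable_itv `]0%R, +oo[)).
have m2_0 : mrestr mu m2 (A `&` `]0%R, +oo[) = 0.
  rewrite /mrestr -setIA (_ : `]0%R, +oo[ `&` `]-oo, 0%R] = set0)%classic.
    by rewrite setI0 measure0.
  rewrite -subset0 => x /=; rewrite !in_itv/= => -[]; rewrite andbT ltNge.
  by move=> /negbTE ->.
rewrite measure_addE; move: m2_0 => /= ->; rewrite adde0 => ->.
rewrite /m1 [RHS]integral_mkcond.
apply: eq_integral => x _; rewrite !patchE /= indicE /rho.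
have -> : (x \in h @^-1` (A `&` `]0%R, +oo[)) = (h x \in A) && (0 < h x)%R.
  apply/idP/idP; rewrite inE /= in_itv/= andbT.
    by move=> [/mem_set -> ->].
  by move=> /andP[/set_mem ? ->].
have [/andP[ax xb]|_] := boolP ((a < x)%R && (x%:E < b)); last first.
  by rewrite mul0r if_same.
by rewrite (hpos ax xb) andbT; case: ifP => _; rewrite ?mulr1 ?mulr0.
Qed.

Lemma ge0_integral_subst (G : R -> \bar R) :
  measurable_fun setT (G : measurableTypeR R -> \bar R) ->
  (forall y, 0 <= G y) ->
  \int[mu]_x ((rho x)%:E * G (h x)) = \int[mu]_(y in `]0%R, +oo[) G y.
Proof.
move=> mG G0; apply: ge0_integral_density => //.
- exact: measurable_subst_density.
- exact: subst_density_ge0.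
Qed.

End substitution.

(** * Iterated integrals *)

Section measurable_real.
Context d (X : measurableType d) (R : realType).
Implicit Types f g : X -> R.

Lemma measurable_invr : measurable_fun setT (@GRing.inv R : measurableTypeR R -> measurableTypeR R).
Proof.
(* Inversion is continuous away from 0, and on a single point everything is measurable. *)
have -> : [set: measurableTypeR R] = ~` [set 0] `|` [set 0] by rewrite setUC setUv.
apply/measurable_funU; [exact: measurableC|exact: measurable_set1|split].
  apply: open_continuous_measurable_fun; first
    exact/closed_openC/accessible_closed_set1/hausdorff_accessible/Rhausdorff.
  by move=> x; rewrite inE/= => /eqP x0; exact: inv_continuous.
exact: measurable_fun_set1.
Qed.

Lemma measurable_funV f : measurable_fun setT f ->
  measurable_fun setT (fun x => (f x)^-1).
Proof. exact: (measurableT_comp measurable_invr). Qed.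

Lemma measurable_fun_if0 (b : X -> bool) (f : X -> \bar R) :
  measurable_fun setT b -> measurable_fun setT f ->
  measurable_fun setT (fun x => if b x then f x else 0%E).
Proof. by move=> mb mf; apply: measurable_fun_ifT. Qed.

Lemma measurable_big_andb (I : eqType) (s : seq I) (b : I -> X -> bool) :
  (forall i, i \in s -> measurable_fun setT (b i)) ->
  measurable_fun setT (fun x => \big[andb/true]_(i <- s) b i x).
Proof.
elim: s => [|i s IH] mb.
  by rewrite (_ : (fun _ => _) = cst true)//; apply/funext => x; rewrite big_nil.
under eq_fun do rewrite big_cons; apply: measurable_and.
  by apply: mb; rewrite mem_head.
by apply: IH => j js; apply: mb; rewrite inE js orbT.
Qed.

End measurable_real.

Section measurable_seq.
Variable R : realType.
Local Notation T := (measurableTypeR R).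

Lemma measurable_nth (m i : nat) :
  measurable_fun setT (fun t : m.-tuple T => nth 0 (t : seq R) i : R).
Proof.
have [im|mi] := ltnP i m.
  rewrite (_ : (fun _ => _) = fun t : m.-tuple T => tnth t (Ordinal im)).
    exact: measurable_tnth.
  by apply/funext => t; rewrite (tnth_nth 0).
rewrite (_ : (fun _ => _) = cst 0); first exact: measurable_cst.
by apply/funext => t; rewrite nth_default// size_tuple.
Qed.

Context d (X : measurableType d).

Lemma measurable_nth_comp m (phi : X -> m.-tuple T) i :
  measurable_fun setT phi ->
  measurable_fun setT (fun x => nth 0 (phi x : seq R) i : R).
Proof. exact: (measurableT_comp (@measurable_nth m i)). Qed.

(** Bridge from lists of constant size to tuples: measurability of the coordinates of [phi] is
    enough. *)
Lemma measurable_seq_comp d' (Y : measurableType d') (phi : X -> seq R) m (G : seq R -> Y) :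
  (forall x, size (phi x) = m) ->
  (forall i, (i < m)%N -> measurable_fun setT (fun x => nth 0 (phi x) i : R)) ->
  measurable_fun setT (fun t : m.-tuple T => G t) ->
  measurable_fun setT (fun x => G (phi x)).
Proof.
move=> sphi mphi mG.
pose psi x : m.-tuple T := Tuple (introT eqP (sphi x)).
apply: (measurableT_comp (f := fun t : m.-tuple T => G t) (g := psi)) => //.
apply/measurable_fun_tnthP => i.
rewrite (_ : _ \o _ = fun x => nth 0 (phi x) i); first exact: mphi.
by apply/funext => x /=; rewrite (tnth_nth 0).
Qed.

End measurable_seq.

Section iterated_integral.
Local Open Scope ereal_scope.
Variable R : realType.
Local Notation T := (measurableTypeR R).
Local Notation leb := (@lebesgue_measure R).
Implicit Types f g : seq R -> \bar R.

(* Functions of m variables are functions of lists, only used at lists of size m: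
   points can then be concatenated, split and compared without casts. *)
Fixpoint itint (m : nat) (f : seq R -> \bar R) : \bar R :=
  match m with
  | 0 => f [::]
  | m'.+1 => \int[leb]_x itint m' (fun s => f (x :: s))
  end.

Lemma eq_itint m f g : (forall s, size s = m -> f s = g s) ->
  itint m f = itint m g.
Proof.
elim: m f g => [|m IH] f g fg /=; first exact: fg.
by apply: eq_integral => x _; apply: IH => s sm; apply: fg; rewrite /= sm.
Qed.

Lemma itint_cat m k f :
  itint (m + k) f = itint m (fun s => itint k (fun t => f (s ++ t))).
Proof. by elim: m f => //= m IH f; apply: eq_integral => x _; rewrite IH. Qed.

Lemma itint_ge0 m f : (forall s, 0 <= f s) -> 0 <= itint m f.
Proof.
elim: m f => [|m IH] f f0 /=; first exact: f0.
by apply: integral_ge0 => x _; exact: IH.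
Qed.

Definition seq_measurable m f := measurable_fun setT (fun t : m.-tuple T => f t).

Lemma seq_measurable_joint m f : seq_measurable m.+1 f ->
  measurable_fun setT (fun p : T * m.-tuple T => f (p.1 :: p.2)).
Proof.
move=> mf; apply: (measurableT_comp mf (g := fun p : T * m.-tuple T => tuple_cons p)).
exact: measurable_tuple_cons.
Qed.

Lemma seq_measurable_cons m f x :
  seq_measurable m.+1 f -> seq_measurable m (fun s => f (x :: s)).
Proof.
move=> /seq_measurable_joint mf.
apply: (measurableT_comp mf (g := fun t : m.-tuple T => (x, t))).
exact: pair1_measurable.
Qed.

Lemma itintE m f : (forall s, 0 <= f s) -> seq_measurable m f ->
  \int[@tuple_lebesgue R m]_t f t = itint m f.
Proof.
elim: m f => [|m IH] f f0 mf.
  have /= -> := @integral_dirac _ _ ([tuple] : 0.-tuple T) R setT measurableT _ mf.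
  by rewrite diracT mul1e.
rewrite [LHS](@ge0_integral_pushforward _ _ _ _ _ _ (@measurable_tuple_cons R m)
  (leb \x @tuple_lebesgue R m)) //=.
rewrite preimage_setT fubini_tonelli1//=; last exact: seq_measurable_joint.
apply: eq_integral => x _; rewrite /fubini_F -IH//.
exact: seq_measurable_cons.
Qed.

Section parametrized.
Context d (Z : measurableType d).
Variables (m : nat) (f : Z -> seq R -> \bar R).
Hypothesis f0 : forall z s, 0 <= f z s.
Hypothesis mf : measurable_fun setT (fun p : Z * m.-tuple T => f p.1 p.2).

Lemma seq_measurable_param z : seq_measurable m (f z).
Proof.
apply: (measurableT_comp mf (g := fun t : m.-tuple T => (z, t))).
exact: pair1_measurable.
Qed.

Lemma measurable_itint : measurable_fun setT (fun z => itint m (f z)).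
Proof.
under eq_fun do rewrite -(itintE (@f0 _) (@seq_measurable_param _)).
exact: (measurable_fun_fubini_tonelli_F (m2 := @tuple_lebesgue R m) _ mf).
Qed.

Lemma itint_swap (mu : {sigma_finite_measure set Z -> \bar R}) :
  \int[mu]_z itint m (f z) = itint m (fun s => \int[mu]_z f z s).
Proof.
under eq_integral do rewrite -(itintE (@f0 _) (@seq_measurable_param _)).
rewrite -itintE.
- exact: (fubini_tonelli (m1 := mu) (m2 := @tuple_lebesgue R m) _ mf).
- by move=> s; exact: integral_ge0.
- exact: (measurable_fun_fubini_tonelli_G (m1 := mu) _ mf).
Qed.

End parametrized.

Lemma itintZl m f (c : R) : (0 <= c)%R -> (forall s, 0 <= f s) ->
  seq_measurable m f -> itint m (fun s => c%:E * f s) = c%:E * itint m f.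
Proof.
move=> c0 f0 mf; rewrite -!itintE//.
- by rewrite ge0_integralZl.
- by move=> s; rewrite mule_ge0.
- by apply: emeasurable_funM.
Qed.

End iterated_integral.

(** * Interlacing sequences *)

Section interlacing.
Variable R : realFieldType.
Implicit Types a l w s : seq R.

Fixpoint interlaced a l : bool :=
  match a, l with
  | [::], [::] => true
  | x :: a', y :: l' =>
      [&& x < y, (if a' is x' :: _ then y < x' else true) & interlaced a' l']
  | _, _ => false
  end.

Definition vandermonde s : R :=
  \prod_(0 <= j < size s) \prod_(0 <= i < j) (nth 0 s j - nth 0 s i).

Definition fracsum a w (t : R) : R :=
  \sum_(0 <= i < size a) nth 0 w i / (nth 0 a i - t).

(* The w_i of prod (l_p - t) / prod (a_i - t) = 1 + sum w_i / (a_i - t): adding the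
   pair (x, y) multiplies the expansion by (y - t) / (x - t), hence each w_i by
   (a_i - y) / (a_i - x), and the weight of x is the new residue. *)
Fixpoint weights a l : seq R :=
  match a, l with
  | x :: a', y :: l' =>
      (y - x) * (1 + fracsum a' (weights a' l') x)
      :: mkseq (fun i => nth 0 (weights a' l') i
                  * (nth 0 a' i - y) / (nth 0 a' i - x)) (size a')
  | _, _ => [::]
  end.

Lemma vandermonde_cons x s :
  vandermonde (x :: s) = (\prod_(0 <= i < size s) (nth 0 s i - x)) * vandermonde s.
Proof.
rewrite /vandermonde /= big_nat_recl//= big_geq// mul1r.
under eq_bigr do rewrite big_nat_recl//=.
by rewrite big_split.
Qed.

Lemma size_interlaced a l : interlaced a l -> size a = size l.
Proof. by elim: a l => [|x a IH] [|y l]//= /and3P[_ _ /IH ->]. Qed.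

Lemma interlaced_lt a l : interlaced a l -> sorted <%R a.
Proof.
elim: a l => [|x a IH] [|y l]//= /and3P[xy ya al].
case: a ya al IH => //= x' a ya al IH.
by rewrite (lt_trans xy ya) (IH _ al).
Qed.

Lemma interlaced_ltl x a l : interlaced a l -> (if a is x' :: _ then x < x' else true) ->
  all (> x) a && all (> x) l.
Proof.
elim: a l x => [|x' a IH] [|y l] x //= /and3P[x'y ya al] xx'.
have xy := lt_trans xx' x'y; rewrite xx' xy /=.
by apply: IH => //; case: a ya {al} => // z a; exact: lt_trans.
Qed.

Lemma sorted_gt x a : sorted <%R (x :: a) -> all (> x) a.
Proof. by move=> /=; exact: order_path_min lt_trans. Qed.

Lemma nth_gt x s i : all (> x) s -> (i < size s)%N -> x < nth 0 s i.
Proof. by move=> /all_nthP h; exact: h. Qed.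

Lemma prod_shift_gt0 x s : all (> x) s -> 0 < \prod_(0 <= i < size s) (nth 0 s i - x).
Proof.
move=> xs; rewrite big_seq; apply: prodr_gt0 => i; rewrite mem_index_iota => /= ilt.
by rewrite subr_gt0 nth_gt.
Qed.

Lemma size_weights a l : size a = size l -> size (weights a l) = size a.
Proof. by case: a l => [|x a] [|y l]//= _; rewrite size_mkseq. Qed.

Lemma vandermonde_gt0 s : sorted <%R s -> 0 < vandermonde s.
Proof.
elim: s => [|x s IH] xs; first by rewrite /vandermonde big_geq.
rewrite vandermonde_cons mulr_gt0 ?IH//; last exact: path_sorted xs.
exact/prod_shift_gt0/sorted_gt.
Qed.

Lemma fracsum_weights a l t : size a = size l -> sorted <%R a ->
  (forall i, (i < size a)%N -> nth 0 a i != t) ->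
  (\prod_(0 <= i < size a) (nth 0 a i - t)) * (1 + fracsum a (weights a l) t)
  = \prod_(0 <= p < size l) (nth 0 l p - t).
Proof.
elim: a l => [|x a IH] [|y l]//=.
  by move=> _ _ _; rewrite /fracsum !big_geq// addr0 mulr1.
move=> [sz] xa nt; rewrite big_nat_recl//= [RHS]big_nat_recl//=.
have /sorted_gt xlt := xa.
have x0 : x - t != 0 by rewrite subr_eq0 (nt 0%N).
have ax i : (i < size a)%N -> nth 0 a i - x != 0.
  by move=> /(nth_gt xlt); rewrite subr_eq0 => /gt_eqF ->.
have at_ i : (i < size a)%N -> nth 0 a i - t != 0.
  by move=> ia; rewrite subr_eq0 (nt i.+1).
rewrite -(IH l) //; first last.
- by move=> i ia; exact: (nt i.+1).
- exact: path_sorted xa.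
rewrite [X in X * _]mulrC -mulrA [RHS]mulrCA; congr (_ * _).
rewrite /fracsum /= big_nat_recl//=.
set w := weights a l.
(* Partial fractions of (a_i - y) / ((a_i - x) (a_i - t)) in a_i. The sum at x that splits off
   cancels the one inside the weight of x. *)
have -> : \sum_(0 <= i < size a) nth 0 (mkseq (fun i0 => nth 0 w i0
      * (nth 0 a i0 - y) / (nth 0 a i0 - x)) (size a)) i / (nth 0 a i - t)
   = (x - t)^-1 * ((y - t) * \sum_(0 <= i < size a) nth 0 w i / (nth 0 a i - t)
     - (y - x) * \sum_(0 <= i < size a) nth 0 w i / (nth 0 a i - x)).
  rewrite !mulr_sumr -sumrB mulr_sumr; apply: eq_big_nat => i /andP[_ ia].
  rewrite nth_mkseq//; field.
  by rewrite x0 ax// at_.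
by field.
Qed.

Lemma prod_interlaced a l t : interlaced a l -> all (> t) a ->
  (\prod_(0 <= i < size a) (nth 0 a i - t)) * (1 + fracsum a (weights a l) t)
  = \prod_(0 <= p < size l) (nth 0 l p - t).
Proof.
move=> al ta; apply: fracsum_weights.
- exact: size_interlaced.
- exact: interlaced_lt al.
- by move=> i ia; rewrite gt_eqF// nth_gt.
Qed.

End interlacing.

(** * One-variable substitution for the weight of the smallest node *)

Section pick_subst.
Local Open Scope ereal_scope.
Variable R : realType.
Local Notation T := (measurableTypeR R).
Local Notation leb := (@lebesgue_measure R).

Lemma integral_pos (H : R -> \bar R) :
  \int[leb]_(x in `]0%R, +oo[) H x = \int[leb]_x (if (0 < x)%R then H x else 0).
Proof.
rewrite integral_mkcond; apply: eq_integral => x _; rewrite patchE.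
by rewrite (_ : (x \in _) = (0 < x)%R)//; apply/idP/idP; rewrite inE/= in_itv/= andbT.
Qed.

Lemma ge0_integral_scale (c : R) (H : R -> \bar R) : (0 < c)%R ->
  measurable_fun setT (H : T -> \bar R) -> (forall x, 0 <= H x) ->
  \int[leb]_x (if (0 < x)%R then H x else 0) =
  \int[leb]_x (c%:E * (if (0 < x)%R then H (x * c)%R else 0)).
Proof.
move=> c0 mH H0; rewrite -integral_pos.
transitivity (\int[leb]_x ((subst_density 0%R +oo (fun=> c) x)%:E * H (x * c)%R)); last first.
  apply: eq_integral => x _; rewrite /subst_density ltry andbT.
  by case: ifP => _ //; rewrite mul0e mule0.
apply/esym/(@ge0_integral_subst R 0%R +oo (fun x => x * c)%R (fun=> c)) => //.
- move=> x _ _; apply: is_derive_eq (_ : is_derive x 1%R ((id : R -> R) * cst c)%R _) _.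
  by rewrite scaler0 add0r /cst /= /GRing.scale/= mulr1.
- by move=> x _ _; exact: cst_continuous.
- by rewrite mul0r.
- move=> y y0; exists (y / c)%R; rewrite divr_ge0 ?ltry ?(ltW c0)//.
  by rewrite divfK// gt_eqF.
- exact: mulrr_measurable.
Qed.

Lemma is_derive_bigsum (s : seq nat) (F : nat -> R -> R) (dF : nat -> R) (x : R) :
  (forall i, i \in s -> is_derive x 1%R (F i) (dF i)) ->
  is_derive x 1%R (fun x => \sum_(i <- s) F i x)%R (\sum_(i <- s) dF i)%R.
Proof.
elim: s => [|i s IH] dFi.
  rewrite big_nil (_ : (fun _ => _) = cst 0%R); first exact: is_derive_cst.
  by apply/funext => y; rewrite big_nil.
rewrite big_cons (_ : (fun _ => _) = F i + (fun y => \sum_(j <- s) F j y))%R; last first.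
  by apply/funext => y; rewrite big_cons.
apply: is_deriveD; first by apply: dFi; rewrite mem_head.
by apply: IH => j js; apply: dFi; rewrite inE js orbT.
Qed.

Lemma continuous_bigsum (s : seq nat) (F : nat -> R -> R) (x : R) :
  (forall i, i \in s -> {for x, continuous (F i)}) ->
  {for x, continuous (fun x => \sum_(i <- s) F i x)%R}.
Proof.
elim: s => [|i s IH] cF.
  rewrite (_ : (fun _ => _) = cst 0%R); first exact: cst_continuous.
  by apply/funext => y; rewrite big_nil.
rewrite (_ : (fun _ => _) = F i \+ (fun y => \sum_(j <- s) F j y))%R; last first.
  by apply/funext => y; rewrite big_cons.
apply: continuousD; first by apply: cF; rewrite mem_head.
by apply: IH => j js; apply: cF; rewrite inE js orbT.
Qed.

Variables (x1 : R) (a w : seq R).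
Hypotheses (x1a : sorted <%R (x1 :: a)) (w0 : all (> 0)%R w) (sw : size w = size a).

(** The weight of [x1] as a function of the entry [x] next above it. Here [w] are the final weights
    of the nodes [a]; [weights] expresses the same number through their weights before the factor
    (a_i - x) / (a_i - x1), which is why the sum is taken at [x] here and at [x1] there. *)
Definition first_weight (x : R) := ((x - x1) * (1 + fracsum a w x))%R.
Definition first_weight' (x : R) : R :=
  (1 + \sum_(0 <= i < size a)
      nth 0 w i * ((nth 0 a i - x1) * (nth 0 a i - x) ^- 2))%R.

Let bound : \bar R := if a is x' :: _ then x'%:E else +oo.

Let a_gt x i : x%:E < bound -> (i < size a)%N -> (0 < nth 0 a i - x)%R.
Proof.
rewrite subr_gt0 /bound; case: a x1a => // x' a' /= /andP[_ x'a'].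
rewrite lte_fin => xx'; case: i => //= i ia; apply: (lt_trans xx').
by apply: nth_gt => //; exact: sorted_gt.
Qed.

Let a_gt1 i : (i < size a)%N -> (0 < nth 0 a i - x1)%R.
Proof.
apply: a_gt; rewrite /bound; case: a x1a => [_|x' a' /= /andP[xx' _]].
  exact: ltry.
by rewrite lte_fin.
Qed.

Let w_gt i : (i < size a)%N -> (0 < nth 0 w i)%R.
Proof. by rewrite -sw; apply: nth_gt. Qed.

(** Between [x1] and the smallest entry of [a] the first weight has a positive derivative, vanishes
    at [x1] and tends to infinity at that entry, its first pole. For empty [a] it is x - x1 on a
    half-line. *)
Lemma ge0_integral_first_weight (G : R -> \bar R) :
  measurable_fun setT (G : T -> \bar R) -> (forall x, 0 <= G x) ->
  \int[leb]_x (if (x1 < x)%R && (if a is x' :: _ then x < x' else true)%R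
               then (first_weight' x)%:E * G (first_weight x) else 0) =
  \int[leb]_y (if (0 < y)%R then G y else 0).
Proof.
move=> mG G0; rewrite -integral_pos.
transitivity (\int[leb]_x ((subst_density x1 bound first_weight' x)%:E
    * G (first_weight x))).
  apply: eq_integral => x _; rewrite /subst_density.
  rewrite (_ : (if a is x' :: _ then x < x' else true)%R = (x%:E < bound)); last first.
    by rewrite /bound; case: a => [|x' a']; rewrite ?ltry ?lte_fin.
  by case: ifP => // _; rewrite mul0e.
apply: (@ge0_integral_subst R x1 bound first_weight first_weight') => //.
- move=> x x1x xb.
  have D : is_derive x 1%R (fun y => \sum_(0 <= i < size a) nth 0 w i / (nth 0 a i - y))%R
      (\sum_(0 <= i < size a) nth 0 w i * (nth 0 a i - x) ^- 2)%R.
    apply: is_derive_bigsum => i; rewrite mem_index_iota => /= ia.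
    have /gt_eqF/negbT ax := a_gt xb ia.
    have D1 : is_derive x 1%R (cst (nth 0 a i) - id : R -> R)%R (0 - 1)%R by exact: is_deriveB.
    have D2 := is_deriveM (is_derive_cst (nth 0%R w i) x 1%R) (@is_deriveV _ (cst (nth 0 a i) -
      id : R -> R)%R x _ 1%R ax D1).
    apply: is_derive_eq D2 _.
    by rewrite /GRing.scale/= /cst !(mulr0,addr0,sub0r) mulrN1 opprK.
  have D1 : is_derive x 1%R (id - cst x1 : R -> R)%R (1 - 0)%R by exact: is_deriveB.
  have D2 := is_deriveD (is_derive_cst (1%R : R) x 1%R) D.
  apply: is_derive_eq (is_deriveM D1 D2) _.
  rewrite /GRing.scale/= /cst /first_weight' add0r subr0 mulr1.
  rewrite [X in (_ + X)%R](_ : _ = 1 + \sum_(0 <= i < size a) nth 0 w i / (nth 0 a i - x))%R //.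
  rewrite addrCA; congr (_ + _)%R; rewrite mulr_sumr -big_split /=.
  apply: eq_big_nat => i ia; have /gt_eqF/negbT ax := a_gt xb ia.
  by rewrite (_ : (id - (fun=> x1)) x = x - x1)%R //; field.
- move=> x _ xb; apply: continuousD; first exact: cst_continuous.
  apply: continuous_bigsum => i; rewrite mem_index_iota => /= ia.
  have /gt_eqF/negbT ax := a_gt xb ia.
  apply: continuousM; first exact: cst_continuous.
  apply: continuousM; first exact: cst_continuous.
  apply: continuousV; first by rewrite expf_neq0.
  apply: (@continuous_comp _ _ _ (fun x => nth 0 a i - x)%R (fun x => x ^+ 2)%R).
    by apply: continuousB; [exact: cst_continuous|exact: cvg_id].
  exact: exprn_continuous.
- move=> x _ xb; rewrite ltr_wpDr// big_nat; apply: sumr_ge0 => i /= ia.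
  by rewrite mulr_ge0 ?(ltW (w_gt ia))// mulr_ge0 ?(ltW (a_gt1 ia))// invr_ge0 sqr_ge0.
- by rewrite /first_weight subrr mul0r.
- move=> y y0; rewrite /first_weight /fracsum /bound.
  have := a_gt; rewrite /bound.
  case: a x1a w_gt => [_ _ _|x' a' /= /andP[xx' _] wg ag].
    exists (y + x1)%R; rewrite ltry; split => //; first by rewrite lerDr.
    by rewrite big_geq// addr0 mulr1 addrK.
  have W0 := wg 0%N isT.
  (* The point x divides [x1, x'] so that (x - x1) / (x' - x) = t; the term of [x'] alone then
     equals y, and the other terms are nonnegative. *)
  pose t := (y / nth 0 w 0)%R.
  have t0 : (0 <= t)%R by rewrite divr_ge0// ltW.
  have t1 : (0 < 1 + t)%R by rewrite ltr_pwDl.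
  pose x := ((x1 + t * x') / (1 + t))%R.
  have xE : (x - x1 = t * (x' - x1) / (1 + t))%R by rewrite /x; field; rewrite gt_eqF.
  have x'E : (x' - x = (x' - x1) / (1 + t))%R by rewrite /x; field; rewrite gt_eqF.
  have dx : (0 < x' - x1)%R by rewrite subr_gt0.
  have x1x : (0 <= x - x1)%R by rewrite xE; apply: divr_ge0; [apply: mulr_ge0 => //|]; exact: ltW.
  have xx'0 : (0 < x' - x)%R by rewrite x'E divr_gt0.
  have xb : x%:E < x'%:E by rewrite lte_fin -subr_gt0.
  exists x; split; [by rewrite -subr_ge0|exact: xb|].
  rewrite big_nat_recl//= addrCA mulrDr.
  have -> : ((x - x1) * (nth 0 w 0 / (x' - x)) = y)%R.
    by rewrite xE x'E /t; field; rewrite !gt_eqF// ltr_pwDl.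
  apply: (@ler_wpDr R) => //.
  rewrite mulr_ge0// addr_ge0// big_nat; apply: sumr_ge0 => i ia.
  by apply: divr_ge0; apply: ltW; [exact: (wg i.+1)|exact: (ag x i.+1 xb ia)].
- apply: measurable_funM; first exact: measurable_funB.
  apply: measurable_funD => //; apply: measurable_sum => i.
  by apply: measurable_funM => //; apply: measurable_funV; apply: measurable_funB.
- apply: measurable_funD => //; apply: measurable_sum => i.
  apply: measurable_funM => //; apply: measurable_funM => //; apply: measurable_funV.
  by apply: measurable_funX; apply: measurable_funB.
Qed.

End pick_subst.

(** * Change of variables from interlacing sequences to weights *)

Section interlacing_change_of_variables.
Local Open Scope ereal_scope.
Variable R : realType.
Local Notation T := (measurableTypeR R).
Local Notation leb := (@lebesgue_measure R).
Implicit Type G : seq R -> \bar R.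

Lemma itint0 m : @itint R m (fun=> 0) = 0.
Proof. by elim: m => //= m IH; rewrite integral0_eq. Qed.

Lemma measurable_all_pos m d (X : measurableType d) (phi : X -> m.-tuple T) :
  measurable_fun setT phi ->
  measurable_fun setT (fun x => all (> 0)%R (phi x : seq R)).
Proof.
move=> mphi.
rewrite (_ : (fun _ => _) =
    fun x => \big[andb/true]_(i <- iota 0 m) (0 < nth 0 (phi x : seq R) i)%R).
  apply: measurable_big_andb => i _; apply: measurable_fun_ltr => //.
  exact: measurable_nth_comp.
apply/funext => x; rewrite big_all -[in LHS](mkseq_nth 0%R (phi x)) size_tuple.
by rewrite /mkseq all_map.
Qed.

Lemma itint_pos_cons m G :
  itint m.+1 (fun s => if all (> 0)%R s then G s else 0) =
  \int[leb]_x (if (0 < x)%R then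
    itint m (fun s => if all (> 0)%R s then G (x :: s) else 0) else 0).
Proof.
apply: eq_integral => x _; case: ifPn => x0; first by apply: eq_itint => s _ /=; rewrite x0.
by rewrite -[RHS](itint0 m); apply: eq_itint => s _ /=; rewrite (negbTE x0).
Qed.

Lemma seq_measurable_mkseq m d (X : measurableType d) (f : nat -> X -> R) G :
  seq_measurable m G -> (forall i, (i < m)%N -> measurable_fun setT (f i)) ->
  measurable_fun setT (fun x => G (mkseq (f ^~ x) m)).
Proof.
move=> mG mf; apply: (measurable_seq_comp (m := m)) => //.
  by move=> x; rewrite size_mkseq.
move=> i im; rewrite (_ : (fun _ => _) = f i); first exact: mf.
by apply/funext => x; rewrite nth_mkseq.
Qed.

Lemma itint_scale m (c : nat -> R) G : (forall i, (i < m)%N -> (0 < c i)%R) ->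
  (forall s, 0 <= G s) -> seq_measurable m G ->
  itint m (fun s => if all (> 0)%R s then G s else 0) =
  itint m (fun s => (\prod_(0 <= i < m) c i)%:E *
    (if all (> 0)%R s then G (mkseq (fun i => nth 0 s i * c i)%R m) else 0)).
Proof.
elim: m c G => [|m IH] c G c0 G0 mG; first by rewrite /= big_geq// mul1e.
pose H x := itint m (fun s => if all (> 0)%R s then G (x :: s) else 0).
rewrite itint_pos_cons -/(H _) (@ge0_integral_scale _ (c 0%N))//; first last.
- by move=> x; apply: itint_ge0 => s; case: ifP.
- apply: (measurable_itint (f := fun x s => if all _ s then _ else _)).
    by move=> z s; case: ifP.
  apply: measurable_fun_if0; first exact: measurable_all_pos.
  exact: seq_measurable_joint.
- exact: c0.
apply: eq_integral => x _.
have mH : seq_measurable m (fun s => if all (> 0)%R s then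
     G (x * c 0%N :: mkseq (fun i => nth 0 s i * c i.+1) m)%R else 0).
  apply: measurable_fun_if0; first exact: measurable_all_pos.
  apply: (@seq_measurable_mkseq m _ _
      (fun i (t : m.-tuple T) => nth 0 (t : seq R) i * c i.+1)%R
      (fun s => G ((x * c 0%N)%R :: s))).
    exact: seq_measurable_cons.
  by move=> i _; apply: measurable_funM => //; exact: measurable_nth.
case: ifPn => x0; last first.
  by rewrite mule0 -[LHS](itint0 m); apply: eq_itint => s _ /=; rewrite (negbTE x0) mule0.
rewrite /H (IH (fun i => c i.+1)) => [|i im|//|]; first last.
- exact: seq_measurable_cons.
- exact: c0.
rewrite -itintZl ?(ltW (c0 0%N _))//; first last.
- by apply: emeasurable_funM.
- move=> s; rewrite mule_ge0//; last by case: ifP.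
  by rewrite lee_fin big_nat; apply: prodr_ge0 => i im; apply: ltW; exact: c0.
apply: eq_itint => s sm /=; rewrite x0 /= big_nat_recl//= EFinM muleA.
congr (_ * (if _ then G (_ :: _) else _)).
change (mkseq (fun i => nth 0 s i * c i.+1)%R m
  = map (fun i => nth 0 (x :: s) i * c i)%R (iota 1 m)).
by rewrite (iotaDl 1 0 m : iota 1 m = _) -map_comp.
Qed.

Lemma measurable_fracsum d (X : measurableType d) m (a : seq R)
    (phi : X -> m.-tuple T) (g : X -> R) :
  measurable_fun setT phi -> measurable_fun setT g ->
  measurable_fun setT (fun x => fracsum a (phi x) (g x)).
Proof.
move=> mphi mg; apply: measurable_sum => i; apply: measurable_funM.
  exact: measurable_nth_comp.
by apply: measurable_funV; exact: measurable_funB.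
Qed.

Lemma head_lt_all x (a : seq R) : sorted <%R a ->
  (if a is x' :: _ then x < x' else true)%R -> all (> x)%R a.
Proof.
case: a => //= x' a sa xx'; rewrite xx' /=.
by apply: sub_all (sorted_gt sa) => z; exact: lt_trans.
Qed.

Lemma nth_pos_ge0 (w : seq R) i : all (> 0)%R w -> (0 <= nth 0 w i)%R.
Proof.
move=> w0; have [iw|wi] := ltnP i (size w); first by rewrite ltW// nth_gt.
by rewrite nth_default.
Qed.

(** At w = [weights a l] this is, by [prod_interlaced], the product of the l_p - x, the factor that
    [x] adds to the Vandermonde product of [l]. The absolute value makes it nonnegative at every
    list, as Tonelli requires. *)
Let peel (a : seq R) (x1 x : R) (w : seq R) :=
  `|(\prod_(0 <= i < size a) (nth 0 a i - x)) * (1 + fracsum a w x)|%R.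

Let peeled (a : seq R) (x1 x : R) (w : seq R) :=
  ((x - x1) * (1 + fracsum a w x1))%R ::
  mkseq (fun i => nth 0 w i * (nth 0 a i - x) / (nth 0 a i - x1))%R (size a).

Let measurable_peeled a x1 x G : seq_measurable (size a).+1 G ->
  seq_measurable (size a) (fun w => (peel a x1 x w)%:E * G (peeled a x1 x w)).
Proof.
move=> mG; apply: emeasurable_funM.
  apply/measurable_EFinP/measurableT_comp => //; apply: measurable_funM => //.
  by apply: measurable_funD => //; apply: measurable_fracsum.
apply: (measurable_seq_comp (m := (size a).+1)) => //.
  by move=> t; rewrite /= size_mkseq.
case=> [|i] ia /=.
  apply: measurable_funM => //; apply: measurable_funD => //.
  exact: measurable_fracsum.
rewrite (_ : (fun _ => _) = fun t : (size a).-tuple T =>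
    nth 0 (t : seq R) i * ((nth 0 a i - x) / (nth 0 a i - x1)))%R; last first.
  by apply/funext => t; rewrite nth_mkseq// mulrA.
by apply: measurable_funM => //; exact: measurable_nth.
Qed.

Let peel_interlaced a l x1 x G : interlaced a l -> all (> x)%R a ->
  (vandermonde (x :: l))%:E * G (weights (x1 :: a) (x :: l)) =
  (vandermonde l)%:E * ((peel a x1 x (weights a l))%:E * G (peeled a x1 x (weights a l))).
Proof.
move=> al xa; rewrite vandermonde_cons mulrC EFinM -muleA; congr (_ * (_ * _)).
rewrite /peel prod_interlaced// gtr0_norm//; apply: prod_shift_gt0.
suff /andP[] : all (> x)%R a && all (> x)%R l by [].
by apply: interlaced_ltl al _; case: a xa => //= ? ? /andP[].
Qed.

(** Expressing the old weights by the final ones makes the derivative of the first weight appear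
    inside [peel]. Together with the Jacobian of the scaling there remains the product of the a_i -
    x1, the factor that [x1] adds to the Vandermonde product of [a]. *)
Let peeled_scale (a w : seq R) x1 x G : size w = size a -> all (> 0)%R w ->
  all (> x1)%R a -> all (> x)%R a ->
  let w' := mkseq (fun i => nth 0 w i * ((nth 0 a i - x1) / (nth 0 a i - x)))%R (size a) in
  (\prod_(0 <= i < size a) ((nth 0 a i - x1) / (nth 0 a i - x)))%:E *
     ((peel a x1 x w')%:E * G (peeled a x1 x w')) =
  (\prod_(0 <= i < size a) (nth 0 a i - x1))%:E *
  ((first_weight' x1 a w x)%:E * G (first_weight x1 a w x :: w)).
Proof.
move=> sw w0 x1a xa w'.
have a1 i : (i < size a)%N -> (0 < nth 0 a i - x1)%R by move=> ia; rewrite subr_gt0 nth_gt.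
have ax i : (i < size a)%N -> (0 < nth 0 a i - x)%R by move=> ia; rewrite subr_gt0 nth_gt.
have -> : peeled a x1 x w' = first_weight x1 a w x :: w.
  congr (_ :: _).
    congr (_ * (1 + _))%R; apply: eq_big_nat => i /= ia.
    by rewrite nth_mkseq//; field; rewrite !gt_eqF// ?a1// ax.
  apply: (@eq_from_nth _ 0%R); rewrite size_mkseq// => i ia; rewrite !nth_mkseq//.
  by field; rewrite !gt_eqF// ?a1// ax.
rewrite !muleA -!EFinM; congr (_%:E * _).
have -> : peel a x1 x w' = (\prod_(0 <= i < size a) (nth 0 a i - x) * first_weight' x1 a w x)%R.
  rewrite /peel (_ : (1 + fracsum a w' x)%R = first_weight' x1 a w x); last first.
    congr (1 + _)%R; apply: eq_big_nat => i /= ia.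
    by rewrite nth_mkseq//; field; rewrite !gt_eqF// ?a1// ax.
  rewrite gtr0_norm// mulr_gt0 ?prod_shift_gt0// ltr_wpDr// big_nat.
  apply: sumr_ge0 => i /= ia; rewrite mulr_ge0//.
    by rewrite ltW// nth_gt// sw.
  by rewrite mulr_ge0 ?invr_ge0 ?exprn_ge0// ltW// ?a1// ax.
rewrite mulrA; congr (_ * _)%R; rewrite -big_split/=.
by apply: eq_big_nat => i /= ia; rewrite divfK// gt_eqF// ax.
Qed.

(** Induction on the nodes. At fixed first entry x the induction hypothesis turns the other entries
    into weights, and a scaling turns these into final weights; then the integrals are exchanged and
    x is replaced by the first weight. *)
Lemma itint_interlaced (a : seq R) G : sorted <%R a -> (forall s, 0 <= G s) ->
  seq_measurable (size a) G ->
  itint (size a) (fun l => if interlaced a l then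
    (vandermonde l)%:E * G (weights a l) else 0) =
  (vandermonde a)%:E *
  itint (size a) (fun w => if all (> 0)%R w then G w else 0).
Proof.
elim: a G => [|x1 a IH] G sa G0 mG.
  by rewrite /= /vandermonde big_geq.
have sa' : sorted <%R a by exact: path_sorted sa.
have a1 : all (> x1)%R a by exact: sorted_gt.
pose inb x := (x1 < x)%R && (if a is x' :: _ then x < x' else true)%R.
pose F (x : R) (w : seq R) := if inb x && all (> 0)%R w then
  (first_weight' x1 a w x)%:E * G (first_weight x1 a w x :: w) else 0.
have a_gt x : inb x -> all (> x)%R a by move=> /andP[_]; exact: head_lt_all.
have fw0 x w : inb x -> all (> 0)%R w -> (0 <= first_weight' x1 a w x)%R.
  move=> xb w0; rewrite addr_ge0// big_nat; apply: sumr_ge0 => i /= ia.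
  rewrite mulr_ge0 ?nth_pos_ge0//.
  by rewrite mulr_ge0 ?invr_ge0 ?sqr_ge0// subr_ge0 ltW// nth_gt.
have F0 x w : 0 <= F x w.
  rewrite /F; case: ifPn => // /andP[xb w0].
  by rewrite mule_ge0// lee_fin fw0.
have minb : measurable_fun setT (inb : T -> bool).
  apply: measurable_and; first exact: measurable_fun_ltr.
  by case: {+}a => // x' _; exact: measurable_fun_ltr.
have mF : measurable_fun setT (fun p : T * (size a).-tuple T => F p.1 p.2).
  apply: measurable_fun_if0.
    apply: measurable_and; last exact: measurable_all_pos.
    exact: measurableT_comp minb measurable_fst.
  apply: emeasurable_funM.
    apply/measurable_EFinP; apply: measurable_funD => //.
    apply: measurable_sum => i; apply: measurable_funM; first exact: measurable_nth_comp.
    apply: measurable_funM => //; apply: measurable_funV; apply: measurable_funX.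
    exact: measurable_funB.
  apply: (measurable_seq_comp (m := (size a).+1)) => //.
    by move=> p /=; rewrite size_tuple.
  case=> [|i] ia /=; last exact: measurable_nth_comp.
  apply: measurable_funM; first exact: measurable_funB.
  by apply: measurable_funD => //; exact: measurable_fracsum.
have step1 x : itint (size a) (fun l => if interlaced (x1 :: a) (x :: l) then
      (vandermonde (x :: l))%:E * G (weights (x1 :: a) (x :: l)) else 0) =
    (vandermonde (x1 :: a))%:E * itint (size a) (F x).
  have [xb|xb] := boolP (inb x); last first.
    rewrite [X in _ * X](_ : _ = 0) ?mule0 -?[RHS](itint0 (size a)).
      by apply: eq_itint => l _ /=; rewrite andbA -/(inb x) (negbTE xb).
    by apply: eq_itint => w _; rewrite /F (negbTE xb).
  transitivity (itint (size a) (fun l => if interlaced a l then (vandermonde l)%:E *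
      ((peel a x1 x (weights a l))%:E * G (peeled a x1 x (weights a l))) else 0)).
    apply: eq_itint => l _; rewrite [interlaced _ _]/= andbA -/(inb x) xb andTb.
    by case: ifP => // al; rewrite (peel_interlaced x1 G al (a_gt _ xb)).
  rewrite (IH (fun w => (peel a x1 x w)%:E * G (peeled a x1 x w)))//; first last.
  - exact: measurable_peeled.
  - by move=> s; rewrite mule_ge0// lee_fin normr_ge0.
  rewrite vandermonde_cons mulrC EFinM -muleA; congr (_ * _).
  rewrite -itintZl//; first last.
  - exact: seq_measurable_param mF x.
  - by rewrite ltW// prod_shift_gt0.
  rewrite (@itint_scale _ (fun i => (nth 0 a i - x1) / (nth 0 a i - x))%R); first last.
  - exact: measurable_peeled.
  - by move=> s; rewrite mule_ge0// lee_fin normr_ge0.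
  - by move=> i ia; rewrite divr_gt0// subr_gt0 nth_gt// a_gt.
  apply: eq_itint => w sw; rewrite /F xb /=; case: ifP => w0; last by rewrite !mule0.
  by apply: (peeled_scale G) => //; exact: a_gt.
transitivity (\int[leb]_x ((vandermonde (x1 :: a))%:E * itint (size a) (F x))).
  by apply: eq_integral => x _; rewrite -step1.
rewrite ge0_integralZl//; first last.
- by rewrite lee_fin ltW// vandermonde_gt0.
- by move=> x _; exact: itint_ge0.
- exact: measurable_itint.
(* With the integral over x innermost the weights w are constants, which the one-variable
   substitution presupposes. *)
congr (_ * _); rewrite itint_swap// [RHS]itint_pos_cons.
transitivity (\int[leb]_y itint (size a) (fun w =>
    if (0 < y)%R && all (> 0)%R w then G (y :: w) else 0)); last first.
  apply: eq_integral => y _; case: ifP => //= _; exact: itint0.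
rewrite itint_swap//; first last.
- apply: measurable_fun_if0; last exact: seq_measurable_joint.
  by apply: measurable_and; [exact: measurable_fun_ltr|exact: measurable_all_pos].
- by move=> y w; case: ifP.
apply: eq_itint => w sw; rewrite /F; case: (boolP (all _ w)) => w0; last first.
  by rewrite !integral0_eq// => y _; rewrite andbF.
under eq_integral do rewrite andbT; under [RHS]eq_integral do rewrite andbT.
apply: ge0_integral_first_weight => //.
apply: (measurable_seq_comp (m := (size a).+1)) => //.
  by move=> y /=; rewrite sw.
by case=> [|i] _ /=; [exact: measurable_id|exact: measurable_cst].
Qed.

End interlacing_change_of_variables.

(** * Complex-valued integrals *)

Section complex_integral.
Variable R : realType.
Local Notation C := R[i].
Local Notation Re := (@complex.Re R).
Local Notation Im := (@complex.Im R).

Lemma ReM (z w : C) : Re (z * w) = Re z * Re w - Im z * Im w.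
Proof. by case: z => a b; case: w => c d. Qed.

Lemma ImM (z w : C) : Im (z * w) = Re z * Im w + Im z * Re w.
Proof. by case: z => a b; case: w => c d. Qed.

Lemma complex_eq (z w : C) : Re z = Re w -> Im z = Im w -> z = w.
Proof. by case: z => a b; case: w => c d /= -> ->. Qed.

(** The modulus as a real number: the norm of [R[i]] takes its values in [R[i]]. *)
Definition cnorm (z : C) : R := Re `|z|.

Lemma cnormE z : (cnorm z)%:C%C = `|z|.
Proof. by rewrite /cnorm normc_def. Qed.

Lemma cnormM z w : cnorm (z * w) = cnorm z * cnorm w.
Proof. by apply: (@complexI R); rewrite rmorphM /= !cnormE normrM. Qed.

Lemma cnorm_ge0 z : 0 <= cnorm z.
Proof. by rewrite -lecR cnormE normr_ge0. Qed.

Lemma cnorm0 : cnorm 0 = 0.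
Proof. by rewrite /cnorm normr0. Qed.

Lemma Re_le_cnorm z : `|Re z| <= cnorm z.
Proof. by rewrite /cnorm normc_def/= -sqrtr_sqr ler_wsqrtr// lerDl sqr_ge0. Qed.

Lemma Im_le_cnorm z : `|Im z| <= cnorm z.
Proof. by rewrite /cnorm normc_def/= -sqrtr_sqr ler_wsqrtr// lerDr sqr_ge0. Qed.

Lemma cnorm_le z : cnorm z <= `|Re z| + `|Im z|.
Proof.
rewrite /cnorm normc_def/= -[leRHS]ger0_norm ?addr_ge0// -[leRHS]sqrtr_sqr.
rewrite ler_wsqrtr// sqrrD !real_normK ?num_real// addrAC lerDl.
by rewrite mulrn_wge0// mulr_ge0.
Qed.

(** [b1] selects the imaginary instead of the real part, [b2] the negative instead of the positive
    part of it. Each choice is positively homogeneous, hence commutes with nonnegative Jacobians. *)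
Definition cpart (b1 b2 : bool) (z : C) : R :=
  Num.max ((-1) ^+ b2 * (if b1 then Im z else Re z)) 0.

Lemma cpart_ge0 b1 b2 z : 0 <= cpart b1 b2 z.
Proof. by rewrite le_max lexx orbT. Qed.

Lemma cpart0 b1 b2 : cpart b1 b2 0 = 0.
Proof. by rewrite /cpart; case: b1; rewrite mulr0 maxxx. Qed.

Lemma cpartZ b1 b2 (r : R) z : 0 <= r -> cpart b1 b2 (r%:C%C * z) = r * cpart b1 b2 z.
Proof.
move=> r0; rewrite /cpart maxr_pMr// mulr0 mulrCA; congr (Num.max (_ * _) _).
by case: b1; rewrite ?ReM ?ImM /= mul0r ?addr0 ?subr0.
Qed.

Section cmeasurable.
Context d (T : measurableType d).
Implicit Types f g : T -> C.

Definition cmeasurable f :=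
  measurable_fun setT (fun x => Re (f x)) /\ measurable_fun setT (fun x => Im (f x)).

Lemma cmeasurable_cst z : cmeasurable (fun=> z).
Proof. by split; exact: measurable_cst. Qed.

Lemma cmeasurableM f g : cmeasurable f -> cmeasurable g ->
  cmeasurable (fun x => f x * g x).
Proof.
move=> [f1 f2] [g1 g2]; split.
  under eq_fun do rewrite ReM.
  by apply: measurable_funB; apply: measurable_funM.
under eq_fun do rewrite ImM.
by apply: measurable_funD; apply: measurable_funM.
Qed.

Lemma cmeasurable_prod (I : eqType) (s : seq I) (f : I -> T -> C) :
  (forall i, i \in s -> cmeasurable (f i)) ->
  cmeasurable (fun x => \prod_(i <- s) f i x).
Proof.
elim: s => [|i s IH] mf.
  rewrite (_ : (fun _ => _) = fun=> 1); first exact: cmeasurable_cst.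
  by apply/funext => x; rewrite big_nil.
rewrite (_ : (fun _ => _) = fun x => f i x * \prod_(j <- s) f j x).
  apply: cmeasurableM; first by apply: mf; rewrite mem_head.
  by apply: IH => j js; apply: mf; rewrite inE js orbT.
by apply/funext => x; rewrite big_cons.
Qed.

Lemma cmeasurable_real (f : T -> R) : measurable_fun setT f ->
  cmeasurable (fun x => (f x)%:C%C).
Proof. by move=> mf; split => //=; exact: measurable_cst. Qed.

Lemma cmeasurable_if0 (b : T -> bool) f : measurable_fun setT b -> cmeasurable f ->
  cmeasurable (fun x => if b x then f x else 0).
Proof.
move=> mb [f1 f2]; split.
  rewrite (_ : (fun _ => _) = fun x => if b x then Re (f x) else 0).
    exact: measurable_fun_ifT.
  by apply/funext => x; case: ifP.
rewrite (_ : (fun _ => _) = fun x => if b x then Im (f x) else 0).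
  exact: measurable_fun_ifT.
by apply/funext => x; case: ifP.
Qed.

Lemma measurable_cpart b1 b2 f : cmeasurable f ->
  measurable_fun setT (fun x => cpart b1 b2 (f x)).
Proof.
move=> [f1 f2]; apply: measurable_maxr => //; apply: measurable_funM => //.
by case: b1.
Qed.

Lemma measurable_cnorm f : cmeasurable f -> measurable_fun setT (fun x => cnorm (f x)).
Proof.
move=> [f1 f2].
rewrite (_ : (fun _ => _) = fun x => Num.sqrt (Re (f x) ^+ 2 + Im (f x) ^+ 2)).
  apply: (measurableT_comp (f := @Num.sqrt R : measurableTypeR R -> measurableTypeR R)).
    by apply: continuous_measurable_fun; exact: sqrt_continuous.
  by apply: measurable_funD; apply: measurable_funX.
by apply/funext => x; rewrite /cnorm normc_def.
Qed.

End cmeasurable.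

Lemma cmeasurable_comp d d' (T : measurableType d) (T' : measurableType d')
    (f : T -> C) (phi : T' -> T) : measurable_fun setT phi ->
  cmeasurable f -> cmeasurable (fun x => f (phi x)).
Proof. by move=> mphi [f1 f2]; split; [exact: (measurableT_comp f1)|exact: (measurableT_comp f2)]. Qed.

Section has_cint.
Context d (T : measurableType d).
Implicit Types f g : T -> C.
Implicit Type mu : {measure set T -> \bar R}.

(** Convergence travels with the value, since [cintegral] alone returns a default number when an
    integral is infinite. *)
Definition has_cint mu f (v : C) :=
  abs_integrable mu setT f /\ cintegral mu setT f = v.

Lemma abs_integrableP mu f : abs_integrable mu setT f <->
  mu.-integrable setT (fun x => (Re (f x))%:E) /\
  mu.-integrable setT (fun x => (Im (f x))%:E).
Proof.
split=> [[m1 m2 foo]|[/integrableP[/measurable_EFinP m1 i1] /integrableP[/measurable_EFinP m2 i2]]].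
  have mN : measurable_fun setT (fun x => cnorm (f x)) by exact: measurable_cnorm.
  split; apply/integrableP; (split; first exact/measurable_EFinP);
    apply: le_lt_trans foo; apply: ge0_le_integral => //.
  - by apply: measurableT_comp => //; exact/measurable_EFinP.
  - exact/measurable_EFinP.
  - by move=> x _; rewrite lee_fin Re_le_cnorm.
  - by apply: measurableT_comp => //; exact/measurable_EFinP.
  - exact/measurable_EFinP.
  - by move=> x _; rewrite lee_fin Im_le_cnorm.
split => //; apply: le_lt_trans (lte_add_pinfty i1 i2).
have mN : measurable_fun setT (fun x => cnorm (f x)) by exact: measurable_cnorm.
rewrite -ge0_integralD//.
- apply: ge0_le_integral => //.
  + by move=> x _; rewrite lee_fin cnorm_ge0.
  + exact/measurable_EFinP.
  + by apply: emeasurable_funD; apply: measurableT_comp => //; exact/measurable_EFinP.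
  + by move=> x _; rewrite -EFinD lee_fin cnorm_le.
- by apply: measurableT_comp => //; exact/measurable_EFinP.
- by apply: measurableT_comp => //; exact/measurable_EFinP.
Qed.

Lemma abs_integrable_cmeasurable mu f : abs_integrable mu setT f -> cmeasurable f.
Proof. by case. Qed.

Let re_cpart f b1 : (fun x => (if b1 then Im (f x) else Re (f x))%:E)^\+%E
   = (fun x => (cpart b1 false (f x))%:E).
Proof. by apply/funext => x; rewrite funeposE /cpart mul1r -EFin_max. Qed.

Let im_cpart f b1 : (fun x => (if b1 then Im (f x) else Re (f x))%:E)^\-%E
   = (fun x => (cpart b1 true (f x))%:E).
Proof. by apply/funext => x; rewrite funenegE /cpart mulN1r -EFin_max. Qed.

Let integral_part mu f b1 :
  (\int[mu]_x (if b1 then Im (f x) else Re (f x))%:E =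
   \int[mu]_x (cpart b1 false (f x))%:E - \int[mu]_x (cpart b1 true (f x))%:E)%E.
Proof. by rewrite integralE re_cpart im_cpart. Qed.

(** The modulus dominates each of the four parts and is at most their sum. *)
Lemma abs_integrable_cpart mu f : cmeasurable f ->
  abs_integrable mu setT f <->
  forall b1 b2, (\int[mu]_x (cpart b1 b2 (f x))%:E < +oo)%E.
Proof.
move=> mf; have mc b1 b2 := measurable_cpart b1 b2 mf; split.
  move=> [_ _ foo] b1 b2; apply: le_lt_trans foo.
  apply: ge0_le_integral => //.
  - by move=> x _; rewrite lee_fin cpart_ge0.
  - exact/measurable_EFinP.
  - exact/measurable_EFinP/measurable_cnorm.
  - move=> x _; rewrite lee_fin ge_max cnorm_ge0 andbT.
    have N (r : R) : (-1) ^+ b2 * r <= `|r|.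
      by case: b2; rewrite ?mulN1r ?mul1r ?ler_norm// -normrN ler_norm.
    by case: b1; apply: le_trans (N _) _; rewrite ?Im_le_cnorm ?Re_le_cnorm.
have [m1 m2] := mf; move=> foo; split => //.
apply: le_lt_trans (_ : (\int[mu]_x ((cpart false false (f x))%:E +
  (cpart false true (f x))%:E + ((cpart true false (f x))%:E + (cpart true true (f x))%:E)) < +oo)%E).
  apply: ge0_le_integral => //.
  - by move=> x _; rewrite lee_fin cnorm_ge0.
  - exact/measurable_EFinP/measurable_cnorm.
  - by do 2 apply: emeasurable_funD; exact/measurable_EFinP.
  - move=> x _; rewrite -!EFinD lee_fin; apply: le_trans (cnorm_le _) _.
    have N (r : R) : `|r| <= Num.max (1 * r) 0 + Num.max ((-1) * r) 0.
      have h1 := cpart_ge0 false false r%:C%C; have h2 := cpart_ge0 false true r%:C%C.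
      have h3 : r <= Num.max r 0 by rewrite le_max lexx.
      have h4 : - r <= Num.max (- r) 0 by rewrite le_max lexx.
      rewrite /cpart/= mul1r mulN1r in h1 h2 *.
      by rewrite ler_norml; apply/andP; split; lra.
    by apply: lerD; exact: N.
have mE b1 b2 : measurable_fun setT (fun x => (cpart b1 b2 (f x))%:E).
  exact/measurable_EFinP.
have c0 b1 b2 x : (0 <= (cpart b1 b2 (f x))%:E)%E by rewrite lee_fin cpart_ge0.
rewrite ge0_integralD//; last 4 first.
- by move=> x _; rewrite adde_ge0.
- exact: emeasurable_funD.
- by move=> x _; rewrite adde_ge0.
- exact: emeasurable_funD.
by rewrite lte_add_pinfty// ge0_integralD// lte_add_pinfty.
Qed.

Lemma has_cint_unique mu f v w : has_cint mu f v -> has_cint mu f w -> v = w.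
Proof. by move=> [_ <-] [_ <-]. Qed.

Lemma eq_has_cint mu f g v : f =1 g -> has_cint mu f v -> has_cint mu g v.
Proof. by move=> /funext ->. Qed.

Lemma cintegral_cpart mu f : cintegral mu setT f =
  (fine (\int[mu]_x (cpart false false (f x))%:E - \int[mu]_x (cpart false true (f x))%:E)%E +i*
   fine (\int[mu]_x (cpart true false (f x))%:E - \int[mu]_x (cpart true true (f x))%:E)%E)%C.
Proof. by rewrite /cintegral /Rintegral -!integral_part. Qed.

End has_cint.

(* Reduces an identity between complex integrals to one between integrals of
   nonnegative functions, for which no integrability is needed. *)
Lemma has_cint_transfer d d' (T : measurableType d) (T' : measurableType d')
    (mu : {measure set T -> \bar R}) (nu : {measure set T' -> \bar R})
    (f : T -> C) (g : T' -> C) v :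
  cmeasurable g ->
  (forall b1 b2, (\int[mu]_x (cpart b1 b2 (f x))%:E = \int[nu]_y (cpart b1 b2 (g y))%:E)%E) ->
  has_cint mu f v -> has_cint nu g v.
Proof.
move=> mg E [iF <-]; split; last by rewrite !cintegral_cpart !E.
apply/abs_integrable_cpart => // b1 b2; rewrite -E.
by move/(abs_integrable_cpart mu (abs_integrable_cmeasurable iF)) : iF.
Qed.

End complex_integral.

(** * Linearity and Fubini for complex-valued functions *)

Section complex_fubini.
Variable R : realType.
Local Notation C := R[i].
Local Notation Re := (@complex.Re R).
Local Notation Im := (@complex.Im R).

(** A complex factor mixes real and imaginary parts, so both are handled as real linear combinations
    of two integrable functions. *)
Lemma has_cintZ d (T : measurableType d) (mu : {measure set T -> \bar R})
    (f : T -> C) c v : has_cint mu f v -> has_cint mu (fun x => c * f x) (c * v).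
Proof.
move=> [iF <-]; have [/= i1 i2] := (abs_integrableP mu f).1 iF.
have E1 (a b : R) : mu.-integrable setT (fun x => (a * Re (f x) + b * Im (f x))%:E).
  apply: (eq_integrable measurableT (fun x => (a%:E * (Re (f x))%:E + b%:E * (Im (f x))%:E)%E)) => //.
  by apply: integrableD => //; apply: integrableZl.
have E2 (a b : R) : \int[mu]_x (a * Re (f x) + b * Im (f x)) =
    a * (\int[mu]_x Re (f x)) + b * (\int[mu]_x Im (f x)).
  rewrite -!RintegralZl// -RintegralD//.
    by apply: (eq_integrable measurableT (fun x => (a%:E * (Re (f x))%:E)%E)) => //; apply: integrableZl.
  by apply: (eq_integrable measurableT (fun x => (b%:E * (Im (f x))%:E)%E)) => //; apply: integrableZl.
have reE : (fun x => Re (c * f x)) = (fun x => Re c * Re (f x) + (- Im c) * Im (f x)).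
  by apply/funext => x; rewrite ReM mulNr.
have imE : (fun x => Im (c * f x)) = (fun x => Im c * Re (f x) + Re c * Im (f x)).
  by apply/funext => x; rewrite ImM addrC.
split.
  apply/abs_integrableP; split.
    by apply: (eq_integrable measurableT _ _ _ (E1 (Re c) (- Im c))) => // x _; rewrite ReM mulNr.
  by apply: (eq_integrable measurableT _ _ _ (E1 (Im c) (Re c))) => // x _; rewrite ImM addrC.
apply: complex_eq; rewrite /cintegral ?ReM ?ImM /=.
  by rewrite reE E2 mulNr.
by rewrite imE E2 addrC.
Qed.

Lemma has_cint_ge0 d (T : measurableType d) (mu : {measure set T -> \bar R})
    (g : T -> R) v : (forall x, 0 <= g x) ->
  has_cint mu (fun x => (g x)%:C%C) v -> (\int[mu]_x (g x)%:E)%E = (Re v)%:E.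
Proof.
move=> g0 [iF <-]; have [/= i1 _] := (abs_integrableP mu _).1 iF.
by rewrite /cintegral /Rintegral /= fineK//; exact: integrable_fin_num.
Qed.

Lemma ge0_has_cint d (T : measurableType d) (mu : {measure set T -> \bar R})
    (g : T -> R) r : (forall x, 0 <= g x) -> measurable_fun setT g ->
  (\int[mu]_x (g x)%:E)%E = r%:E -> has_cint mu (fun x => (g x)%:C%C) r%:C%C.
Proof.
move=> g0 mg E; split.
  split; [exact: mg|exact: measurable_cst|].
  under eq_integral do rewrite normc_def/= expr0n addr0 sqrtr_sqr ger0_norm//.
  by rewrite E ltry.
rewrite /cintegral /Rintegral /= E /=.
by rewrite [X in fine X](_ : _ = 0%E)//; apply: integral0_eq.
Qed.

Lemma integrable_fubini_G d1 d2 (T1 : measurableType d1) (T2 : measurableType d2)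
    (mu1 : {sigma_finite_measure set T1 -> \bar R})
    (mu2 : {sigma_finite_measure set T2 -> \bar R}) (f : T1 * T2 -> \bar R) :
  (mu1 \x mu2)%E.-integrable setT f -> mu2.-integrable setT (fubini_G mu1 f).
Proof.
move=> iF; have mf : measurable_fun setT f := measurable_int _ iF.
have mG := measurable_fubini_G iF.
apply/integrableP; split => //.
apply: le_lt_trans ((integrable21ltyP mu1 mu2 mf).1 iF).
apply: ge0_le_integral => //.
- exact: measurableT_comp.
- apply: (measurable_fun_fubini_tonelli_G (m1 := mu1) (fun z => `|f z|%E)) => //.
  exact: measurableT_comp.
- move=> y _; apply: le_abse_integral => //.
  apply: (measurableT_comp mf (g := fun x => (x, y))).
  exact: pair2_measurable.
Qed.

Section fubini.
Context d1 d2 (T1 : measurableType d1) (T2 : measurableType d2).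
Variables (mu1 : {sigma_finite_measure set T1 -> \bar R})
  (mu2 : {sigma_finite_measure set T2 -> \bar R}) (f : T1 * T2 -> C).
Hypothesis mf : cmeasurable f.

Lemma abs_integrable_prod :
  (\int[mu1]_x \int[mu2]_y (cnorm (f (x, y)))%:E < +oo)%E ->
  abs_integrable (mu1 \x mu2)%E setT f.
Proof.
have [m1 m2] := mf; move=> foo; split => //.
rewrite (fubini_tonelli1 (m1 := mu1) (m2 := mu2))//.
  exact/measurable_EFinP/measurable_cnorm.
by move=> x /=; rewrite lee_fin cnorm_ge0.
Qed.

Hypothesis iF : abs_integrable (mu1 \x mu2)%E setT f.

(** Since every section is assumed to converge, and not only almost every one, [g] is the inner
    integral at each point and no null set has to be carried along. *)
Lemma has_cint_fubini1 (g : T1 -> C) : (forall x, has_cint mu2 (fun y => f (x, y)) (g x)) ->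
  has_cint mu1 g (cintegral (mu1 \x mu2)%E setT f).
Proof.
move=> fg; have [i1 i2] := (abs_integrableP _ f).1 iF.
have gre : (fun x => (Re (g x))%:E) = fubini_F mu2 (fun z => (Re (f z))%:E).
  apply/funext => x; have [ix <-] := fg x; have [j1 _] := (abs_integrableP _ _).1 ix.
  by rewrite /fubini_F /cintegral /Rintegral /= fineK//; exact: integrable_fin_num.
have gim : (fun x => (Im (g x))%:E) = fubini_F mu2 (fun z => (Im (f z))%:E).
  apply/funext => x; have [ix <-] := fg x; have [_ j2] := (abs_integrableP _ _).1 ix.
  by rewrite /fubini_F /cintegral /Rintegral /= fineK//; exact: integrable_fin_num.
split; first by apply/abs_integrableP; rewrite gre gim; split; exact: integrable_fubini_F.
by rewrite /cintegral /Rintegral gre gim !integral12_prod_meas1.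
Qed.

Lemma has_cint_fubini2 (g : T2 -> C) : (forall y, has_cint mu1 (fun x => f (x, y)) (g y)) ->
  has_cint mu2 g (cintegral (mu1 \x mu2)%E setT f).
Proof.
move=> fg; have [i1 i2] := (abs_integrableP _ f).1 iF.
have gre : (fun x => (Re (g x))%:E) = fubini_G mu1 (fun z => (Re (f z))%:E).
  apply/funext => x; have [ix <-] := fg x; have [j1 _] := (abs_integrableP _ _).1 ix.
  by rewrite /fubini_G /cintegral /Rintegral /= fineK//; exact: integrable_fin_num.
have gim : (fun x => (Im (g x))%:E) = fubini_G mu1 (fun z => (Im (f z))%:E).
  apply/funext => x; have [ix <-] := fg x; have [_ j2] := (abs_integrableP _ _).1 ix.
  by rewrite /fubini_G /cintegral /Rintegral /= fineK//; exact: integrable_fin_num.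
split; first by apply/abs_integrableP; rewrite gre gim; split; exact: integrable_fubini_G.
by rewrite /cintegral /Rintegral gre gim !integral21_prod_meas1.
Qed.

End fubini.

Lemma has_cint_mul d1 d2 (T1 : measurableType d1) (T2 : measurableType d2)
    (mu1 : {sigma_finite_measure set T1 -> \bar R})
    (mu2 : {sigma_finite_measure set T2 -> \bar R}) f g v w :
  has_cint mu1 f v -> has_cint mu2 g w ->
  has_cint (mu1 \x mu2)%E (fun z => f z.1 * g z.2) (v * w).
Proof.
move=> hf hg; have [iF fv] := hf; have [iG gw] := hg.
have mfg : cmeasurable (fun z : T1 * T2 => f z.1 * g z.2).
  apply: cmeasurableM.
    exact: cmeasurable_comp measurable_fst (abs_integrable_cmeasurable iF).
  exact: cmeasurable_comp measurable_snd (abs_integrable_cmeasurable iG).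
have ifg : abs_integrable (mu1 \x mu2)%E setT (fun z => f z.1 * g z.2).
  apply: abs_integrable_prod => //=.
  under eq_integral do under eq_integral do rewrite cnormM EFinM.
  have [[mf1 mf2 foo] [mg1 mg2 goo]] := (iF, iG).
  have c0 (z : C) : (0 <= (cnorm z)%:E)%E by rewrite lee_fin cnorm_ge0.
  have mcf : measurable_fun setT (fun x => (cnorm (f x))%:E).
    by apply/measurable_EFinP; apply: measurable_cnorm.
  have mcg : measurable_fun setT (fun x => (cnorm (g x))%:E).
    by apply/measurable_EFinP; apply: measurable_cnorm.
  under eq_integral => x _ do rewrite ge0_integralZl//.
  rewrite ge0_integralZr//; last by apply: integral_ge0.
  by rewrite lte_mul_pinfty// ?integral_ge0// ge0_fin_numE// integral_ge0.
split => //.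
have H := has_cint_fubini1 ifg (g := fun x => f x * w) (fun x => has_cintZ (f x) hg).
have H2 := has_cintZ w hf.
apply: has_cint_unique H _.
by rewrite mulrC; apply: eq_has_cint H2 => x; rewrite mulrC.
Qed.

End complex_fubini.

(** * Complex integrals over tuples *)

Section tuple_cint.
Variable R : realType.
Local Notation C := R[i].
Local Notation T := (measurableTypeR R).
Local Notation leb := (@lebesgue_measure R).
Implicit Types f g : seq R -> C.

Definition seq_cmeasurable m f := cmeasurable (fun t : m.-tuple T => f t).

Definition tcint m f v := has_cint (@tuple_lebesgue R m) (fun t : m.-tuple T => f t) v.

Let cpart_fun b1 b2 f s : \bar R := (cpart b1 b2 (f s))%:E.

Let cpart_fun_ge0 b1 b2 f s : (0 <= cpart_fun b1 b2 f s)%E.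
Proof. by rewrite lee_fin cpart_ge0. Qed.

Let seq_measurable_cpart m b1 b2 f : seq_cmeasurable m f ->
  seq_measurable m (cpart_fun b1 b2 f).
Proof. by move=> mf; apply/measurable_EFinP; exact: measurable_cpart. Qed.

Lemma tcint_transfer m M f g v : seq_cmeasurable m f -> seq_cmeasurable M g ->
  (forall b1 b2, itint m (fun s => (cpart b1 b2 (f s))%:E) =
                 itint M (fun s => (cpart b1 b2 (g s))%:E)) ->
  tcint m f v -> tcint M g v.
Proof.
move=> mf mg E; apply: has_cint_transfer => // b1 b2.
rewrite (itintE (cpart_fun_ge0 b1 b2 f)) ?(itintE (cpart_fun_ge0 b1 b2 g)) ?E//;
  exact: seq_measurable_cpart.
Qed.

Lemma integral_tuple_cons m (F : seq R -> \bar R) : (forall s, 0 <= F s)%E ->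
  seq_measurable m.+1 F ->
  (\int[leb \x @tuple_lebesgue R m]_p F (p.1 :: p.2) = itint m.+1 F)%E.
Proof.
move=> F0 mF; rewrite (fubini_tonelli1 (m1 := leb) (m2 := @tuple_lebesgue R m))//=.
  by apply: eq_integral => x _; rewrite -itintE//; exact: seq_measurable_cons.
exact: seq_measurable_joint.
Qed.

Lemma measurable_tuple_cat d (Y : measurableType d) m k (F : seq R -> Y) :
  measurable_fun setT (fun t : (m + k).-tuple T => F t) ->
  measurable_fun setT (fun p : m.-tuple T * k.-tuple T => F (p.1 ++ p.2)).
Proof.
move=> mF; apply: (measurable_seq_comp (m := (m + k)%N)) => //.
  by move=> p; rewrite size_cat !size_tuple.
move=> i _; have [im|mi] := ltnP i m.
  rewrite (_ : (fun _ => _) = fun p : m.-tuple T * k.-tuple T => nth 0 (p.1 : seq R) i).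
    exact: measurable_nth_comp.
  by apply/funext => p; rewrite nth_cat size_tuple im.
rewrite (_ : (fun _ => _) = fun p : m.-tuple T * k.-tuple T => nth 0 (p.2 : seq R) (i - m)).
  exact: measurable_nth_comp.
by apply/funext => p; rewrite nth_cat size_tuple ltnNge mi.
Qed.

(** Through the iterated integral the product measure and Lebesgue measure on tuples of length m + k
    are compared on functions only, without transporting measures along concatenation. *)
Lemma integral_tuple_cat m k (F : seq R -> \bar R) : (forall s, 0 <= F s)%E ->
  seq_measurable (m + k) F ->
  (\int[@tuple_lebesgue R m \x @tuple_lebesgue R k]_p F (p.1 ++ p.2) = itint (m + k) F)%E.
Proof.
move=> F0 mF.
have mcat := measurable_tuple_cat mF.
rewrite (fubini_tonelli1 (m1 := @tuple_lebesgue R m) (m2 := @tuple_lebesgue R k))//=.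
have E (s : m.-tuple T) : (\int[@tuple_lebesgue R k]_t F (s ++ t) = itint k (fun t => F (s ++ t)))%E.
  apply: (itintE (f := fun t => F (s ++ t))) => //.
  apply: (measurableT_comp mcat (g := fun t : k.-tuple T => (s, t))).
  exact: pair1_measurable.
rewrite itint_cat -itintE//.
- by apply: eq_integral => s _; exact: E.
- by move=> s; exact: itint_ge0.
apply: (eq_measurable_fun (fubini_F (@tuple_lebesgue R k) (fun p : m.-tuple T * k.-tuple T => F
  (p.1 ++ p.2)))).
  by move=> s _; exact: E.
exact: measurable_fun_fubini_tonelli_F.
Qed.

Lemma tcint_cons m f v : seq_cmeasurable m.+1 f ->
  has_cint (leb \x @tuple_lebesgue R m)%E (fun p => f (p.1 :: p.2)) v <-> tcint m.+1 f v.
Proof.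
move=> mf.
have E b1 b2 : (\int[leb \x @tuple_lebesgue R m]_p (cpart b1 b2 (f (p.1 :: p.2)))%:E =
    \int[@tuple_lebesgue R m.+1]_t (cpart b1 b2 (f t))%:E)%E.
  rewrite (integral_tuple_cons (cpart_fun_ge0 b1 b2 f)) ?(itintE (cpart_fun_ge0 b1 b2 f))//;
  exact: seq_measurable_cpart.
split; apply: has_cint_transfer => //.
apply: (cmeasurable_comp (phi := @tuple_cons R m) _ mf).
exact: measurable_tuple_cons.
Qed.

Lemma tcint_cat m k f v : seq_cmeasurable (m + k) f ->
  has_cint (@tuple_lebesgue R m \x @tuple_lebesgue R k)%E (fun p => f (p.1 ++ p.2)) v <->
  tcint (m + k) f v.
Proof.
move=> mf.
have E b1 b2 : (\int[@tuple_lebesgue R m \x @tuple_lebesgue R k]_p (cpart b1 b2 (f (p.1 ++ p.2)))%:E =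
    \int[@tuple_lebesgue R (m + k)]_t (cpart b1 b2 (f t))%:E)%E.
  rewrite (integral_tuple_cat (cpart_fun_ge0 b1 b2 f)) ?(itintE (cpart_fun_ge0 b1 b2 f))//;
  exact: seq_measurable_cpart.
split; apply: has_cint_transfer => //.
by case: mf => m1 m2; split; [exact: (measurable_tuple_cat (F := fun s => complex.Re (f s))
  m1)|exact: (measurable_tuple_cat (F := fun s => complex.Im (f s)) m2)].
Qed.

Lemma seq_cmeasurable_prod m (F : nat -> T -> C) :
  (forall i, (i < m)%N -> cmeasurable (F i)) ->
  seq_cmeasurable m (fun s => \prod_(0 <= i < m) F i (nth 0 s i)).
Proof.
move=> mF; apply: cmeasurable_prod => i; rewrite mem_index_iota => /= im.
exact: cmeasurable_comp (@measurable_nth R m i) (mF i im).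
Qed.

Lemma tcint_prod m (F : nat -> T -> C) (v : nat -> C) :
  (forall i, (i < m)%N -> has_cint leb (F i) (v i)) ->
  tcint m (fun s => \prod_(0 <= i < m) F i (nth 0 s i)) (\prod_(0 <= i < m) v i).
Proof.
elim: m F v => [|m IH] F v hF.
  apply: (eq_has_cint (f := fun=> (1 : R)%:C%C)).
    by move=> t; rewrite big_geq.
  rewrite big_geq// (_ : 1 = (1 : R)%:C%C :> C)//; apply: ge0_has_cint => //.
  by rewrite (itintE (f := fun=> 1%E))//; exact: measurable_cst.
apply/tcint_cons.
  by apply: seq_cmeasurable_prod => i im; have [/abs_integrable_cmeasurable] := hF i im.
rewrite big_nat_recl//.
have H : tcint m (fun s => \prod_(0 <= i < m) F i.+1 (nth 0 s i)) (\prod_(0 <= i < m) v i.+1).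
  by apply: (IH (fun i => F i.+1) (fun i => v i.+1)) => i im; exact: (hF i.+1).
apply: eq_has_cint (has_cint_mul (hF 0%N _) H) => //.
by move=> p; rewrite big_nat_recl.
Qed.

End tuple_cint.

(** * Complex powers and the Gamma function *)

Section complex_power.
Variable R : realType.
Local Notation C := R[i].
Local Notation Re := (@complex.Re R).
Local Notation Im := (@complex.Im R).
Implicit Types (z w s t : C) (x y : R).

Lemma cexpD z w : cexp (z + w) = cexp z * cexp w.
Proof.
rewrite /cexp; case: z => a b; case: w => c d /=; apply: complex_eq;
  rewrite !(ReM,ImM) /= expRD ?sinD ?cosD; ring.
Qed.

Lemma cexp0 : cexp 0 = 1 :> C.
Proof. by rewrite /cexp /= expR0 sin0 cos0 mul1r. Qed.

Lemma cexp_norm z : `|cexp z| = (expR (Re z))%:C%C.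
Proof.
rewrite /cexp normrM ger0_norm ?ler0c ?expR_ge0// normc_def /= cos2Dsin2 sqrtr1.
by rewrite mulr1.
Qed.

Lemma cexp_neq0 z : cexp z != 0.
Proof.
rewrite -normr_eq0 cexp_norm; apply/eqP => /(@complexI R)/eqP.
by rewrite gt_eqF ?expR_gt0.
Qed.

(** The sign of x does not matter for the laws in the exponent, whatever value ln x has; positivity
    enters where ln has to be multiplicative in the base. *)
Lemma cpowD x s t : cpow x (s + t) = cpow x s * cpow x t.
Proof. by rewrite /cpow mulrDl cexpD. Qed.

Lemma cpow0 x : cpow x 0 = 1.
Proof. by rewrite /cpow mul0r cexp0. Qed.

Lemma cpow_neq0 x s : cpow x s != 0.
Proof. exact: cexp_neq0. Qed.

Lemma cpowN x s : cpow x (- s) = (cpow x s)^-1.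
Proof.
by apply: (mulfI (cpow_neq0 x s)); rewrite -cpowD subrr cpow0 divff ?cpow_neq0.
Qed.

Lemma cpowB x s t : cpow x (s - t) = cpow x s / cpow x t.
Proof. by rewrite cpowD cpowN. Qed.

Lemma cpow_real x y : cpow x y%:C%C = (expR (y * ln x))%:C%C.
Proof.
rewrite /cpow -rmorphM /cexp /= cos0 sin0; apply: complex_eq; rewrite ?ReM ?ImM /=; ring.
Qed.

Lemma cpow1r x : 0 < x -> cpow x 1 = x%:C%C.
Proof. by move=> x0; rewrite (_ : 1 = (1 : R)%:C%C)// cpow_real mul1r lnK. Qed.

Lemma cpow1l s : cpow 1 s = 1.
Proof. by rewrite /cpow ln1 mulr0 cexp0. Qed.

Lemma cpowM x y s : 0 < x -> 0 < y -> cpow (x * y) s = cpow x s * cpow y s.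
Proof. by move=> x0 y0; rewrite /cpow lnM// rmorphD mulrDr cexpD. Qed.

Lemma cpowV x s : 0 < x -> cpow x^-1 s = cpow x (- s).
Proof.
move=> x0; apply: (mulfI (cpow_neq0 x s)).
by rewrite -cpowM ?invr_gt0// divff ?gt_eqF// cpow1l -cpowD subrr cpow0.
Qed.

Lemma cpow_div x y s : 0 < x -> 0 < y -> cpow (x / y) s = cpow x s / cpow y s.
Proof. by move=> x0 y0; rewrite cpowM ?invr_gt0// cpowV// cpowN. Qed.

Lemma cpow_prod (I : eqType) (r : seq I) (F : I -> R) s :
  (forall i, i \in r -> 0 < F i) ->
  cpow (\prod_(i <- r) F i) s = \prod_(i <- r) cpow (F i) s.
Proof.
elim: r => [|i r IH] F0; first by rewrite !big_nil cpow1l.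
rewrite !big_cons cpowM ?F0 ?mem_head// ?IH// => [j jr|].
  by apply: F0; rewrite inE jr orbT.
by rewrite big_seq; apply: prodr_gt0 => j jr; apply: F0; rewrite inE jr orbT.
Qed.

Lemma cpow_sum (I : Type) (r : seq I) (F : I -> C) x :
  cpow x (\sum_(i <- r) F i) = \prod_(i <- r) cpow x (F i).
Proof.
elim: r => [|i r IH]; first by rewrite !big_nil cpow0.
by rewrite !big_cons cpowD IH.
Qed.

Lemma cpow_norm x s : `|cpow x s| = cpow x (Re s)%:C%C.
Proof. by rewrite {1}/cpow cexp_norm cpow_real ReM /= mulr0 subr0. Qed.

Lemma cmeasurable_cpow d (T : measurableType d) (f : T -> R) s :
  measurable_fun setT f -> cmeasurable (fun u => cpow (f u) s).
Proof.
move=> mf; rewrite /cpow /cexp.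
have mln : measurable_fun setT (fun u => ln (f u)).
  exact: (measurableT_comp (@measurable_ln R)).
have mr : measurable_fun setT (fun u => Re (s * (ln (f u))%:C%C)).
  by under eq_fun do rewrite ReM /= mulr0 subr0; exact: measurable_funM.
have mi : measurable_fun setT (fun u => Im (s * (ln (f u))%:C%C)).
  by under eq_fun do rewrite ImM /= mulr0 add0r; exact: measurable_funM.
apply: cmeasurableM.
  by apply: cmeasurable_real; exact: (measurableT_comp (@measurable_expR R)).
have mcos : measurable_fun setT (@cos R : measurableTypeR R -> measurableTypeR R).
  by apply: continuous_measurable_fun; exact: continuous_cos.
have msin : measurable_fun setT (@sin R : measurableTypeR R -> measurableTypeR R).
  by apply: continuous_measurable_fun; exact: continuous_sin.
by split; [exact: (measurableT_comp mcos mi)|exact: (measurableT_comp msin mi)].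
Qed.

End complex_power.

Section complex_integral_on.
Variable R : realType.
Local Notation C := R[i].
Local Notation Re := (@complex.Re R).
Local Notation Im := (@complex.Im R).
Local Notation T := (measurableTypeR R).
Local Notation leb := (@lebesgue_measure R).

(** Lets integrals be taken over the whole space, the domain becoming a boolean test in the
    integrand. *)
Lemma has_cint_on d (X : measurableType d) (mu : {measure set X -> \bar R})
    (D : set X) (b : X -> bool) (f : X -> C) v : measurable D ->
  (forall x, D x <-> b x) ->
  has_cint mu (fun x => if b x then f x else 0) v <->
  abs_integrable mu D f /\ cintegral mu D f = v.
Proof.
move=> mD Db.
have restr (g : C -> R) : g 0 = 0 ->
    (fun x => g (if b x then f x else 0)) = (fun x => g (f x)) \_ D.
  move=> g0; apply/funext => x; rewrite patchE (_ : (x \in D) = b x).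
    by case: ifP.
  by apply/idP/idP; rewrite inE => /Db.
have -> : cintegral mu D f = cintegral mu setT (fun x => if b x then f x else 0).
  by rewrite /cintegral !(Rintegral_mkcond _ D) (restr Re)// (restr Im).
suff -> : abs_integrable mu D f =
    abs_integrable mu setT (fun x => if b x then f x else 0) by [].
apply/propext; rewrite /abs_integrable.
have E : (\int[mu]_x (cnorm (if b x then f x else 0))%:E = \int[mu]_(x in D) (cnorm (f x))%:E)%E.
  rewrite [RHS]integral_mkcond; apply: eq_integral => x _.
  rewrite patchE (_ : (x \in D) = b x); first by case: ifP => //; rewrite cnorm0.
  by apply/idP/idP; rewrite inE => /Db.
rewrite (_ : (\int[mu]_x _)%E = \int[mu]_(x in D) (cnorm (f x))%:E)%E//.
rewrite (restr Re)// (restr Im)//.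
by split=> -[m1 m2 ?]; split => //; [exact/(measurable_restrictT _ _).1|exact/(measurable_restrictT _ _).1|
  exact/(measurable_restrictT _ mD).2|exact/(measurable_restrictT _ mD).2].
Qed.

Lemma has_cintD d (X : measurableType d) (mu : {measure set X -> \bar R})
    (f g : X -> C) v w : has_cint mu f v -> has_cint mu g w ->
  has_cint mu (fun x => f x + g x) (v + w).
Proof.
move=> [iF <-] [iG <-].
have [/= i1 i2] := (abs_integrableP mu f).1 iF.
have [/= j1 j2] := (abs_integrableP mu g).1 iG.
have reE : (fun x => Re (f x + g x)) = (fun x => Re (f x) + Re (g x)).
  by apply/funext => x; case: (f x); case: (g x).
have imE : (fun x => Im (f x + g x)) = (fun x => Im (f x) + Im (g x)).
  by apply/funext => x; case: (f x); case: (g x).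
split.
  apply/abs_integrableP; split.
    rewrite (_ : (fun x => _) = EFin \o (fun x => Re (f x + g x)))// reE.
    exact: integrableD i1 j1.
  rewrite (_ : (fun x => _) = EFin \o (fun x => Im (f x + g x)))// imE.
  exact: integrableD i2 j2.
rewrite /cintegral reE imE !RintegralD//.
Qed.

(** The interval is half open so that it can be glued to one ending at [q] without overlap. *)
Lemma has_cint_FTC (f F : R -> C) (q r : R) : q < r ->
  cmeasurable (f : T -> C) ->
  (forall t, q <= t <= r -> is_derive t 1 (fun t => Re (F t)) (Re (f t))) ->
  (forall t, q <= t <= r -> is_derive t 1 (fun t => Im (F t)) (Im (f t))) ->
  (forall t, q <= t <= r -> {for t, continuous (fun t => Re (f t))}) ->
  (forall t, q <= t <= r -> {for t, continuous (fun t => Im (f t))}) ->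
  has_cint leb (fun t => if q <= t < r then f t else 0) (F r - F q).
Proof.
move=> qr [mf1 mf2] D1 D2 c1 c2.
have ftc (g G : R -> R) : measurable_fun setT (g : T -> R) ->
    (forall t, q <= t <= r -> is_derive t 1 G (g t)) ->
    (forall t, q <= t <= r -> {for t, continuous g}) ->
    leb.-integrable `[q, r[ (EFin \o g) /\ \int[leb]_(t in `[q, r[) g t = G r - G q.
  move=> mg D c.
  have cw : {within `[q, r], continuous g}.
    by apply: continuous_in_subspaceT => t; rewrite inE/= in_itv/= => /c.
  have i : leb.-integrable `[q, r] (EFin \o g).
    by apply: continuous_compact_integrable => //; exact: segment_compact.
  have cG t : q <= t <= r -> {for t, continuous G}.
    move=> tqr; apply: differentiable_continuous; apply/derivable1_diffP.
    by have [] := D t tqr.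
  split.
    apply: integrableS i => //.
    by apply: subset_itvl; rewrite bnd_simp.
  rewrite /Rintegral integral_itv_bndo_bndc; last exact/measurable_EFinP/measurable_funTS.
  rewrite (@continuous_FTC2 _ g G)//.
    split.
    - move=> t; rewrite in_itv/= => /andP[qt tr].
      by have [] := D t; rewrite ?(ltW qt) ?(ltW tr).
    - by apply/cvg_at_right_filter/cG; rewrite lexx ltW.
    - by apply/cvg_at_left_filter/cG; rewrite lexx ltW.
  move=> t; rewrite in_itv/= => /andP[qt tr]; rewrite derive1E.
  by have [] := D t; rewrite ?(ltW qt) ?(ltW tr).
have [i1 E1] := ftc _ _ mf1 D1 c1; have [i2 E2] := ftc _ _ mf2 D2 c2.
have patch (g : R -> R) : (fun t => if q <= t < r then g t else 0) = g \_ `[q, r[%classic.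
  apply/funext => t; rewrite patchE (_ : (t \in `[q, r[%classic) = (q <= t < r))//.
  by apply/idP/idP; rewrite inE/= in_itv.
have reE : (fun t => Re (if q <= t < r then f t else 0)) = (fun t => Re (f t)) \_ `[q, r[%classic.
  by rewrite -patch; apply/funext => t; case: ifP.
have imE : (fun t => Im (if q <= t < r then f t else 0)) = (fun t => Im (f t)) \_ `[q, r[%classic.
  by rewrite -patch; apply/funext => t; case: ifP.
split; last first.
  rewrite /cintegral reE imE -!Rintegral_mkcond E1 E2.
  by case: (F r) => ? ?; case: (F q).
apply/abs_integrableP; split.
  rewrite (_ : (fun x => _) = EFin \o (fun x => Re (if q <= x < r then f x else 0)))//.
  by rewrite reE -restrict_EFin; apply: (integrable_mkcond _ _).1 => //.
rewrite (_ : (fun x => _) = EFin \o (fun x => Im (if q <= x < r then f x else 0)))//.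
by rewrite imE -restrict_EFin; apply: (integrable_mkcond _ _).1 => //.
Qed.

End complex_integral_on.

(** * The integral of t^(s-1) over the unit interval *)

Section power_integrals.
Variable R : realType.
Local Notation C := R[i].
Local Notation Re := (@complex.Re R).
Local Notation Im := (@complex.Im R).
Local Notation T := (measurableTypeR R).
Local Notation leb := (@lebesgue_measure R).

Lemma has_cint_scale (f : R -> C) v (c : R) : 0 < c -> (forall t : R, t <= 0 -> f t = 0) ->
  has_cint leb f v -> has_cint leb (fun t => c%:C%C * f (t * c)) v.
Proof.
move=> c0 f0 hf; have mf : cmeasurable (f : T -> C) by have [/abs_integrable_cmeasurable] := hf.
have mfc : cmeasurable (fun t : T => f (t * c)).
  by apply: (cmeasurable_comp (phi := fun t : T => t * c)) => //; exact: mulrr_measurable.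
apply: has_cint_transfer hf; first exact: cmeasurableM (cmeasurable_cst _ _) mfc.
move=> b1 b2.
have E1 (t : R) : (cpart b1 b2 (f t))%:E = (if (0 < t)%R then (cpart b1 b2 (f t))%:E else 0)%E.
  by case: ltP => // /f0 ->; rewrite cpart0.
have E2 (t : R) : (c%:E * (if (0 < t)%R then (cpart b1 b2 (f (t * c)%R))%:E else 0))%E =
    (cpart b1 b2 (c%:C%C * f (t * c)))%:E.
  rewrite cpartZ ?ltW// EFinM; case: ltP => // t0.
  by rewrite f0 ?cpart0// pmulr_lle0.
transitivity (\int[leb]_t (if (0 < t)%R then (cpart b1 b2 (f t))%:E else 0))%E.
  by apply: eq_integral => t _; exact: E1.
rewrite (ge0_integral_scale c0 (H := fun t => (cpart b1 b2 (f t))%:E)).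
- by apply: eq_integral => t _; exact: E2.
- by apply/measurable_EFinP; exact: measurable_cpart.
- by move=> t; rewrite lee_fin cpart_ge0.
Qed.

Let is_derive_cpow_part s (t : R) : 0 < t ->
  is_derive t 1 (fun t => Re (cpow t s)) (Re (s * cpow t (s - 1))) /\
  is_derive t 1 (fun t => Im (cpow t s)) (Im (s * cpow t (s - 1))).
Proof.
case: s => a b t0.
have -> : cpow t ((a +i* b)%C - 1) = cpow t (a +i* b)%C * (t^-1)%:C%C.
  by rewrite cpowB cpow1r// fmorphV.
have Dln (k : R) : is_derive t 1 (fun t => k * ln t) (k * t^-1).
  have L := is_derive1_ln t0.
  apply: is_derive_eq (is_deriveM (is_derive_cst k t 1) L) _.
  by rewrite /GRing.scale/= /cst mulr0 addr0.
have De := is_derive1_comp (f := @expR R) (g := fun t => a * ln t) (is_derive_expR (a * ln t)) (Dln a).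
have Dc := is_derive1_comp (f := @cos R) (g := fun t => b * ln t) (is_derive_cos (b * ln t)) (Dln b).
have Ds := is_derive1_comp (f := @sin R) (g := fun t => b * ln t) (is_derive_sin (b * ln t)) (Dln b).
have reE : (fun t => Re (cpow t (a +i* b)%C)) = (expR \o (fun t => a * ln t)) * (cos \o (fun t => b * ln t)).
  apply/funext => u; transitivity (expR (a * ln u) * cos (b * ln u)) => //.
  by rewrite /cpow /cexp !(ReM,ImM) /= !(mulr0,mul0r,subr0,addr0,add0r).
have imE : (fun t => Im (cpow t (a +i* b)%C)) = (expR \o (fun t => a * ln t)) * (sin \o (fun t => b * ln t)).
  apply/funext => u; transitivity (expR (a * ln u) * sin (b * ln u)) => //.
  by rewrite /cpow /cexp !(ReM,ImM) /= !(mulr0,mul0r,subr0,addr0,add0r).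
have re := congr1 (@^~ t) reE; have im := congr1 (@^~ t) imE; rewrite /= in re im.
split.
  rewrite reE; apply: is_derive_eq (is_deriveM De Dc) _.
  rewrite !(ReM,ImM) re im /GRing.scale/=.
  rewrite [X in X = _](_ : _ = (expR (a * ln t)) * (- sin (b * ln t) * (b / t)) + cos (b * ln t)
    * (expR (a * ln t) * (a / t)))//.
  rewrite [RHS](_ : _ = a * ((expR (a * ln t) * cos (b * ln t)) * t^-1 - expR (a * ln t) * sin (b
    * ln t) * 0) - b * (expR (a * ln t) * cos (b * ln t) * 0 + expR (a * ln t) * sin (b * ln t) *
    t^-1))//.
  ring.
rewrite imE; apply: is_derive_eq (is_deriveM De Ds) _.
rewrite !(ReM,ImM) re im /GRing.scale/=.
rewrite [X in X = _](_ : _ = (expR (a * ln t)) * (cos (b * ln t) * (b / t)) + sin (b * ln t) *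
  (expR (a * ln t) * (a / t)))//.
rewrite [RHS](_ : _ = a * ((expR (a * ln t) * cos (b * ln t)) * 0 + expR (a * ln t) * sin (b * ln
  t) * t^-1) + b * (expR (a * ln t) * cos (b * ln t) * t^-1 - expR (a * ln t) * sin (b * ln t) *
  0))//.
ring.
Qed.

Let continuous_cpow_part s (t : R) : 0 < t ->
  {for t, continuous (fun t => Re (cpow t s))} /\ {for t, continuous (fun t => Im (cpow t s))}.
Proof.
move=> t0; have [[d1 _] [d2 _]] := is_derive_cpow_part s t0.
by split; apply: differentiable_continuous; exact/derivable1_diffP.
Qed.

Lemma has_cint_cpow_itv s (q : R) : 0 < q < 1 ->
  has_cint leb (fun t => if q <= t < 1 then s * cpow t (s - 1) else 0) (1 - cpow q s).
Proof.
move=> /andP[q0 q1]; rewrite (_ : 1 - cpow q s = cpow 1 s - cpow q s); last by rewrite cpow1l.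
have t0 t : q <= t <= 1 -> 0 < t by move=> /andP[qt _]; exact: lt_le_trans qt.
apply: (@has_cint_FTC R (fun t => s * cpow t (s - 1)) (fun t => cpow t s) q 1) => //.
- apply: cmeasurableM; first exact: cmeasurable_cst.
  exact: cmeasurable_cpow.
- by move=> t /t0 /(is_derive_cpow_part s)[].
- by move=> t /t0 /(is_derive_cpow_part s)[].
- move=> t /t0 /(continuous_cpow_part (s - 1))[c1 c2].
  rewrite (_ : (fun _ => _) = (fun t => Re s * Re (cpow t (s - 1)) - Im s * Im (cpow t (s - 1)))).
    by apply: continuousB; apply: continuousM => //; exact: cst_continuous.
  by apply/funext => u; rewrite ReM.
- move=> t /t0 /(continuous_cpow_part (s - 1))[c1 c2].
  rewrite (_ : (fun _ => _) = (fun t => Re s * Im (cpow t (s - 1)) + Im s * Re (cpow t (s - 1)))).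
    by apply: continuousD; apply: continuousM => //; exact: cst_continuous.
  by apply/funext => u; rewrite ImM.
Qed.

Definition unit_cpow s (t : R) := if 0 < t < 1 then cpow t (s - 1) else 0.

Lemma cmeasurable_unit_cpow s : cmeasurable (unit_cpow s : T -> C).
Proof.
have mb : measurable_fun setT (fun t : T => 0 < t < 1 :> bool).
  by apply: measurable_and; exact: measurable_fun_ltr.
apply: cmeasurable_if0 mb _; exact: cmeasurable_cpow.
Qed.

Lemma cnorm_unit_cpow s t : cnorm (unit_cpow s t) = (if 0 < t < 1 then expR ((Re s - 1) * ln t) else 0).
Proof.
rewrite /unit_cpow; case: ifP => _; last exact: cnorm0.
apply: (@complexI R); rewrite cnormE cpow_norm -cpow_real; congr (cpow _ _).
by case: s => a b; apply: complex_eq => /=.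
Qed.

(** Over [q, 1) the integral is (1 - q^x) / x, which is at most 1 / x; monotone convergence lets q
    tend to 0 along 1 / (n + 2). *)
Let unit_powR_lty (x : R) : 0 < x ->
  (\int[leb]_t (if 0 < t < 1 then expR ((x - 1) * ln t) else 0 : R)%:E < +oo)%E.
Proof.
move=> x0.
pose f t := (expR ((x - 1) * ln t)).
have mf : measurable_fun setT (f : T -> R).
  apply: (measurableT_comp (@measurable_expR R)); apply: measurable_funM => //.
have f0 t : 0 <= f t by exact: expR_ge0.
pose q (n : nat) : R := n.+2%:R^-1.
have q01 n : 0 < q n < 1 by rewrite invr_gt0 ltr0n/= invf_lt1 ?ltr0n// ltr1n.
have on (b : T -> bool) (D : set T) : (forall t, D t <-> b t) ->
    (\int[leb]_t (if b t then f t else 0 : R)%:E = \int[leb]_(t in D) (f t)%:E)%E.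
  move=> bD; rewrite [RHS]integral_mkcond; apply: eq_integral => t _.
  rewrite patchE (_ : (t \in D) = b t); first by case: ifP.
  by apply/idP/idP; rewrite inE => /bD.
have le n : (\int[leb]_(t in `[q n, 1%R[) (f t)%:E <= (x^-1)%:E)%E.
  have [q0 q1] := andP (q01 n).
  have /has_cintZ := has_cint_cpow_itv x%:C%C (q01 n) => /(_ (x^-1)%:C%C) H.
  have E : (fun t => (x^-1)%:C%C * (if q n <= t < 1 then x%:C%C * cpow t (x%:C%C - 1) else 0)) =
           (fun t => (if q n <= t < 1 then f t else 0)%:C%C).
    apply/funext => t; case: ifP => _; last by rewrite mulr0.
    rewrite mulrA -rmorphM /= mulVf ?gt_eqF// mul1r -cpow_real; congr (cpow _ _).
    by rewrite rmorphB.
  rewrite E in H; rewrite -(on (fun t : R => q n <= t < 1)); last first.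
    by move=> t /=; rewrite in_itv.
  rewrite (has_cint_ge0 _ H); last by move=> t; case: ifP.
  rewrite lee_fin cpow_real ReM /= subr0 mul0r subr0 ler_piMr ?invr_ge0 ?(ltW x0)//.
rewrite (on (fun t : R => 0 < t < 1) (\bigcup_n `[q n, 1%R[%classic)); last first.
  move=> t; split => [[n _ /=]|/andP[t0 t1]].
    by rewrite in_itv/= => /andP[qt ->]; rewrite (lt_le_trans _ qt)//; have /andP[] := q01 n.
  have [N tN] : exists N : nat, t^-1 < N%:R.
    by exists (Num.truncn t^-1).+1; rewrite truncnS_gt.
  exists N => //=; rewrite in_itv/= t1 andbT -[leRHS]invrK lef_pV2 ?posrE ?invr_gt0 ?ltr0n//.
  by rewrite (le_trans (ltW tN))// ler_nat ltnW.
have cv : (\int[leb]_(t in `[q n, 1%R[) (f t)%:E @[n --> \oo] -->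
    \int[leb]_(t in \bigcup_n `[q n, 1%R[%classic) (f t)%:E)%E.
  apply: ge0_nondecreasing_set_cvg_integral => //.
  - apply/nondecreasing_seqP => n; rewrite subsetEset => t /=; rewrite !in_itv/=.
    move=> /andP[qt ->]; rewrite (le_trans _ qt)// lef_pV2 ?posrE ?ltr0n//.
    by rewrite ler_nat.
  - by move=> n; apply/measurable_EFinP; exact: measurable_funTS.
  - by move=> n t _; rewrite lee_fin.
rewrite -(cvg_lim _ cv)//; apply: le_lt_trans (ltry x^-1).
by apply: lime_le; [exact: cvgP cv|apply: nearW => n; exact: le].
Qed.

(** Self-similarity takes the place of a limit of complex integrals. Once the integral c is known to
    converge, scaling shows that ]0, 1/2[ contributes 2^(-s) c, while [1/2, 1[ contributes (1 -
    2^(-s)) / s. As 2^(-s) has modulus less than 1, this determines c. *)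
Lemma has_cint_unit_cpow s : 0 < Re s -> has_cint leb (unit_cpow s) s^-1.
Proof.
move=> s0.
have iu : abs_integrable leb setT (unit_cpow s).
  have [m1 m2] := cmeasurable_unit_cpow s; split => //.
  by under eq_integral do rewrite -/(cnorm _) cnorm_unit_cpow; exact: unit_powR_lty.
pose c := cintegral leb setT (unit_cpow s).
have hc : has_cint leb (unit_cpow s) c by [].
suff : c = s^-1 by move=> <-.
have q0 : 0 < 2^-1 :> R by rewrite invr_gt0.
have q1 : 2^-1 < 1 :> R by rewrite invf_lt1// ltr1n.
have s_neq0 : s != 0 by apply/eqP => E; move: s0; rewrite E ltxx.
pose u := cpow (2^-1 : R) s.
have us0 (t : R) : t <= 0 -> unit_cpow s t = 0 by move=> t0; rewrite /unit_cpow ltNge t0.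
have h1 := has_cintZ u (has_cint_scale (ltr0n R 2) us0 hc).
have h2 := has_cintZ s^-1 (@has_cint_cpow_itv s 2^-1 (introT andP (conj q0 q1))).
have u2 : u * cpow 2 s = 1 by rewrite -cpowM// mulVf// cpow1l.
have cE : c = u * c + s^-1 * (1 - u).
  apply: has_cint_unique hc _; apply: eq_has_cint (has_cintD h1 h2) => t.
  have [t0|t0] := leP t 0.
    rewrite !us0 ?pmulr_lle0// !mulr0 add0r ifF ?mulr0//.
    by apply/negbTE; rewrite negb_and -ltNge (le_lt_trans t0).
  rewrite /unit_cpow mulr_gt0// t0 /= -(ltr_pdivlMr t 1)// mul1r.
  have [t2|t2] := ltP t 2^-1.
    rewrite (lt_trans t2 q1) mulr0 addr0 cpowM// !cpowB (cpow1r (ltr0n R 2)).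
    rewrite [X in u * X](_ : _ = cpow 2 s * (cpow t s / cpow t 1)).
      by rewrite mulrA u2 mul1r.
    have : (2 : R)%:C%C != 0 by apply/eqP => /(@complexI R)/eqP; rewrite pnatr_eq0.
    by move=> ?; field; rewrite cpow_neq0.
  rewrite !mulr0 add0r /=; case: ifP => _; last by rewrite mulr0.
  by rewrite mulrA mulVf// mul1r.
have u1 : u != 1.
  apply/eqP => /(congr1 Num.norm); rewrite normr1 cpow_norm cpow_real.
  move=> /(congr1 (@complex.Re R))/=/eqP; apply/negP; rewrite lt_eqF// expR_lt1.
  by rewrite pmulr_rlt0// ln_lt0// q0.
apply: (mulIf (x := 1 - u)); first by rewrite subr_eq0 eq_sym.
by rewrite mulrBr mulr1 {1}cE; ring.
Qed.

End power_integrals.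

(** * Convergence and scaling of Euler's integral *)

Section gamma_function.
Variable R : realType.
Local Notation C := R[i].
Local Notation Re := (@complex.Re R).
Local Notation Im := (@complex.Im R).
Local Notation T := (measurableTypeR R).
Local Notation leb := (@lebesgue_measure R).

Lemma has_cint_le d (X : measurableType d) (mu : {measure set X -> \bar R})
    (f g : X -> C) v w : has_cint mu f v -> has_cint mu g w ->
  (forall x, Re (f x) <= Re (g x)) -> Re v <= Re w.
Proof.
move=> [/abs_integrableP[i1 _] <-] [/abs_integrableP[j1 _] <-] fg /=.
exact: le_Rintegral.
Qed.

Lemma has_cint_expR_tail (t : R) :
  has_cint leb (fun r => if t < r then (expR (- r))%:C%C else 0) (expR (- t))%:C%C.
Proof.
pose f (r : R) := if t < r then expR (- r) else 0.
have mE : measurable_fun setT ((fun r => expR (- r)) : T -> R).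
  by apply: (measurableT_comp (@measurable_expR R)); exact: measurable_funN.
apply: (eq_has_cint (f := (fun r => (f r)%:C%C) : T -> C)); first by move=> r; rewrite /f; case: ifP.
apply: ge0_has_cint.
- by move=> r; rewrite /f; case: ifP => // _; exact: expR_ge0.
- by apply: measurable_fun_ifT => //; exact: measurable_fun_ltr.
have dE (x : R) : is_derive x 1 (fun r => - expR (- r)) (expR (- x)).
  have D := is_derive1_comp (f := @expR R) (g := fun r => - r) (is_derive_expR (- x)) (is_deriveN
    (is_derive_id x 1)).
  apply: is_derive_eq (is_deriveN D) _.
  by rewrite mulrN1 opprK.
have cE (x : R) : {for x, continuous (fun r => - expR (- r))}.
  by apply: differentiable_continuous; apply/derivable1_diffP; have [] := dE x.
transitivity (\int[leb]_(r in `[t, +oo[) (expR (- r))%:E)%E.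
  rewrite -integral_itv_obnd_cbnd; last exact/measurable_EFinP/measurable_funTS.
  rewrite [RHS]integral_mkcond; apply: eq_integral => r _.
  rewrite patchE (_ : (r \in `]t, +oo[%classic) = (t < r)); first by rewrite /f; case: ifP.
  by apply/idP/idP; rewrite inE/= in_itv/= andbT.
rewrite (@ge0_continuous_FTC2y _ (fun r => expR (- r)) (fun r => - expR (- r)) t 0).
- by rewrite EFinN oppeK add0e.
- by move=> x _; exact: expR_ge0.
- apply: continuous_subspaceT => x.
  by apply: (@continuous_comp _ _ _ (fun r => - r) (@expR R)); [exact: opp_continuous|exact: continuous_expR].
- by rewrite -[X in _ --> X]oppr0; apply: cvgN; exact: cvgr_expR.
- by move=> x _; have [] := dE x.
- exact/cvg_at_right_filter/cE.
- by move=> x _; rewrite derive1E; have [_ ->] := dE x.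
Qed.

Definition gamma_fun s (t : R) := if 0 < t then cpow t (s - 1) * (expR (- t))%:C%C else 0.

Lemma cmeasurable_gamma_fun s : cmeasurable (gamma_fun s : T -> C).
Proof.
apply: cmeasurable_if0; first exact: measurable_fun_ltr.
apply: cmeasurableM; first exact: cmeasurable_cpow.
apply: cmeasurable_real.
by apply: (measurableT_comp (@measurable_expR R)); exact: measurable_funN.
Qed.

Lemma cnorm_cpow t s : cnorm (cpow t s) = expR (Re s * ln t).
Proof. by rewrite /cnorm cpow_norm cpow_real. Qed.

Lemma cnorm_real (r : R) : 0 <= r -> cnorm r%:C%C = r.
Proof. by move=> r0; rewrite /cnorm ger0_norm// ler0c. Qed.

Let cnorm_gamma_fun s t : cnorm (gamma_fun s t) =
  (if 0 < t then expR ((Re s - 1) * ln t - t) else 0).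
Proof.
rewrite /gamma_fun; case: ifP => _; last exact: cnorm0.
by rewrite cnormM cnorm_cpow cnorm_real ?expR_ge0// -expRD; case: s.
Qed.

(** Domination by t^(Re s - 1) on ]0, 1[ and by a multiple of e^(-t/2) from 1 on. *)
Lemma abs_integrable_gamma s : 0 < Re s -> abs_integrable leb setT (gamma_fun s).
Proof.
move=> s0; have [m1 m2] := cmeasurable_gamma_fun s; split => //.
(* From ln u < u at u = t / (2c + 1) follows c ln t <= t/2 + K, hence t^c e^(-t) <= e^K e^(-t/2).
   The summand 1 keeps the denominator positive when c = 0. *)
pose c := `|Re s - 1|; pose K := c * ln (2 * c + 1).
have c0 : 0 <= c by exact: normr_ge0.
have d0 : 0 < 2 * c + 1 by rewrite ltr_wpDl// mulr_ge0.
have [_ _ iu] : abs_integrable leb setT (unit_cpow s) by have [] := has_cint_unit_cpow s0.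
have h2 : 0 < 2^-1 :> R by rewrite invr_gt0.
have tail0 (t : R) : t <= 0 -> (if 0 < t then (expR (- t))%:C%C else 0) = 0 :> C.
  by move=> t0; rewrite ltNge t0.
(* The factor 2 undoes the Jacobian 1/2 of the scaling. *)
have [[n1 n2 it] _] := has_cintZ (expR K * 2)%:C%C (has_cint_scale h2 tail0 (has_cint_expR_tail 0)).
have le t : cnorm (gamma_fun s t) <= cnorm (unit_cpow s t) +
    cnorm ((expR K * 2)%:C%C * ((2^-1)%:C%C * (if 0 < t * 2^-1 then (expR (- (t * 2^-1)))%:C%C else 0))).
  rewrite cnorm_gamma_fun cnorm_unit_cpow.
  have [t0|t0] := ltP 0 t; last first.
    by apply: addr_ge0; [exact: lexx|exact: cnorm_ge0].
  rewrite mulr_gt0//= mulrA -rmorphM /= mulfK ?pnatr_eq0//.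
  rewrite -rmorphM /= cnorm_real ?mulr_ge0 ?expR_ge0// -expRD.
  have [t1|t1] := ltP t 1.
    by rewrite ler_wpDr ?expR_ge0// ler_expR lerBlDr lerDl ltW.
  rewrite add0r ler_expR.
  have lnt : 0 <= ln t by rewrite ln_ge0.
  have : (Re s - 1) * ln t <= c * ln t by rewrite ler_wpM2r// ler_norm.
  have : c * ln t <= c * (t / (2 * c + 1) + ln (2 * c + 1)).
    rewrite ler_wpM2l// -{1}[t](divfK (lt0r_neq0 d0)) lnM ?posrE ?divr_gt0//.
    by rewrite lerD2r ltW// ln_sublinear// divr_gt0.
  have : c * (t / (2 * c + 1)) <= t * 2^-1.
    rewrite mulrCA ler_wpM2l ?(ltW t0)// ler_pdivrMr// mulrDr mulrA mulVf ?pnatr_eq0// mul1r mulr1.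
    by rewrite lerDl ltW.
  rewrite /K; move: (ln _) (ln _) => ? ?; lra.
apply: le_lt_trans (lte_add_pinfty iu it).
rewrite -ge0_integralD//.
- apply: ge0_le_integral => //.
  + by move=> t _; rewrite lee_fin cnorm_ge0.
  + exact/measurable_EFinP/measurable_cnorm.
  + by apply: emeasurable_funD; apply/measurable_EFinP/measurable_cnorm => //; exact: cmeasurable_unit_cpow.
  + by move=> t _; rewrite -EFinD lee_fin; exact: le.
- by move=> t _; rewrite lee_fin cnorm_ge0.
- exact/measurable_EFinP/measurable_cnorm/cmeasurable_unit_cpow.
- by move=> t _; rewrite lee_fin cnorm_ge0.
- exact/measurable_EFinP/measurable_cnorm.
Qed.

Lemma has_cint_gamma s : 0 < Re s -> has_cint leb (gamma_fun s) (cGamma s).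
Proof.
move=> s0; have := abs_integrable_gamma s0.
have E := @has_cint_on R _ _ leb `]0, +oo[%classic (fun t => 0 < t)
  (fun t => cpow t (s - 1) * (expR (- t))%:C%C).
move=> i; apply/E => //; first by move=> x /=; rewrite in_itv/= andbT.
have /E [] // : has_cint leb (gamma_fun s) (cintegral leb setT (gamma_fun s)) by [].
by move=> x /=; rewrite in_itv/= andbT.
Qed.

Lemma has_cint_gamma_scale s (c : R) : 0 < Re s -> 0 < c ->
  has_cint leb (fun t => if 0 < t then cpow t (s - 1) * (expR (- (t * c)))%:C%C else 0)
    (cpow c (- s) * cGamma s).
Proof.
move=> s0 c0.
have g0 t : t <= 0 -> gamma_fun s t = 0 by move=> t0; rewrite /gamma_fun ltNge t0.
have := has_cintZ (cpow c (- s)) (has_cint_scale c0 g0 (has_cint_gamma s0)).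
apply: eq_has_cint => t; rewrite /gamma_fun pmulr_lgt0//.
case: ltP => t0; last by rewrite !mulr0.
rewrite cpowM// [cpow c (s - 1)]cpowB cpow1r// cpowN.
have c_neq0 : c%:C%C != 0 by apply/eqP => /(@complexI R)/eqP; rewrite gt_eqF.
by field; rewrite cpow_neq0 c_neq0.
Qed.

End gamma_function.

(** * Functional equation and absence of zeros of Gamma *)

Section gamma_nonzero.
Variable R : realType.
Local Notation C := R[i].
Local Notation Re := (@complex.Re R).
Local Notation Im := (@complex.Im R).
Local Notation T := (measurableTypeR R).
Local Notation leb := (@lebesgue_measure R).

Lemma abs_integrable_cnorm d (X : measurableType d) (mu : {measure set X -> \bar R})
    (f : X -> C) :
  abs_integrable mu setT f -> abs_integrable mu setT (fun x => (cnorm (f x))%:C%C).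
Proof.
move=> iF; have mf := abs_integrable_cmeasurable iF; have [_ _ foo] := iF.
split; [exact: measurable_cnorm|exact: measurable_cst|].
under eq_integral do rewrite -/(cnorm _) cnorm_real ?cnorm_ge0//.
exact: foo.
Qed.

(** [N] is the inner integral of the modulus; if it is integrable, Tonelli makes [f] integrable on
    the product, and the value passes from one order of integration to the other. *)
Lemma has_cint_prod_swap d1 d2 (T1 : measurableType d1) (T2 : measurableType d2)
    (mu1 : {sigma_finite_measure set T1 -> \bar R})
    (mu2 : {sigma_finite_measure set T2 -> \bar R}) (f : T1 * T2 -> C)
    (g1 N : T1 -> C) (g2 : T2 -> C) v :
  cmeasurable f ->
  (forall x, has_cint mu2 (fun y => (cnorm (f (x, y)))%:C%C) (N x)) ->
  abs_integrable mu1 setT N ->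
  (forall x, has_cint mu2 (fun y => f (x, y)) (g1 x)) ->
  (forall y, has_cint mu1 (fun x => f (x, y)) (g2 y)) ->
  has_cint mu1 g1 v -> has_cint mu2 g2 v.
Proof.
move=> mf hN /abs_integrableP[/integrable_lty Noo _] h1 h2 hv.
have iF : abs_integrable (mu1 \x mu2)%E setT f.
  apply: abs_integrable_prod => //; apply: le_lt_trans (Noo measurableT).
  rewrite le_eqVlt; apply/orP; left; apply/eqP; apply: eq_integral => x _.
  by rewrite (has_cint_ge0 _ (hN x))// => y; exact: cnorm_ge0.
rewrite (has_cint_unique hv (has_cint_fubini1 iF h1)).
exact: (has_cint_fubini2 (f := f) iF h2).
Qed.

(* Fubini for t^(s-1) e^(-r) on 0 < t < r, since int_0^r t^(s-1) dt = r^s / s. *)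
Lemma cGammaS s : 0 < Re s -> cGamma (s + 1) = s * cGamma s.
Proof.
move=> s0.
have s1 : 0 < Re (s + 1) by case: s s0 => a b /= a0; rewrite addr_gt0.
have s_neq0 : s != 0 by apply/eqP => E; move: s0; rewrite E ltxx.
pose f (p : T * T) : C := if (0 < p.1) && (p.1 < p.2)
  then cpow p.1 (s - 1) * (expR (- p.2))%:C%C else 0.
have mf : cmeasurable f.
  apply: cmeasurable_if0.
    by apply: measurable_and; exact: measurable_fun_ltr.
  apply: cmeasurableM; first exact: cmeasurable_cpow.
  apply: cmeasurable_real.
  by apply: (measurableT_comp (@measurable_expR R)); exact: measurable_funN.
have fE t r : f (t, r) = (if 0 < t then cpow t (s - 1) else 0) *
    (if t < r then (expR (- r))%:C%C else 0).
  by rewrite /f /=; case: (0 < t); case: (t < r); rewrite ?mul0r ?mulr0.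
have gE t : gamma_fun s t = (if 0 < t then cpow t (s - 1) else 0) * (expR (- t))%:C%C.
  by rewrite /gamma_fun; case: ifP => //; rewrite mul0r.
have H : has_cint leb (fun r => s^-1 * gamma_fun (s + 1) r) (cGamma s).
  have iN : abs_integrable leb setT (fun t => (cnorm (gamma_fun s t))%:C%C).
    exact/abs_integrable_cnorm/abs_integrable_gamma.
  apply: (@has_cint_prod_swap _ _ T T leb leb f (gamma_fun s) _ _ _ mf _ iN _ _ (has_cint_gamma s0)).
  - move=> t; rewrite gE cnormM rmorphM /= (cnorm_real (expR_ge0 _)).
    apply: eq_has_cint (has_cintZ _ (has_cint_expR_tail t)) => r.
    by rewrite fE cnormM rmorphM; case: (t < r); rewrite ?cnorm0// (cnorm_real (expR_ge0 _)).
  - move=> t; rewrite gE.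
    by apply: eq_has_cint (has_cintZ _ (has_cint_expR_tail t)) => r; rewrite fE.
  - move=> r; have [r0|r0] := leP r 0.
      rewrite /gamma_fun ltNge r0 /= mulr0.
      have := has_cintZ 0 (has_cint_gamma s0); rewrite mul0r.
      apply: eq_has_cint => t; rewrite mul0r /f /= ifF//.
      by apply/negbTE; rewrite negb_and -!leNgt; case: leP => //= t0; exact: le_trans r0 (ltW t0).
    rewrite /gamma_fun r0 addrK.
    have u0 t : t <= 0 -> unit_cpow s t = 0 by move=> t0; rewrite /unit_cpow ltNge t0.
    have ri : 0 < r^-1 by rewrite invr_gt0.
    have := has_cintZ (cpow r s * (expR (- r))%:C%C) (has_cint_scale ri u0 (has_cint_unit_cpow s0)).
    rewrite [X in has_cint _ _ X]mulrC; apply: eq_has_cint => t; rewrite /f/= /unit_cpow.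
    rewrite pmulr_lgt0// ltr_pdivrMr// mul1r; case: ltP => t0 /=; last by rewrite !mulr0.
    case: ltP => tr; last by rewrite !mulr0.
    rewrite cpowM// cpowV// [cpow r (- _)](_ : _ = cpow r 1 / cpow r s); last first.
      by rewrite -cpowB; congr cpow; ring.
    rewrite cpow1r// fmorphV /=.
    have r_neq0 : r%:C%C != 0 by apply/eqP => /(@complexI R)/eqP; rewrite gt_eqF.
    by field; rewrite cpow_neq0 r_neq0.
have := has_cint_unique H (has_cintZ s^-1 (has_cint_gamma s1)) => ->.
by rewrite mulrA divff// mul1r.
Qed.

Let sin_le (x : R) : sin x ^+ 2 <= x ^+ 2.
Proof.
have main (z : R) : 0 < z -> sin z ^+ 2 <= z ^+ 2.
  move=> z0; have [|c _] := @MVT R (@sin R) (@cos R) 0 z z0 (fun c _ => is_derive_sin c).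
    by apply: continuous_subspaceT => c; exact: continuous_sin.
  rewrite sin0 !subr0 => ->; rewrite exprMn; apply: ler_piMl; first exact: sqr_ge0.
  by rewrite cos2sin2 gerBl sqr_ge0.
have [x0|x0|->] := ltgtP x 0; [|exact: main|by rewrite sin0].
by rewrite -(sqrrN (sin x)) -sinN -(sqrrN x) main// oppr_gt0.
Qed.

(** Half-angle formula: cos x = 1 - 2 sin(x/2)^2. *)
Let cos_ge (x : R) : 1 - x ^+ 2 / 2 <= cos x.
Proof.
have xE : x = (x / 2) *+ 2 by rewrite -mulr_natr divfK// pnatr_eq0.
rewrite [in leRHS]xE cos_mulr2n.
have := sin_le (x / 2); rewrite sin2cos2 expr_div_n -natrX -mulr_natl; lra.
Qed.

(** With e the square root of u, the bracket is (e - 1/e)^2, and for u >= 1 one has ln(u) / 2 = ln e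
    <= e - 1 <= e - 1/e. Both sides are invariant under u -> 1/u. *)
Let sqr_ln_le (u : R) : 0 < u -> ln u ^+ 2 <= 4 * (u + u^-1 - 2).
Proof.
have main (v : R) : 1 <= v -> ln v ^+ 2 <= 4 * (v + v^-1 - 2).
  move=> v1; have v0 : 0 < v by exact: lt_le_trans v1.
  have l0 : 0 <= ln v by rewrite ln_ge0.
  pose e := expR (ln v / 2).
  have e2 : e ^+ 2 = v by rewrite expr2 -expRD -splitr lnK.
  have e0 : 0 < e by exact: expR_gt0.
  have e1 : 1 + ln v / 2 <= e by exact: expR_ge1Dx.
  have e1' : 1 <= e by apply: le_trans e1; rewrite lerDl divr_ge0.
  have -> : v + v^-1 - 2 = (e - e^-1) ^+ 2 by rewrite -e2; field; rewrite gt_eqF.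
  have : ln v / 2 <= e - e^-1.
    have : e^-1 <= 1 by rewrite invf_le1.
    lra.
  move=> h; have : (ln v / 2) ^+ 2 <= (e - e^-1) ^+ 2.
    by rewrite ler_sqr// nnegrE ?(le_trans _ h)// divr_ge0.
  by rewrite expr_div_n -natrX; lra.
move=> u0; have [u1|u1] := leP 1 u; first exact: main.
have := main u^-1; rewrite lnV// sqrrN invrK [_ + u]addrC; apply.
by rewrite invf_ge1// ltW.
Qed.

(** For x >= 1 the integrand is at least e^(-t) on t > 1, so the integral is at least 1/e. *)
Let cGamma_real_gt0 (x : R) : 1 <= x -> 0 < Re (cGamma x%:C%C).
Proof.
move=> x1; have x0 : 0 < x by exact: lt_le_trans x1.
apply: lt_le_trans (_ : Re (expR (- 1))%:C%C <= _); first by rewrite /= expR_gt0.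
apply: has_cint_le (has_cint_expR_tail 1) (has_cint_gamma (s := x%:C%C) x0) _ => t.
rewrite /gamma_fun; have [t1|t1] := ltP 1 t.
  rewrite (lt_trans ltr01 t1) -[1]/(1%:C%C) -rmorphB cpow_real -rmorphM /=.
  apply: ler_peMl; first exact: expR_ge0.
  by rewrite -[leLHS]expR0 ler_expR mulr_ge0 ?subr_ge0// ln_ge0// ltW.
case: ifP => // _; rewrite -[1]/(1%:C%C) -rmorphB cpow_real -rmorphM /=.
by rewrite mulr_ge0 ?expR_ge0.
Qed.

(* The integrand of x^(-iy) Gamma(x + iy) has real part
   t^(x-1) e^(-t) cos (y ln (t / x)), and cos z >= 1 - z^2 / 2 together with
   ln(u)^2 <= 4 (u + 1/u - 2) bounds it below by a combination of the integrands of
   Gamma(x + 1), Gamma(x) and Gamma(x - 1), whose integral is positive for large x. *)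
Let cGamma_large_neq0 (x y : R) : 1 < x -> 2 * y ^+ 2 < x - 1 -> cGamma (x +i* y)%C != 0.
Proof.
move=> x1 xy; have x0 : 0 < x by exact: lt_trans x1.
have x10 : 0 < x - 1 by rewrite subr_gt0.
pose c := cpow x (0 -i* y)%C.
pose G := Re (cGamma x%:C%C).
have G0 : 0 < G by exact/cGamma_real_gt0/ltW.
have hxy := has_cintZ c (has_cint_gamma (s := (x +i* y)%C) x0).
have hx (r : R) : 0 < r -> has_cint leb (gamma_fun r%:C%C) (cGamma r%:C%C).
  by move=> r0; exact: has_cint_gamma.
(* The coefficients come from expanding t^(x-1) e^(-t) (1 - 2 y^2 (t/x + x/t - 2)) in powers of t.
   By the functional equation the integral is Gamma(x) (x - 1 - 2 y^2) / (x - 1), whence the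
   hypothesis on [y]. *)
have hlow := has_cintD (has_cintD (has_cintZ (1 + 4 * y ^+ 2)%:C%C (hx _ x0))
  (has_cintZ (- (2 * y ^+ 2 / x))%:C%C (hx (x + 1) (addr_gt0 x0 ltr01))))
  (has_cintZ (- (2 * y ^+ 2 * x))%:C%C (hx _ x10)).
have := has_cint_le hlow hxy _.
have -> : cGamma (x + 1)%:C%C = x%:C%C * cGamma x%:C%C.
  by rewrite -cGammaS// rmorphD.
have GE : cGamma x%:C%C = (x - 1)%:C%C * cGamma (x - 1)%:C%C.
  by rewrite -cGammaS// -rmorphD subrK.
have x1C : (x - 1)%:C%C != 0 by apply/eqP => /(@complexI R)/eqP; rewrite gt_eqF.
have -> : cGamma (x - 1)%:C%C = ((x - 1)^-1)%:C%C * cGamma x%:C%C.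
  by rewrite GE mulrA fmorphV mulVf// mul1r.
have lowE (a b d : R) (z : C) : Re (a%:C%C * z + b%:C%C * (x%:C%C * z) +
    d%:C%C * (((x - 1)^-1)%:C%C * z)) = (a + b * x + d * (x - 1)^-1) * Re z.
  by case: z => z1 z2 /=; ring.
rewrite lowE -/G.
move=> low; apply/eqP => E; suff : 0 < Re (c * cGamma (x +i* y)%C).
  by rewrite E mulr0 ltxx.
apply: lt_le_trans (low _).
  rewrite mulr_gt0//.
  rewrite (_ : _ + _ + _ = (x - 1 - 2 * y ^+ 2) / (x - 1)).
    by rewrite divr_gt0// subr_gt0.
  by field; rewrite !gt_eqF.
move=> t; rewrite /gamma_fun; case: ifP => t0; last by rewrite !mulr0 !addr0.
have rE (r : R) : r%:C%C - 1 = (r - 1)%:C%C by rewrite rmorphB.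
have -> : Re (c * (cpow t ((x +i* y)%C - 1) * (expR (- t))%:C%C)) =
   expR ((x - 1) * ln t) * expR (- t) * cos (y * ln (t / x)).
  have -> : c * (cpow t ((x +i* y)%C - 1) * (expR (- t))%:C%C) =
     (expR ((x - 1) * ln t) * expR (- t))%:C%C * cpow (t / x) (0 +i* y)%C.
    rewrite cpow_div// -cpowN rmorphM /= -cpow_real.
    rewrite (_ : ((x +i* y)%C - 1) = (x - 1)%:C%C + (0 +i* y)%C); last first.
      by apply: complex_eq; rewrite /= ?addr0 ?add0r ?subr0.
    rewrite cpowD (_ : - (0 +i* y)%C = (0 -i* y)%C); first by rewrite -/c; ring.
    by apply: complex_eq; rewrite /= ?oppr0.
  rewrite [LHS]ReM [Re _%:C%C]/= [Im _%:C%C]/= mul0r subr0; congr (_ * _).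
  by rewrite /cpow /cexp ReM /= !(mul0r,mulr0,subr0,add0r,addr0,oppr0) expR0 mul1r.
rewrite !rE !cpow_real -!rmorphM /=.
have lnE (r : R) : expR ((r + 1) * ln t) = t * expR (r * ln t).
  by rewrite mulrDl mul1r expRD lnK// mulrC.
rewrite (_ : x + 1 - 1 = (x - 1 - 1) + 1 + 1); last by ring.
rewrite lnE (_ : x - 1 = (x - 1 - 1) + 1); last by ring.
rewrite !lnE addrK.
set e := expR _; set f := expR _.
have ef0 : 0 < t * e * f by rewrite !mulr_gt0// expR_gt0.
have u0 : 0 < t / x by rewrite divr_gt0.
apply: le_trans (_ : t * e * f * (1 - (y * ln (t / x)) ^+ 2 / 2) <= _); last first.
  by apply: ler_wpM2l; [exact: ltW|exact: cos_ge].
apply: le_trans (_ : t * e * f * (1 - y ^+ 2 * (4 * (t / x + (t / x)^-1 - 2)) / 2) <= _).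
  rewrite le_eqVlt; apply/orP; left; apply/eqP; field.
  by rewrite !gt_eqF.
apply: ler_wpM2l; first exact: ltW.
rewrite lerD2l lerN2 ler_wpM2r ?invr_ge0// exprMn ler_wpM2l ?sqr_ge0//.
exact: sqr_ln_le.
Qed.

(** The functional equation carries a zero at s to s + n. The imaginary part stays fixed while the
    real part grows, so [cGamma_large_neq0] applies for large n. *)
Lemma cGamma_neq0 s : 0 < Re s -> cGamma s != 0.
Proof.
move=> s0.
have up (n : nat) : cGamma s = 0 -> cGamma (s + n%:R) = 0.
  elim: n => [|n IH] E; first by rewrite addr0.
  rewrite -addn1 natrD addrA cGammaS ?IH ?mulr0//.
  rewrite (_ : n%:R = (n%:R : R)%:C%C); last by rewrite rmorph_nat.
  by case: s s0 {E IH} => a b /= a0; rewrite ltr_wpDr.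
apply/eqP => E; case: s s0 up E => a b /= a0 up E.
pose n := (Num.truncn (2 * b ^+ 2 + 1)).+1.
have := up n E; rewrite (_ : _ + _ = ((a + n%:R) +i* b)%C); last first.
  rewrite (_ : n%:R = (n%:R : R)%:C%C); last by rewrite rmorph_nat.
  by apply: complex_eq; rewrite /= ?addr0.
have nb : 2 * b ^+ 2 + 1 < n%:R by exact: truncnS_gt.
have b0 : 0 <= b ^+ 2 by exact: sqr_ge0.
by move/eqP; apply/negP/cGamma_large_neq0; lra.
Qed.

End gamma_nonzero.


(** * The Dirichlet integral and the integral over a row *)

Section dirichlet_integral.
Variable R : realType.
Local Notation C := R[i].
Local Notation Re := (@complex.Re R).
Local Notation T := (measurableTypeR R).
Local Notation leb := (@lebesgue_measure R).

Lemma ReD (z w : C) : Re (z + w) = Re z + Re w.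
Proof. by case: z; case: w. Qed.

Lemma Re_sum (I : Type) (r : seq I) (F : I -> C) :
  Re (\sum_(i <- r) F i) = \sum_(i <- r) Re (F i).
Proof.
by elim: r => [|i r IH]; rewrite ?big_nil// !big_cons ReD IH.
Qed.

Lemma all_posP m (w : seq R) : size w = m ->
  all (> 0) w = false -> exists2 i, (i < m)%N & nth 0 w i <= 0.
Proof.
move=> sw /negbT/allPn[x /(nthP 0) [i im <-]].
by rewrite -leNgt => h; exists i => //; rewrite -sw.
Qed.

Variables (m : nat) (d : nat -> R).
Hypothesis d0 : forall i, (i < m)%N -> 0 < d i.
Implicit Types (s : nat -> C) (tau : C).

Let h s (i : nat) (t x : R) : C :=
  if 0 < x then cpow x (s i - 1) * (expR (- (x * (t * d i))))%:C%C else 0.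

(** Integrated over w at fixed t it splits into Gamma integrals; integrated over t at fixed w it
    gives Gamma(tau) times the Dirichlet integrand. *)
Let F s tau (t : R) (w : seq R) : C :=
  gamma_fun tau t * \prod_(0 <= i < m) h s i t (nth 0 w i).

Let mF s tau : cmeasurable (fun p : T * m.-tuple T => F s tau p.1 p.2).
Proof.
have mn i : measurable_fun setT (fun p : T * m.-tuple T => nth 0 (p.2 : seq R) i : R).
  exact: measurable_nth_comp.
apply: cmeasurableM.
  exact: cmeasurable_comp measurable_fst (cmeasurable_gamma_fun tau).
apply: cmeasurable_prod => i _; apply: cmeasurable_if0.
  exact: measurable_fun_ltr.
apply: cmeasurableM; first exact: cmeasurable_cpow.
apply: cmeasurable_real; apply: (measurableT_comp (@measurable_expR R)).
by apply: measurable_funN; apply: measurable_funM => //; apply: measurable_funM.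
Qed.

Let inner_w s tau t : (forall i, (i < m)%N -> 0 < Re (s i)) ->
  tcint m (F s tau t)
    ((\prod_(0 <= i < m) (cpow (d i) (- s i) * cGamma (s i)))
     * gamma_fun (tau - \sum_(0 <= i < m) s i) t).
Proof.
move=> s0; have [t0|t0] := ltP 0 t; last first.
  rewrite /F /gamma_fun ltNge t0 /= mulr0.
  apply: (eq_has_cint (f := fun _ => (0 : R)%:C%C)); first by move=> w; rewrite mul0r.
  by apply: (ge0_has_cint (r := 0)) => //; rewrite integral0.
have H i : (i < m)%N -> has_cint leb (h s i t) (cpow (t * d i) (- s i) * cGamma (s i)).
  move=> im; apply: has_cint_gamma_scale; first exact: s0.
  by rewrite mulr_gt0// d0.
have := has_cintZ (gamma_fun tau t) (tcint_prod H).
congr has_cint; rewrite /gamma_fun t0.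
have -> : \prod_(0 <= i < m) (cpow (t * d i) (- s i) * cGamma (s i)) =
    cpow t (- \sum_(0 <= i < m) s i) *
    \prod_(0 <= i < m) (cpow (d i) (- s i) * cGamma (s i)).
  rewrite -sumrN cpow_sum -big_split/=; apply: eq_big_nat => i /= im.
  by rewrite cpowM ?d0//; ring.
by rewrite [tau - _ - 1]addrAC [cpow t (_ - _ - _)]cpowD; ring.
Qed.

(** Makes the integral of the modulus over w an instance of [inner_w], at the real parts of the
    exponents. *)
Let cnormF s tau t w : (cnorm (F s tau t w))%:C%C =
  F (fun i => (Re (s i))%:C%C) (Re tau)%:C%C t w.
Proof.
have E z : `|(z : C) - 1| = 0 -> True by [].
have subE (z : C) : (Re (z - 1))%:C%C = (Re z)%:C%C - 1.
  by case: z => a b; apply: complex_eq; rewrite /= ?subr0.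
rewrite cnormE /F normrM normr_prod; congr (_ * _).
  rewrite /gamma_fun; case: ifP => _; last exact: normr0.
  by rewrite normrM cpow_norm subE ger0_norm// ler0c expR_ge0.
apply: eq_bigr => i _; rewrite /h; case: ifP => _; last exact: normr0.
by rewrite normrM cpow_norm subE ger0_norm// ler0c expR_ge0.
Qed.

Let inner_t s tau (w : seq R) : size w = m -> 0 < Re tau ->
  has_cint leb (F s tau ^~ w) (if all (> 0) w then
    (\prod_(0 <= i < m) cpow (nth 0 w i) (s i - 1)) *
    (cpow (1 + \sum_(0 <= i < m) nth 0 w i * d i) (- tau) * cGamma tau) else 0).
Proof.
move=> sw tau0; case: ifPn => [w0|/negbTE w0]; last first.
  have [i im wi] := all_posP sw w0.
  have := has_cintZ 0 (has_cint_gamma tau0); rewrite mul0r.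
  apply: eq_has_cint => t; rewrite /F mul0r (bigD1_seq i) ?mem_index_iota ?iota_uniq//=.
  by rewrite /h ltNge wi mul0r mulr0.
have wi i : (i < m)%N -> 0 < nth 0 w i by rewrite -sw => /(nth_gt w0).
have c0 : 0 < 1 + \sum_(0 <= i < m) nth 0 w i * d i.
  rewrite ltr_wpDr// big_nat; apply: sumr_ge0 => i /= im.
  by rewrite mulr_ge0// ltW ?wi ?d0.
apply: eq_has_cint (has_cintZ _ (has_cint_gamma_scale tau0 c0)) => t.
rewrite /F /gamma_fun; case: ifP => _; last by rewrite mulr0 mul0r.
have -> : \prod_(0 <= i < m) h s i t (nth 0 w i) =
    (\prod_(0 <= i < m) cpow (nth 0 w i) (s i - 1)) *
    (expR (- (t * \sum_(0 <= i < m) nth 0 w i * d i)))%:C%C.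
  rewrite mulr_sumr -sumrN expR_sum rmorph_prod -big_split/=.
  by apply: eq_big_nat => i /= im; rewrite /h wi// mulrCA.
rewrite mulrDr mulr1 opprD expRD rmorphM /=; ring.
Qed.

(* Multiply by Gamma(tau) = int_0^oo t^(tau-1) e^(-t) dt and scale t by
   1 + sum w_i d_i: the w_i separate. *)
Lemma tcint_dirichlet s tau : (forall i, (i < m)%N -> 0 < Re (s i)) ->
  \sum_(0 <= i < m) Re (s i) < Re tau ->
  tcint m (fun w => if all (> 0) w then
      (\prod_(0 <= i < m) cpow (nth 0 w i) (s i - 1)) *
      cpow (1 + \sum_(0 <= i < m) nth 0 w i * d i) (- tau) else 0)
    ((\prod_(0 <= i < m) cpow (d i) (- s i)) *
     ((\prod_(0 <= i < m) cGamma (s i)) * cGamma (tau - \sum_(0 <= i < m) s i) / cGamma tau)).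
Proof.
move=> s0 stau.
have tau0 : 0 < Re tau.
  by apply: le_lt_trans stau; rewrite big_nat; apply: sumr_ge0 => i /= im; exact/ltW/s0.
have ds0 : 0 < Re (tau - \sum_(0 <= i < m) s i).
  by rewrite -(subr_gt0 _ (Re tau)) in stau; move: stau; rewrite -Re_sum; case: tau {tau0} => ?
    ?; case: (\sum_(0 <= i < m) s i).
pose K := \prod_(0 <= i < m) (cpow (d i) (- s i) * cGamma (s i)).
pose sr i := (Re (s i))%:C%C; pose tr := (Re tau)%:C%C.
have dr0 : 0 < Re (tr - \sum_(0 <= i < m) sr i).
  rewrite /tr /sr -rmorph_sum -rmorphB /= subr_gt0; exact: stau.
have HH : tcint m (fun w => if all (> 0) w then
      (\prod_(0 <= i < m) cpow (nth 0 w i) (s i - 1)) *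
      (cpow (1 + \sum_(0 <= i < m) nth 0 w i * d i) (- tau) * cGamma tau) else 0)
   (K * cGamma (tau - \sum_(0 <= i < m) s i)).
  apply: (@has_cint_prod_swap _ _ _ T (m.-tuple T) leb (@tuple_lebesgue R m)
    (fun p => F s tau p.1 p.2) (fun t => K * gamma_fun (tau - \sum_(0 <= i < m) s i) t)
    (fun t => (\prod_(0 <= i < m) (cpow (d i) (- sr i) * cGamma (sr i)))
     * gamma_fun (tr - \sum_(0 <= i < m) sr i) t) _ _ (mF s tau)).
  - move=> t; have := inner_w (s := sr) tr t s0.
    by apply: eq_has_cint => w; rewrite cnormF.
  - exact: (has_cintZ _ (has_cint_gamma dr0)).1.
  - by move=> t; exact: inner_w.
  - by move=> w; apply: inner_t => //; exact: size_tuple.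
  - by have := has_cintZ K (has_cint_gamma ds0).
(* [HH] carries Gamma(tau) inside the integral; only a nonzero factor can be divided out. *)
have tau_neq0 : cGamma tau != 0 by exact: cGamma_neq0.
rewrite /tcint.
rewrite [X in has_cint _ _ X](_ : _ =
    (cGamma tau)^-1 * (K * cGamma (tau - \sum_(0 <= i < m) s i))); last first.
  rewrite /K [X in _ = _ * (X * _)]big_split/=; ring.
have HZ := has_cintZ (cGamma tau)^-1 HH.
apply: eq_has_cint HZ => w /=.
case: ifP => _; last by rewrite mulr0.
by field.
Qed.

End dirichlet_integral.

(** * Powers of the weights as products of differences *)

Section row_kernel.
Variable R : realType.
Local Notation C := R[i].
Local Notation Re := (@complex.Re R).
Local Notation T := (measurableTypeR R).
Local Notation leb := (@lebesgue_measure R).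
Implicit Types (a l w : seq R) (s : nat -> C) (tau : C).

(** Unfolds the recursion into finitely many comparisons of coordinates, from which measurability
    follows. *)
Lemma interlaced_index a l : size l = size a ->
  interlaced a l = all (fun i => (nth 0 a i < nth 0 l i) &&
    ((i.+1 < size a)%N ==> (nth 0 l i < nth 0 a i.+1))) (iota 0 (size a)).
Proof.
elim: a l => [|x a IH] [|y l]//= [sz]; rewrite IH// -andbA; congr (_ && _).
rewrite -[1%N]/(1 + 0)%N iotaDl all_map; congr (_ && _).
by case: a {IH sz}.
Qed.

Lemma measurable_interlaced d (X : measurableType d) m (a l : X -> seq R) :
  (forall x, size (a x) = m) -> (forall x, size (l x) = m) ->
  (forall i, measurable_fun setT (fun x => nth 0 (a x) i : R)) ->
  (forall i, measurable_fun setT (fun x => nth 0 (l x) i : R)) ->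
  measurable_fun setT (fun x => interlaced (a x) (l x)).
Proof.
move=> sa sl ma ml.
rewrite (_ : (fun _ => _) = fun x => \big[andb/true]_(i <- iota 0 m)
    ((nth 0 (a x) i < nth 0 (l x) i) &&
      (if (i.+1 < m)%N then nth 0 (l x) i < nth 0 (a x) i.+1 else true))).
  apply: measurable_big_andb => i _; apply: measurable_and.
    exact: measurable_fun_ltr.
  by case: (i.+1 < m)%N => //; exact: measurable_fun_ltr.
by apply/funext => x; rewrite interlaced_index ?sa ?sl// big_all.
Qed.

(** For the head, [prod_interlaced] at t = x makes 1 + [fracsum] a quotient of positive products.
    For the tail, all remaining nodes lie above both x and y, so the factors (a_i - y) / (a_i - x)
    are positive. *)
Lemma weights_gt0 a l : interlaced a l -> all (> 0) (weights a l).
Proof.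
elim: a l => [|x a IH] [|y l]//= /and3P[xy ya al].
have sa := interlaced_lt al.
have xa : all (> x) a by apply: head_lt_all => //; case: a ya {IH al sa} => // x' a; exact: lt_trans.
have ya' : all (> y) a by exact: head_lt_all.
apply/andP; split.
  rewrite mulr_gt0 ?subr_gt0//.
  have := prod_interlaced al xa.
  have xl : all (> x) l.
    suff /andP[] : all (> x) a && all (> x) l by [].
    by apply: interlaced_ltl al _; case: a xa {IH sa ya ya'} => //= ? ? /andP[].
  have := prod_shift_gt0 xl => /[swap] <-.
  by rewrite pmulr_rgt0// prod_shift_gt0.
apply/(all_nthP 0) => i; rewrite size_mkseq => ia; rewrite nth_mkseq//.
have wi : 0 < nth 0 (weights a l) i.
  by apply: nth_gt; [exact: IH|rewrite size_weights//; exact: size_interlaced].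
by rewrite divr_gt0 ?mulr_gt0// subr_gt0 nth_gt.
Qed.

(** The residue formula for w_i raised to the powers s_i - 1: a pair i < j of nodes receives the
    exponent 1 - s_i from w_i and 1 - s_j from w_j. The proof follows the recursion of [weights]
    instead of the closed formula. *)
Lemma prod_weights_cpow a l s : interlaced a l ->
  \prod_(0 <= i < size a) cpow (nth 0 (weights a l) i) (s i - 1) =
  (\prod_(0 <= i < size a) \prod_(0 <= p < size a)
     cpow `|nth 0 l p - nth 0 a i| (s i - 1)) *
  (\prod_(0 <= j < size a) \prod_(0 <= i < j)
     cpow (nth 0 a j - nth 0 a i) (- (s i + s j - 2))).
Proof.
elim: a l s => [|x a IH] [|y l] s //=; first by rewrite !big_geq// mul1r.
move=> /and3P[xy ya al].
have sa := interlaced_lt al; have sz := size_interlaced al.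
have xa : all (> x) a by apply: head_lt_all => //; case: a ya {IH al sa sz} => // x' a; exact: lt_trans.
have ya' : all (> y) a by exact: head_lt_all.
have xl : all (> x) l.
  suff /andP[] : all (> x) a && all (> x) l by [].
  by apply: interlaced_ltl al _; case: a xa {IH sa sz ya ya'} => //= ? ? /andP[].
have ax i : (i < size a)%N -> 0 < nth 0 a i - x by move=> ia; rewrite subr_gt0 nth_gt.
have ay i : (i < size a)%N -> 0 < nth 0 a i - y by move=> ia; rewrite subr_gt0 nth_gt.
have lx i : (i < size a)%N -> 0 < nth 0 l i - x by move=> ia; rewrite subr_gt0 nth_gt// -sz.
have yx : 0 < y - x by rewrite subr_gt0.
have wi i : (i < size a)%N -> 0 < nth 0 (weights a l) i.
  by move=> ia; apply: nth_gt; [exact: weights_gt0|rewrite size_weights].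
set A := size a in IH ax ay lx wi sz *.
rewrite [LHS]big_nat_recl//= [X in _ = X * _]big_nat_recl//=.
rewrite [X in _ = X * _ * _]big_nat_recl//= [X in _ = _ * X]big_nat_recl//= [X in _ = _ * (X *
  _)]big_geq// mul1r.
rewrite (gtr0_norm yx).
(* By [prod_interlaced] at t = x the weight of the smallest node is a quotient of two products of
   differences. *)
have -> : cpow ((y - x) * (1 + fracsum a (weights a l) x)) (s 0%N - 1) =
  cpow (y - x) (s 0%N - 1) * \prod_(0 <= p < A) cpow (nth 0 l p - x) (s 0%N - 1)
  * \prod_(0 <= i < A) cpow (nth 0 a i - x) (- (s 0%N - 1)).
  have P0 := prod_shift_gt0 xa; have Q0 := prod_shift_gt0 xl.
  have E := prod_interlaced al xa.
  have F0 : 0 < 1 + fracsum a (weights a l) x by rewrite -E pmulr_rgt0 in Q0.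
  have -> : \prod_(0 <= i < A) cpow (nth 0 a i - x) (- (s 0%N - 1)) =
      cpow (\prod_(0 <= i < A) (nth 0 a i - x)) (- (s 0%N - 1)).
    by rewrite cpow_prod// => i; rewrite mem_index_iota => /ax.
  have -> : \prod_(0 <= p < A) cpow (nth 0 l p - x) (s 0%N - 1) =
      cpow (\prod_(0 <= p < A) (nth 0 l p - x)) (s 0%N - 1).
    by rewrite cpow_prod// => i; rewrite mem_index_iota => /lx.
  rewrite cpowM// sz -E cpowM// cpowN -?sz -/A.
  by field; rewrite cpow_neq0.
have -> : \prod_(0 <= i < A) cpow (nth 0 (mkseq (fun i => nth 0 (weights a l) i *
      (nth 0 a i - y) / (nth 0 a i - x)) A) i) (s i.+1 - 1) =
  (\prod_(0 <= i < A) cpow (nth 0 (weights a l) i) (s i.+1 - 1)) *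
  ((\prod_(0 <= i < A) cpow (nth 0 a i - y) (s i.+1 - 1)) *
   (\prod_(0 <= i < A) cpow (nth 0 a i - x) (- (s i.+1 - 1)))).
  rewrite -[X in _ = _ * X]big_split -[RHS]big_split /=.
  apply: eq_big_nat => i /= ia.
  by rewrite nth_mkseq// cpow_div ?mulr_gt0 ?ax ?ay ?wi// cpowM ?ay ?wi// cpowN mulrA.
rewrite (IH l (fun i => s i.+1) al).
have -> : \prod_(0 <= p < A) cpow `|nth 0 l p - x| (s 0%N - 1) =
    \prod_(0 <= p < A) cpow (nth 0 l p - x) (s 0%N - 1).
  by apply: eq_big_nat => p /= pa; rewrite gtr0_norm// lx.
have -> : \prod_(0 <= i < A) \prod_(0 <= p < A.+1) cpow `|nth 0 (y :: l) p - nth 0 a i| (s i.+1 - 1)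
  = (\prod_(0 <= i < A) cpow (nth 0 a i - y) (s i.+1 - 1)) *
    (\prod_(0 <= i < A) \prod_(0 <= p < A) cpow `|nth 0 l p - nth 0 a i| (s i.+1 - 1)).
  rewrite -[RHS]big_split; apply: eq_big_nat => i /= ia.
  by rewrite big_nat_recl//= distrC (gtr0_norm (ay i ia)).
have -> : \prod_(0 <= i < A) \prod_(0 <= i0 < i.+1)
    cpow (nth 0 a i - nth 0 (x :: a) i0) (- (s i0 + s i.+1 - 2)) =
  (\prod_(0 <= i < A) cpow (nth 0 a i - x) (- (s 0%N - 1))) *
  (\prod_(0 <= i < A) cpow (nth 0 a i - x) (- (s i.+1 - 1))) *
  \prod_(0 <= i < A) \prod_(0 <= i0 < i)
    cpow (nth 0 a i - nth 0 a i0) (- (s i0.+1 + s i.+1 - 2)).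
  rewrite -[X in _ = X * _]big_split -[RHS]big_split; apply: eq_big_nat => i /= ia.
  rewrite big_nat_recl//= -cpowD; congr (cpow _ _ * _); ring.
ring.
Qed.

End row_kernel.

(** * The integral over one row *)

Section row_integral.
Variable R : realType.
Local Notation C := R[i].
Local Notation Re := (@complex.Re R).
Local Notation T := (measurableTypeR R).
Implicit Types (a l w : seq R) (s : nat -> C) (tau : C).

(* The quotient of the integrands of sizes n + 1 and n, as a function of row n
   (padded with 0) and row n + 1; see triangle_integrandS. *)
Definition row_kernel a s tau l : C :=
  (\prod_(0 <= i < size a) cpow (1 + nth 0 a i) (tau - s i)) *
  (\prod_(0 <= p < size a) cpow (1 + nth 0 l p) (- tau)) *
  (\prod_(0 <= i < size a) \prod_(0 <= p < size a)
     cpow `|nth 0 l p - nth 0 a i| (s i - 1)) *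
  (\prod_(0 <= j < size a) \prod_(0 <= i < j)
     cpow (nth 0 a j - nth 0 a i) (- (s i + s j - 1))) *
  (vandermonde l)%:C%C.

(** What remains of [row_kernel], in the coordinates [w], after the Vandermonde product of [l] has
    been absorbed by the change of variables. *)
Let weight_fun a s tau w : C :=
  ((vandermonde a)^-1)%:C%C * (\prod_(0 <= i < size a) cpow (1 + nth 0 a i) (- s i)) *
  ((\prod_(0 <= i < size a) cpow (nth 0 w i) (s i - 1)) *
   cpow (1 + \sum_(0 <= i < size a) nth 0 w i * (1 + nth 0 a i)^-1) (- tau)).

(** The exponents in [row_kernel] are one lower than those produced by the weights; the resulting
    factor 1 / V(a) is compensated by the V(a) of [itint_interlaced]. *)
Let vandermonde_cpow a s : sorted <%R a ->
  \prod_(0 <= j < size a) \prod_(0 <= i < j)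
     cpow (nth 0 a j - nth 0 a i) (- (s i + s j - 1)) =
  ((vandermonde a)^-1)%:C%C * \prod_(0 <= j < size a) \prod_(0 <= i < j)
     cpow (nth 0 a j - nth 0 a i) (- (s i + s j - 2)).
Proof.
move=> sa; rewrite fmorphV /vandermonde rmorph_prod -prodfV -[RHS]big_split.
apply: eq_big_nat => j /= ja; rewrite rmorph_prod -prodfV -[RHS]big_split.
apply: eq_big_nat => i /= ij.
have x0 : 0 < nth 0 a j - nth 0 a i.
  by rewrite subr_gt0; apply: (sorted_ltn_nth lt_trans) => //; rewrite inE (ltn_trans ij).
rewrite -cpow1r// -cpowN -cpowD; congr cpow; ring.
Qed.

Let row_kernelE a s tau l : interlaced a l -> all (> -1) a ->
  row_kernel a s tau l = (vandermonde l)%:C%C * weight_fun a s tau (weights a l).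
Proof.
move=> al a1; have sa := interlaced_lt al.
rewrite /row_kernel /weight_fun (vandermonde_cpow s sa) (prod_weights_cpow s al).
(* The expansion at t = -1, where all factors are positive and may be raised to the power -tau. *)
have E := prod_interlaced al a1.
have ai i : (i < size a)%N -> 0 < 1 + nth 0 a i.
  by move=> ia; rewrite -ltrBlDl sub0r nth_gt.
have sz := size_interlaced al.
have l1 : all (> -1) l.
  suff /andP[] : all (> -1) a && all (> -1) l by [].
  by apply: interlaced_ltl al _; case: a a1 {E sa ai sz} => //= ? ? /andP[].
have li i : (i < size a)%N -> 0 < 1 + nth 0 l i.
  by move=> ia; rewrite -ltrBlDl sub0r nth_gt// -sz.
have -> : \prod_(0 <= i < size a) cpow (1 + nth 0 a i) (tau - s i) =
    cpow (\prod_(0 <= i < size a) (1 + nth 0 a i)) tau *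
    \prod_(0 <= i < size a) cpow (1 + nth 0 a i) (- s i).
  rewrite cpow_prod; last by move=> i; rewrite mem_index_iota => /ai.
  rewrite -[RHS]big_split; apply: eq_bigr => i _.
  by rewrite cpowD.
have -> : \prod_(0 <= p < size a) cpow (1 + nth 0 l p) (- tau) =
    cpow (\prod_(0 <= i < size a) (1 + nth 0 a i)) (- tau) *
    cpow (1 + \sum_(0 <= i < size a) nth 0 (weights a l) i * (1 + nth 0 a i)^-1) (- tau).
  have aE : \prod_(0 <= i < size a) (1 + nth 0 a i) = \prod_(0 <= i < size a) (nth 0 a i - -1).
    by apply: eq_bigr => i _; rewrite opprK addrC.
  have a0 := prod_shift_gt0 a1; have l0 := prod_shift_gt0 l1.
  have fE : 1 + \sum_(0 <= i < size a) nth 0 (weights a l) i * (1 + nth 0 a i)^-1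
      = 1 + fracsum a (weights a l) (-1).
    by congr (1 + _); apply: eq_bigr => i _; rewrite opprK addrC.
  rewrite -cpowM ?fE ?aE//; last by rewrite -E pmulr_rgt0 in l0.
  rewrite E -sz cpow_prod => [|i]; last first.
    by rewrite mem_index_iota opprK addrC => /li.
  by apply: eq_bigr => i _; rewrite opprK addrC.
rewrite !cpowN; field.
by rewrite !cpow_neq0 andbT fmorph_eq0 gt_eqF ?vandermonde_gt0.
Qed.

Lemma interlaced_ltr a l : interlaced a l -> sorted <%R l.
Proof.
elim: a l => [|x a IH] [|y l]//= /and3P[xy ya al].
rewrite path_min_sorted; first exact: IH al.
by have /andP[] := interlaced_ltl al ya.
Qed.

Lemma tcint_row a s tau : sorted <%R a -> all (> -1) a ->
  (forall i, (i < size a)%N -> 0 < Re (s i)) ->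
  \sum_(0 <= i < size a) Re (s i) < Re tau ->
  tcint (size a) (fun l => if interlaced a l then row_kernel a s tau l else 0)
    ((\prod_(0 <= i < size a) cGamma (s i)) *
     cGamma (tau - \sum_(0 <= i < size a) s i) / cGamma tau).
Proof.
move=> sa a1 s0 stau; set m := size a in s0 stau *.
have ai i : (i < m)%N -> 0 < 1 + nth 0 a i.
  by move=> ia; rewrite -ltrBlDl sub0r nth_gt.
(* With these parameters the Dirichlet sum is [fracsum] at t = -1; the powers d_i^(-s_i) in the
   result cancel against [cst]. *)
pose d i := (1 + nth 0 a i)^-1.
have d0 i : (i < m)%N -> 0 < d i by move=> im; rewrite invr_gt0 ai.
pose cst := \prod_(0 <= i < m) cpow (1 + nth 0 a i) (- s i).
have V0 := vandermonde_gt0 sa.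
have mn (i : nat) : measurable_fun setT (fun t : m.-tuple T => nth 0 (t : seq R) i : R).
  exact: measurable_nth.
have mpos : measurable_fun setT (fun t : m.-tuple T => all (> 0) (t : seq R)).
  exact: measurable_all_pos.
have mPsi : seq_cmeasurable m (weight_fun a s tau).
  apply: cmeasurableM; first exact: cmeasurable_cst.
  apply: cmeasurableM.
    by apply: cmeasurable_prod => i _; exact: cmeasurable_cpow.
  apply: cmeasurable_cpow; apply: measurable_funD => //.
  by apply: measurable_sum => i; exact: measurable_funM.
pose f w := if all (> 0) w then (vandermonde a)%:C%C * weight_fun a s tau w else 0.
have mf : seq_cmeasurable m f.
  by apply: cmeasurable_if0 => //; apply: cmeasurableM => //; exact: cmeasurable_cst.
have mg : seq_cmeasurable m (fun l => if interlaced a l then row_kernel a s tau l else 0).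
  apply: cmeasurable_if0.
    apply: measurable_interlaced => //; first exact: size_tuple.
  apply: cmeasurableM; last first.
    apply: cmeasurable_real.
    rewrite (_ : (fun _ => _) = fun t : m.-tuple T =>
        \prod_(0 <= j < m) \prod_(0 <= i < j) (nth 0 (t : seq R) j - nth 0 (t : seq R) i)); last first.
      by apply/funext => t; rewrite /vandermonde size_tuple.
    by do 2 (apply: measurable_prod => ? _); exact: measurable_funB.
  apply: cmeasurableM; last exact: cmeasurable_cst.
  apply: cmeasurableM.
    apply: cmeasurableM; first exact: cmeasurable_cst.
    by apply: cmeasurable_prod => i _; apply: cmeasurable_cpow; exact: measurable_funD.
  apply: cmeasurable_prod => i _; apply: cmeasurable_prod => p _; apply: cmeasurable_cpow.
  by apply: measurableT_comp => //; exact: measurable_funB.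
apply: (tcint_transfer mf mg).
  move=> b1 b2.
  transitivity (itint m (fun w => ((vandermonde a)%:E *
      (if all (> 0)%R w then (cpart b1 b2 (weight_fun a s tau w))%:E else 0))%E)).
    apply: eq_itint => w _; rewrite /f; case: ifP => _; last by rewrite mule0 cpart0.
    by rewrite cpartZ// ltW.
  have mc : measurable_fun setT (fun t : m.-tuple T => (cpart b1 b2 (weight_fun a s tau t))%:E).
    by apply/measurable_EFinP; exact: measurable_cpart.
  rewrite itintZl//; last 3 first.
  - exact: ltW.
  - by move=> w; case: ifP => // _; rewrite lee_fin cpart_ge0.
  - exact: measurable_fun_if0.
  rewrite -(itint_interlaced (G := fun w => (cpart b1 b2 (weight_fun a s tau w))%:E))//; last first.
    by move=> w; rewrite lee_fin cpart_ge0.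
  apply: eq_itint => l _; case: ifP => al; last by rewrite cpart0.
  by rewrite row_kernelE// cpartZ// ltW// vandermonde_gt0// (interlaced_ltr al).
have D := has_cintZ cst (tcint_dirichlet d0 s0 stau).
rewrite [X in tcint _ _ X](_ : _ = cst * (\prod_(0 <= i < m) cpow (d i) (- s i) *
   ((\prod_(0 <= i < m) cGamma (s i)) * cGamma (tau - \sum_(0 <= i < m) s i) / cGamma tau))).
  apply: eq_has_cint D => t; rewrite /f; case: ifP => _; last by rewrite mulr0.
  rewrite /weight_fun -/m -/cst fmorphV -!mulrA mulVKf// fmorph_eq0.
  by rewrite gt_eqF.
have c1 : cst * \prod_(0 <= i < m) cpow (d i) (- s i) = 1.
  rewrite -[LHS]big_split big_nat big1// => i /= im.
  by rewrite /d cpowV ?ai// opprK -cpowD addNr cpow0.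
by rewrite [RHS]mulrA c1 mul1r.
Qed.

End row_integral.

(** * Triangles *)

Section triangle_factorization.
Variable R : realType.
Local Notation C := R[i].
Local Notation T := (measurableTypeR R).

(** [x] is row n and [r] is row n + 1. The padding node 0 carries the exponent sg': its pairs with
    the r_p give r_p^(sg' - 1), and its pairs with the x_i give x_i^(-(sg' + th_i - 1)), the
    quotient of x_i^(sg - sg' - th_i) and x_i^(sg - 1). *)
Lemma row_kernel_match n (x r : nat -> R) (sg sg' tau tau' : C) (th : nat -> C) :
  (forall i, (i < n)%N -> 0 < x i) ->
  (forall i j, (i < j < n)%N -> x i < x j) ->
  (forall p, (p < n.+1)%N -> 0 < r p) ->
  (\prod_(0 <= i < n) (cpow (x i) (sg - sg' - th i) / cpow (1 + x i) (tau - tau' + th i))) *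
  (\prod_(0 <= p < n.+1) (cpow (r p) (sg' - 1) / cpow (1 + r p) tau')) *
  ((\prod_(0 <= i < n) \prod_(0 <= p < n.+1) cpow `|x i - r p| (th i - 1)) /
   (\prod_(0 <= j < n) \prod_(0 <= i < j) cpow (x j - x i) (th i + th j - 2))) *
  (\prod_(0 <= q < n.+1) \prod_(0 <= p < q) (r q - r p)%:C%C) =
  (\prod_(0 <= i < n) (cpow (x i) (sg - 1) / cpow (1 + x i) tau)) *
  (\prod_(0 <= j < n) \prod_(0 <= i < j) (x j - x i)%:C%C) *
  row_kernel (0 :: mkseq x n) (fun i => if i is i'.+1 then th i' else sg') tau' (mkseq r n.+1).
Proof.
move=> x0 xx r0.
rewrite /row_kernel [size _]/= size_mkseq /vandermonde size_mkseq.
have -> : (\prod_(0 <= j < n.+1) \prod_(0 <= i < j)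
    (nth 0 (mkseq r n.+1) j - nth 0 (mkseq r n.+1) i))%:C%C =
  \prod_(0 <= q < n.+1) \prod_(0 <= p < q) (r q - r p)%:C%C.
  rewrite rmorph_prod; apply: eq_big_nat => q /= qn; rewrite rmorph_prod.
  by apply: eq_big_nat => p /= pq; rewrite !nth_mkseq// (ltn_trans pq).
rewrite [RHS]mulrA; congr (_ * _).
rewrite [X in _ = _ * (X * _ * _ * _)]big_nat_recl//= addr0 cpow1l mul1r.
have -> : \prod_(0 <= p < n.+1) cpow (1 + nth 0 (mkseq r n.+1) p) (- tau') =
    \prod_(0 <= p < n.+1) (cpow (1 + r p) tau')^-1.
  by apply: eq_big_nat => p /= pn; rewrite nth_mkseq// cpowN.
rewrite [X in _ = _ * (_ * X * _)]big_nat_recl//=.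
have -> : \prod_(0 <= p < n.+1) cpow `|nth 0 (mkseq r n.+1) p - 0| (sg' - 1) =
    \prod_(0 <= p < n.+1) cpow (r p) (sg' - 1).
  by apply: eq_big_nat => p /= pn; rewrite nth_mkseq// subr0 gtr0_norm// r0.
have -> : \prod_(0 <= i < n) \prod_(0 <= p < n.+1)
     cpow `|nth 0 (mkseq r n.+1) p - nth 0 (mkseq x n) i| (th i - 1) =
   \prod_(0 <= i < n) \prod_(0 <= p < n.+1) cpow `|x i - r p| (th i - 1).
  apply: eq_big_nat => i /= iN; apply: eq_big_nat => p /= pn.
  by rewrite !nth_mkseq// distrC.
rewrite [X in _ = _ * (_ * X)]big_nat_recl//= [X in _ = _ * (_ * (X * _))]big_geq// mul1r.
have -> : \prod_(0 <= p < n.+1) (cpow (r p) (sg' - 1) / cpow (1 + r p) tau') =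
   (\prod_(0 <= p < n.+1) cpow (r p) (sg' - 1)) * (\prod_(0 <= p < n.+1) (cpow (1 + r p) tau')^-1).
  by rewrite -[RHS]big_split.
have E1 : \prod_(0 <= i < n) (cpow (x i) (sg - sg' - th i) / cpow (1 + x i) (tau - tau' + th i)) =
  (\prod_(0 <= i < n) (cpow (x i) (sg - 1) / cpow (1 + x i) tau)) *
  (\prod_(0 <= i < n) cpow (1 + nth 0 (mkseq x n) i) (tau' - th i)) *
  \prod_(0 <= i < n) cpow (x i) (- (sg' + th i - 1)).
  rewrite -[X in _ = X * _]big_split -[RHS]big_split; apply: eq_big_nat => i /= iN.
  rewrite nth_mkseq// -!cpowN.
  rewrite [cpow (x i) (sg - sg' - th i)](_ : _ = cpow (x i) (sg - 1) * cpow (x i) (- (sg' + th i - 1))).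
    rewrite [cpow (1 + x i) (- (tau - tau' + th i))](_ : _ =
       cpow (1 + x i) (- tau) * cpow (1 + x i) (tau' - th i)); first by ring.
    by rewrite -cpowD; congr cpow; ring.
  by rewrite -cpowD; congr cpow; ring.
have E2 : (\prod_(0 <= j < n) \prod_(0 <= i < j) cpow (x j - x i) (th i + th j - 2))^-1 *
  \prod_(0 <= i < n) cpow (x i) (- (sg' + th i - 1)) =
  (\prod_(0 <= j < n) \prod_(0 <= i < j) (x j - x i)%:C%C) *
  \prod_(0 <= i < n) \prod_(0 <= i0 < i.+1)
    cpow (nth 0 (mkseq x n) i - nth 0 (0 :: mkseq x n) i0)
      (- ((if i0 is i'.+1 then th i' else sg') + th i - 1)).
  rewrite -prodfV -[LHS]big_split -[RHS]big_split; apply: eq_big_nat => j /= jn.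
  rewrite big_nat_recl//= nth_mkseq// subr0 [LHS]mulrC [RHS]mulrCA; congr (_ * _).
  rewrite -prodfV -[RHS]big_split; apply: eq_big_nat => i /= ij.
  rewrite nth_mkseq ?(ltn_trans ij)// -cpow1r ?subr_gt0 ?xx ?ij// -cpowN -cpowD.
  by congr cpow; ring.
rewrite E1; move: E2.
set A := \prod_(0 <= i < n) \prod_(0 <= i0 < i.+1) _.
set B := \prod_(0 <= i < n) cpow (x i) (- (sg' + th i - 1)).
set D := (\prod_(0 <= j < n) \prod_(0 <= i < j) cpow (x j - x i) _)^-1.
set V := \prod_(0 <= j < n) \prod_(0 <= i < j) (x j - x i)%:C%C.
move: A B D V => A B D V E2.
set P := \prod_(0 <= i < n) (_ / _).
set Q := \prod_(0 <= i < n) cpow (1 + _) _.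
set S := \prod_(0 <= p < n.+1) cpow (r p) _.
set U := \prod_(0 <= p < n.+1) _^-1.
set W := \prod_(0 <= i < n) \prod_(0 <= p < n.+1) _.
move: P Q S U W => P Q S U W.
transitivity (P * Q * S * U * W * (D * B)); first by ring.
by rewrite E2; ring.
Qed.

End triangle_factorization.

Section triangle_integrand.
Variable R : realType.
Local Notation C := R[i].
Local Notation Re := (@complex.Re R).
Variables (sigma tau : nat -> C) (theta : nat -> nat -> C).
Implicit Types (l : nat -> nat -> R).

(** [rayleigh_integrand] for an arbitrary array of entries, so that sizes n and n + 1 can be
    evaluated on the same array. *)
Definition triangle_integrand n l : C :=
  (\prod_(1 <= j < n) \prod_(1 <= a < j.+1)
     (cpow (l j a) (sigma j - sigma j.+1 - theta j a)
      / cpow (1 + l j a) (tau j - tau j.+1 + theta j a)))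
  * (\prod_(1 <= p < n.+1)
       (cpow (l n p) (sigma n - 1) / cpow (1 + l n p) (tau n)))
  * (\prod_(1 <= j < n)
       ((\prod_(1 <= a < j.+1) \prod_(1 <= p < j.+2)
           cpow `|l j a - l j.+1 p| (theta j a - 1))
        / (\prod_(1 <= b < j.+1) \prod_(1 <= a < b)
             cpow (l j b - l j a) (theta j a + theta j b - 2))))
  * (\prod_(1 <= q < n.+1) \prod_(1 <= p < q) (l n q - l n p)%:C%C).

Lemma eq_triangle_integrand n l l' :
  (forall j k, (0 < k <= j)%N -> (j <= n)%N -> l j k = l' j k) ->
  triangle_integrand n l = triangle_integrand n l'.
Proof.
move=> ll'; rewrite /triangle_integrand.
have lj j k : (0 < k)%N -> (k <= j)%N -> (j <= n)%N -> l j k = l' j k.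
  by move=> k0 kj jn; rewrite ll'// k0.
congr (_ * _ * _ * _).
- apply: eq_big_nat => j /andP[_ jn]; apply: eq_big_nat => a /andP[a1 aj].
  by rewrite lj// ltnW.
- by apply: eq_big_nat => a /andP[a1 aj]; rewrite lj.
- apply: eq_big_nat => j /andP[_ jn]; congr (_ / _).
    apply: eq_big_nat => a /andP[a1 aj]; apply: eq_big_nat => p /andP[p1 pj].
    by rewrite !lj// ltnW.
  apply: eq_big_nat => b /andP[b1 bj]; apply: eq_big_nat => a /andP[a1 ab].
  by rewrite !lj// ?(ltnW jn)// ltnW// (leq_trans ab).
- apply: eq_big_nat => b /andP[b1 bj]; apply: eq_big_nat => a /andP[a1 ab].
  by rewrite !lj// ltnW// (leq_trans ab).
Qed.

Let prod1S (F : nat -> C) n : \prod_(1 <= i < n.+1) F i = \prod_(0 <= i < n) F i.+1.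
Proof. by rewrite big_add1. Qed.

(** The condition on [F 0] covers n = 0, where both ranges are empty and the last factor is [F 0];
    thus the recursion can start at the empty triangle. *)
Let prod1_recr (F : nat -> C) n : F 0%N = 1 ->
  \prod_(1 <= i < n.+1) F i = \prod_(1 <= i < n) F i * F n.
Proof.
move=> F0; case: n => [|n]; first by rewrite !big_geq// F0 mulr1.
by rewrite big_nat_recr.
Qed.

Lemma triangle_integrandS n l :
  (forall i, (i < n)%N -> 0 < l n i.+1) ->
  (forall i j, (i < j < n)%N -> l n i.+1 < l n j.+1) ->
  (forall p, (p < n.+1)%N -> 0 < l n.+1 p.+1) ->
  triangle_integrand n.+1 l = triangle_integrand n l *
    row_kernel (0 :: mkseq (fun i => l n i.+1) n)
      (fun i => if i is i'.+1 then theta n i'.+1 else sigma n.+1) (tau n.+1)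
      (mkseq (fun p => l n.+1 p.+1) n.+1).
Proof.
move=> x0 xx r0; rewrite /triangle_integrand.
rewrite [X in X * _ * _ * _ = _]prod1_recr; last by rewrite big_geq.
rewrite [X in _ * _ * X * _ = _]prod1_recr; last by rewrite !big_geq// divr1.
have := row_kernel_match (sigma n) (sigma n.+1) (tau n) (tau n.+1)
  (fun i => theta n i.+1) x0 xx r0.
have -> : \prod_(0 <= i < n) \prod_(0 <= p < n.+1) cpow `|l n i.+1 - l n.+1 p.+1| (theta n i.+1 - 1) =
  \prod_(1 <= a < n.+1) \prod_(1 <= p < n.+2) cpow `|l n a - l n.+1 p| (theta n a - 1).
  by rewrite prod1S; apply: eq_bigr => i _; rewrite prod1S.
have -> : \prod_(0 <= j < n) \prod_(0 <= i < j)
    cpow (l n j.+1 - l n i.+1) (theta n i.+1 + theta n j.+1 - 2) =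
  \prod_(1 <= b < n.+1) \prod_(1 <= a < b) cpow (l n b - l n a) (theta n a + theta n b - 2).
  by rewrite prod1S; apply: eq_bigr => i _; rewrite prod1S.
have V k : \prod_(0 <= j < k) \prod_(0 <= i < j) (l k j.+1 - l k i.+1)%:C%C =
  \prod_(1 <= q < k.+1) \prod_(1 <= p < q) (l k q - l k p)%:C%C.
  by rewrite prod1S; apply: eq_bigr => i _; rewrite prod1S.
rewrite (V n.+1) (V n).
rewrite -(prod1S (fun a => cpow (l n a) (sigma n - sigma n.+1 - theta n a) / cpow (1 + l n a)
  (tau n - tau n.+1 + theta n a))).
rewrite -(prod1S (fun a => cpow (l n a) (sigma n - 1) / cpow (1 + l n a) (tau n))).
rewrite -(prod1S (fun a => cpow (l n.+1 a) (sigma n.+1 - 1) / cpow (1 + l n.+1 a) (tau n.+1))).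
set K := row_kernel _ _ _ _.
set A := \prod_(1 <= i < n.+1) (cpow (l n i) (sigma n - sigma n.+1 - theta n i) / _).
set B := \prod_(1 <= p < n.+2) _.
set D := _ / (\prod_(1 <= b < n.+1) _).
set V1 := \prod_(1 <= q < n.+2) _.
set V0 := \prod_(1 <= q < n.+1) \prod_(1 <= p < q) (l n q - l n p)%:C%C.
set P := \prod_(1 <= i < n.+1) (cpow (l n i) (sigma n - 1) / _).
set Q := \prod_(1 <= j < n) _.
set S := \prod_(1 <= j < n) _.
move: A B D V1 V0 P Q S K => A B D V1 V0 P Q S K E.
transitivity (Q * S * (A * B * D * V1)); first by ring.
by rewrite E; ring.
Qed.

End triangle_integrand.

Section strict_triangles.
Variable R : realType.
Local Notation C := R[i].
Local Notation Re := (@complex.Re R).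
Local Notation Im := (@complex.Im R).
Local Notation T := (measurableTypeR R).
Implicit Types (L r : seq R).

(** The position does not involve the size of the triangle, so appending a row leaves the earlier
    entries in place. *)
Definition seq_entry L j k : R := nth 0 L ('C(j, 2) + k.-1).

Definition seq_row j L : seq R := mkseq (fun k => seq_entry L j k.+1) j.

(* The generic triangles, with positive entries and strict inequalities: padding
   row j with the entry 0 on the left makes it interlace strictly with row j + 1. *)
Definition strict_triangle n L : bool :=
  \big[andb/true]_(j <- iota 0 n) interlaced (0 :: seq_row j L) (seq_row j.+1 L).

Lemma size_seq_row j L : size (seq_row j L) = j.
Proof. by rewrite size_mkseq. Qed.

Lemma triangle_index n j k : (0 < k <= j)%N -> (j <= n)%N ->
  ('C(j, 2) + k.-1 < 'C(n.+1, 2))%N.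
Proof.
move=> /andP[k0 kj] jn; apply: leq_trans (leq_bin2l 2 (_ : j.+1 <= n.+1)%N) => //.
by rewrite binS bin1 ltn_add2l prednK.
Qed.

Lemma seq_entry_cat n L r j k : size L = 'C(n.+1, 2) -> (0 < k <= j)%N -> (j <= n)%N ->
  seq_entry (L ++ r) j k = seq_entry L j k.
Proof. by move=> sL kj jn; rewrite /seq_entry nth_cat sL triangle_index. Qed.

Lemma seq_row_cat n L r j : size L = 'C(n.+1, 2) -> (j <= n)%N ->
  seq_row j (L ++ r) = seq_row j L.
Proof.
move=> sL jn; apply/eq_in_map => k; rewrite mem_iota add0n => /= kj.
by rewrite (seq_entry_cat r sL).
Qed.

Lemma seq_row_last n L r : size L = 'C(n.+1, 2) -> size r = n.+1 ->
  seq_row n.+1 (L ++ r) = r.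
Proof.
move=> sL sr; apply: (@eq_from_nth _ 0); rewrite size_mkseq// => i ir.
by rewrite nth_mkseq// /seq_entry nth_cat sL/= ltnNge leq_addr/= addKn.
Qed.

Lemma strict_triangle_cat n L r : size L = 'C(n.+1, 2) -> size r = n.+1 ->
  strict_triangle n.+1 (L ++ r) =
  strict_triangle n L && interlaced (0 :: seq_row n L) r.
Proof.
move=> sL sr; rewrite /strict_triangle -addn1 iotaD big_cat big_seq1 add0n.
rewrite (seq_row_last sL sr) (seq_row_cat r sL (leqnn n)); congr (_ && _).
apply: eq_big_seq => j; rewrite mem_iota add0n => /andP[_ jn].
by rewrite (seq_row_cat r sL (ltnW jn)) (seq_row_cat r sL jn).
Qed.

Lemma strict_triangleP n L j : strict_triangle n L -> (j < n)%N ->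
  interlaced (0 :: seq_row j L) (seq_row j.+1 L).
Proof.
rewrite /strict_triangle big_all => /allP h jn; apply: h.
by rewrite mem_iota add0n.
Qed.

Lemma interlaced_sorted_cons x a l : interlaced (x :: a) l -> sorted <%R (x :: l : seq R).
Proof.
move=> al; rewrite /= path_min_sorted; first exact: interlaced_ltr al.
by apply: head_lt_all (interlaced_ltr al) _; case: l al => [|y l] //= /and3P[].
Qed.

Lemma strict_triangle_sorted n L j : strict_triangle n L -> (j <= n)%N ->
  sorted <%R (0 :: seq_row j L).
Proof.
move=> st; case: j => [|j] jn //.
exact: interlaced_sorted_cons (strict_triangleP st jn).
Qed.

End strict_triangles.

Section strict_triangle_integral.
Variable R : realType.
Local Notation C := R[i].
Local Notation Re := (@complex.Re R).
Local Notation Im := (@complex.Im R).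
Local Notation T := (measurableTypeR R).

Lemma cmeasurableV d (X : measurableType d) (f : X -> C) :
  cmeasurable f -> cmeasurable (fun x => (f x)^-1).
Proof.
move=> [f1 f2].
have mN : measurable_fun setT (fun x => (Re (f x) ^+ 2 + Im (f x) ^+ 2)^-1).
  by apply: measurable_funV; apply: measurable_funD; exact: measurable_funX.
split.
  rewrite (_ : (fun _ => _) = fun x => Re (f x) * (Re (f x) ^+ 2 + Im (f x) ^+ 2)^-1).
    exact: measurable_funM.
  by apply/funext => x; case: (f x).
rewrite (_ : (fun _ => _) = fun x => - (Im (f x) * (Re (f x) ^+ 2 + Im (f x) ^+ 2)^-1)).
  by apply: measurable_funN; exact: measurable_funM.
by apply/funext => x; case: (f x).
Qed.

(** The modulus of a power depends only on the real part of the exponent; the one factor that is not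
    a power, the Vandermonde product, is positive because [l] is increasing. *)
Lemma row_kernel_cnorm (a : seq R) (s : nat -> C) (t : C) (l : seq R) : interlaced a l ->
  row_kernel a (fun i => (Re (s i))%:C%C) (Re t)%:C%C l = (cnorm (row_kernel a s t l))%:C%C.
Proof.
move=> al; rewrite cnormE /row_kernel !normrM.
rewrite [X in _ = _ * X]ger0_norm ?ler0c ?ltW ?vandermonde_gt0 ?(interlaced_ltr al)//.
congr (_ * _ * _ * _ * _); rewrite !normr_prod; apply: eq_bigr => i _; rewrite ?normr_prod.
- rewrite cpow_norm; congr cpow.
  by case: t (s i) => [t1 t2] [s1 s2]; apply: complex_eq; rewrite /= ?subrr.
- rewrite cpow_norm; congr cpow.
  by case: t => [t1 t2]; apply: complex_eq; rewrite /= ?oppr0.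
- apply: eq_bigr => p _; rewrite cpow_norm; congr cpow.
  by case: (s i) => [s1 s2]; apply: complex_eq; rewrite /= ?subrr.
- apply: eq_bigr => p _; rewrite cpow_norm; congr cpow.
  by case: (s i) (s p) => [s1 s2] [u1 u2]; apply: complex_eq; rewrite /= ?(addr0, subr0, oppr0).
Qed.

Variables (sigma tau : nat -> C) (theta : nat -> nat -> C).

Lemma cmeasurable_triangle_integrand M n :
  seq_cmeasurable M (fun L => triangle_integrand sigma tau theta n (seq_entry L)).
Proof.
have me j k : measurable_fun setT (fun L : M.-tuple T => seq_entry L j k : R).
  exact: measurable_nth.
have m1 j k : measurable_fun setT (fun L : M.-tuple T => 1 + seq_entry L j k : R).
  by apply: measurable_funD => //; exact: measurable_cst.
have mB j k j' k' : measurable_fun setT (fun L : M.-tuple T => seq_entry L j k - seq_entry L j' k' : R).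
  exact: measurable_funB.
have mN j k j' k' : measurable_fun setT (fun L : M.-tuple T => `|seq_entry L j k - seq_entry L j' k'| : R).
  exact: measurableT_comp.
rewrite /seq_cmeasurable /triangle_integrand.
do !apply: cmeasurableM; apply: cmeasurable_prod => i _.
- apply: cmeasurable_prod => p _; apply: cmeasurableM; last apply: cmeasurableV;
    exact: cmeasurable_cpow.
- by apply: cmeasurableM; last apply: cmeasurableV; exact: cmeasurable_cpow.
- apply: cmeasurableM; last apply: cmeasurableV;
    by apply: cmeasurable_prod => p _; apply: cmeasurable_prod => q _; exact: cmeasurable_cpow.
- by apply: cmeasurable_prod => p _; exact: cmeasurable_real.
Qed.

Lemma measurable_strict_triangle M n :
  measurable_fun setT (fun L : M.-tuple T => strict_triangle n L).
Proof.
have mr j i : measurable_fun setT (fun L : M.-tuple T => nth 0 (seq_row j L) i : R).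
  have [ij|ji] := ltnP i j.
    under eq_fun do rewrite nth_mkseq//.
    exact: measurable_nth.
  under eq_fun do rewrite nth_default ?size_mkseq//.
  exact: measurable_cst.
apply: measurable_big_andb => j _.
apply: (@measurable_interlaced _ _ _ j.+1) => [x|x|i|i].
- by rewrite /= size_mkseq.
- by rewrite size_mkseq.
- by case: i => [|i] /=; [exact: measurable_cst|exact: mr].
- exact: mr.
Qed.

End strict_triangle_integral.

(** * Induction on the number of rows *)

Section strict_triangle_induction.
Variable R : realType.
Local Notation C := R[i].
Local Notation Re := (@complex.Re R).
Local Notation Im := (@complex.Im R).
Local Notation T := (measurableTypeR R).
Variables (sigma tau : nat -> C) (theta : nat -> nat -> C).

Lemma has_cint_zero d (X : measurableType d) (mu : {measure set X -> \bar R}) :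
  has_cint mu (fun=> 0 : C) 0.
Proof.
apply: (@ge0_has_cint _ _ _ mu (fun=> 0) 0) => //.
exact: integral0.
Qed.

Let row_exponent n i := if i is i'.+1 then theta n i'.+1 else sigma n.+1.

Let row_value n : C :=
  (\prod_(0 <= i < n.+1) cGamma (row_exponent n i)) *
  cGamma (tau n.+1 - \sum_(0 <= i < n.+1) row_exponent n i) / cGamma (tau n.+1).

Lemma rayleigh_beta_valueS n :
  rayleigh_beta_value n.+1 sigma tau theta =
  rayleigh_beta_value n sigma tau theta * row_value n.
Proof.
rewrite /rayleigh_beta_value /row_value.
rewrite [X in _ * X = _]big_nat_recr//=.
rewrite [X in _ = _ * (X * _ / _)]big_nat_recl//.
rewrite [X in _ = _ * (_ * cGamma (_ - X) / _)]big_nat_recl//.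
have -> : \sum_(1 <= a < n.+1) theta n a = \sum_(0 <= a < n) theta n a.+1 by rewrite big_add1.
have -> : \prod_(1 <= j < n.+1) \prod_(1 <= a < j.+1) cGamma (theta j a) =
   \prod_(1 <= j < n) \prod_(1 <= a < j.+1) cGamma (theta j a) *
   \prod_(0 <= a < n) cGamma (theta n a.+1) :> C.
  case: n => [|n]; first by rewrite !big_geq// mulr1.
  by rewrite big_nat_recr//= [in LHS](big_add1 _ _ 0 n.+2).
rewrite /= [in RHS](opprD (sigma n.+1)) [in RHS]addrA.
by ring.
Qed.

Lemma tcint_strict_triangle n :
  (forall j a, (1 <= a <= j)%N -> (j <= n.-1)%N -> 0 < Re (theta j a)) ->
  (forall j, (1 <= j <= n)%N -> 0 < Re (sigma j)) ->
  (forall j, (1 <= j <= n)%N ->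
     Re (sigma j) + \sum_(1 <= a < j) Re (theta j.-1 a) < Re (tau j)) ->
  tcint 'C(n.+1, 2)
    (fun L : seq R => if strict_triangle n L then triangle_integrand sigma tau theta n (seq_entry L) else 0)
    (rayleigh_beta_value n sigma tau theta).
Proof.
elim: n => [|n IH] th0 s0 st.
  (* The empty triangle: a single point of mass 1, and all products are empty. *)
  have -> : rayleigh_beta_value 0 sigma tau theta = (1 : R)%:C%C.
    by rewrite /rayleigh_beta_value !big_geq// mulr1.
  apply: (eq_has_cint (f := (fun=> (1 : R)%:C%C) : 0.-tuple T -> C)).
    by move=> t; rewrite /strict_triangle big_nil /triangle_integrand !big_geq// !mulr1.
  apply: ge0_has_cint => //.
  by rewrite (itintE (f := fun=> 1%E))//; exact: measurable_cst.
have {}IH : tcint 'C(n.+1, 2)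
    (fun L : seq R => if strict_triangle n L then triangle_integrand sigma tau theta n (seq_entry L) else 0)
    (rayleigh_beta_value n sigma tau theta).
  apply: IH => [j a aj jn|j /andP[j1 jn]|j /andP[j1 jn]].
  - exact/(th0 j a aj)/(leq_trans jn)/leq_pred.
  - by apply: s0; rewrite j1 leqW.
  - by apply: st; rewrite j1 leqW.
have -> : 'C(n.+2, 2) = ('C(n.+1, 2) + n.+1)%N by rewrite [LHS]binS bin1.
set m := 'C(n.+1, 2) in IH *.
set F := fun L : seq R => if strict_triangle n.+1 L then _ else _.
set G := (fun L : seq R => if strict_triangle n L then _ else _) in IH.
have mF : seq_cmeasurable (m + n.+1) F.
  by apply: cmeasurable_if0; [exact: measurable_strict_triangle|exact: cmeasurable_triangle_integrand].
apply/(tcint_cat _ mF).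
have mF2 : cmeasurable (fun p : m.-tuple T * n.+1.-tuple T => F (p.1 ++ p.2)).
  by have [m1 m2] := mF; split; [exact: (measurable_tuple_cat (F := fun L => Re (F L)) m1)|exact:
    (measurable_tuple_cat (F := fun L => Im (F L)) m2)].
pose K L (r : seq R) := if interlaced (0 :: seq_row n L) r then
  row_kernel (0 :: seq_row n L) (row_exponent n) (tau n.+1) r else 0.
have FE (L : m.-tuple T) (r : n.+1.-tuple T) : F (L ++ r) = G L * K L r.
  rewrite /F /G /K (strict_triangle_cat (size_tuple L) (size_tuple r)).
  case: ifPn; last by case: (strict_triangle n L); rewrite /= ?mul0r// => /negbTE ->; rewrite mulr0.
  move=> /andP[sL ir]; rewrite sL ir.
  have sr := seq_row_last (size_tuple L) (size_tuple r).
  have sL' := seq_row_cat r (size_tuple L) (leqnn n).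
  have so := strict_triangle_sorted sL (leqnn n).
  have en j : (j < n)%N -> seq_entry (L ++ r) n j.+1 = nth 0 (seq_row n L) j.
    by move=> jn; rewrite -sL' nth_mkseq.
  have en1 j : (j < n.+1)%N -> seq_entry (L ++ r) n.+1 j.+1 = nth 0 (r : seq R) j.
    by move=> jn; rewrite -[in RHS]sr nth_mkseq.
  have r0 := sorted_gt (interlaced_sorted_cons ir).
  rewrite triangle_integrandS.
  - congr (_ * _).
      by apply: eq_triangle_integrand => j k kj jn; rewrite (seq_entry_cat _ (size_tuple L)).
    by rewrite -/(seq_row n (L ++ r)) -/(seq_row n.+1 (L ++ r)) sL' sr.
  - by move=> i ilt; rewrite en// nth_gt ?size_mkseq//; exact: sorted_gt so.
  - move=> i j /andP[ij jn]; rewrite !en ?(ltn_trans ij)//.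
    by apply: (sorted_ltn_nth lt_trans) => //; rewrite ?inE ?size_mkseq ?(ltn_trans ij)//; exact:
      path_sorted so.
  - by move=> p pn; rewrite en1// nth_gt ?size_tuple.
have FE' : (fun p : m.-tuple T * n.+1.-tuple T => F (p.1 ++ p.2)) =
    (fun p => G p.1 * K p.1 p.2) by apply/funext => p; rewrite FE.
have sre i : (i < n.+1)%N -> 0 < Re (row_exponent n i).
  by case: i => [|i] ilt /=; [apply: s0; rewrite /= leqnn|apply: th0].
have sst : \sum_(0 <= i < n.+1) Re (row_exponent n i) < Re (tau n.+1).
  by have := st n.+1; rewrite /= leqnn => /(_ erefl); rewrite big_add1 big_nat_recl.
have Krow s t L : (forall i, (i < n.+1)%N -> 0 < Re (s i)) ->
    \sum_(0 <= i < n.+1) Re (s i) < Re t -> strict_triangle n L ->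
    tcint n.+1 (fun r => if interlaced (0 :: seq_row n L) r then
        row_kernel (0 :: seq_row n L) s t r else 0)
      ((\prod_(0 <= i < n.+1) cGamma (s i)) *
       cGamma (t - \sum_(0 <= i < n.+1) s i) / cGamma t).
  move=> s1 s2 sL; have so := strict_triangle_sorted sL (leqnn n).
  have := @tcint_row _ (0 :: seq_row n L) s t so.
  rewrite [size _]/= size_mkseq; apply => //.
  apply/andP; split; first by rewrite oppr_lt0.
  by apply: sub_all (sorted_gt so) => z; apply: lt_trans; rewrite oppr_lt0.
(* The given exponents yield the value of the row integral, their real parts the integral [v] of its
   modulus. Neither depends on [L], so integrating the modulus of [F] over the last row leaves that
   of [G] times a constant. *)
have Kint L := Krow _ _ L sre sst.
have Knorm L (sL : strict_triangle n L) := Krow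
  (fun i => (Re (row_exponent n i))%:C%C) (Re (tau n.+1))%:C%C L sre sst sL.
move: Knorm; set v := (X in forall L, _ -> tcint _ _ X); move: v => v Knorm.
rewrite FE'.
have iF : abs_integrable (@tuple_lebesgue R m \x @tuple_lebesgue R n.+1)%E setT
   (fun p : m.-tuple T * n.+1.-tuple T => G p.1 * K p.1 p.2).
  rewrite -FE'; apply: abs_integrable_prod => //.
  have E (L : m.-tuple T) : (\int[@tuple_lebesgue R n.+1]_r (cnorm (F (L ++ r)))%:E =
      (cnorm (G L) * Re v)%:E)%E.
    under eq_integral do rewrite FE cnormM.
    have [sL|nsL] := boolP (strict_triangle n L); last first.
      rewrite {2}/G (negbTE nsL) cnorm0 mul0r -[RHS](integral0 (@tuple_lebesgue R n.+1) setT).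
      by apply: eq_integral => r _; rewrite /G (negbTE nsL) cnorm0 mul0r.
    rewrite (@has_cint_ge0 _ _ _ (@tuple_lebesgue R n.+1)
      (fun r : n.+1.-tuple T => cnorm (G L) * cnorm (K L r)) ((cnorm (G L))%:C%C * v)).
    - by rewrite ReM /= mul0r subr0.
    - by move=> r; rewrite mulr_ge0 ?cnorm_ge0.
    - apply: eq_has_cint (has_cintZ _ (Knorm _ sL)) => r; rewrite rmorphM; congr (_ * _).
      by rewrite /K; case: ifPn => ir; rewrite ?cnorm0// row_kernel_cnorm.
  rewrite (eq_integral (fun L : m.-tuple T => (cnorm (G L) * Re v)%:E)); last by move=> L _; rewrite -E.
  have [iN _] := has_cintZ (Re v)%:C%C (conj (abs_integrable_cnorm IH.1) erefl).
  have [/= iRe _] := (abs_integrableP _ _).1 iN.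
  rewrite ltey_eq; apply/orP; left.
  rewrite (eq_integral (fun L : m.-tuple T => (Re ((Re v)%:C%C * (cnorm (G L))%:C%C))%:E)).
    exact: integrable_fin_num.
  by move=> L _; rewrite ReM /= mul0r subr0 mulrC.
split=> //.
rewrite rayleigh_beta_valueS; apply: has_cint_unique (has_cint_fubini1 iF (g := fun L => G L *
  row_value n) _) _.
  move=> L /=; rewrite /G; case: ifPn => sL; first exact: has_cintZ (Kint _ sL).
  by rewrite mul0r; apply: eq_has_cint (has_cint_zero _) => r; rewrite mul0r.
rewrite [X in has_cint _ _ X]mulrC.
by apply: eq_has_cint (has_cintZ _ IH) => L; rewrite mulrC.
Qed.

End strict_triangle_induction.

(** * Coincidences among coordinates form a null set *)

Section generic_triangles.
Variable R : realType.
Local Notation C := R[i].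
Local Notation Re := (@complex.Re R).
Local Notation Im := (@complex.Im R).
Local Notation T := (measurableTypeR R).
Local Notation leb := (@lebesgue_measure R).

Lemma measurable_uniq m : measurable_fun setT (fun t : m.-tuple T => uniq (t : seq R)).
Proof.
rewrite (_ : (fun _ => _) = fun t : m.-tuple T => \big[andb/true]_(j <- iota 0 m)
    \big[andb/true]_(i <- iota 0 m) ((i < j)%N ==> ~~ (nth 0 (t : seq R) i == nth 0 (t : seq R) j))).
  apply: measurable_big_andb => j _; apply: measurable_big_andb => i _.
  case: (i < j)%N => /=; last exact: measurable_cst.
  apply: measurable_neg; apply: measurable_fun_eqr; exact: measurable_nth.
apply/funext => t; rewrite uniq_pairwise big_all; apply/idP/idP.
  move=> /(pairwiseP 0) h; apply/allP => j; rewrite mem_iota add0n => /andP[_ jm].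
  rewrite big_all; apply/allP => i; rewrite mem_iota add0n => /andP[_ im].
  by apply/implyP => ij; apply: h; rewrite // inE size_tuple.
move=> /allP h; apply/(pairwiseP 0) => i j; rewrite !inE size_tuple => im jm ij.
have := h j; rewrite mem_iota add0n jm big_all => /(_ erefl) /allP /(_ i).
by rewrite mem_iota add0n im ij => /(_ erefl).
Qed.

Lemma measurable_uniq_seq d (X : measurableType d) m (phi : X -> seq R) :
  (forall x, size (phi x) = m) ->
  (forall i, (i < m)%N -> measurable_fun setT (fun x => nth 0 (phi x) i : R)) ->
  measurable_fun setT (fun x => uniq (phi x)).
Proof. by move=> sphi mphi; apply: (measurable_seq_comp sphi mphi); exact: measurable_uniq. Qed.

Let repeats (s t : seq R) : \bar R := if uniq (t ++ s) then 0%E else 1%E.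

Let repeats_ge0 (s t : seq R) : (0 <= repeats s t)%E.
Proof. by rewrite /repeats; case: ifP. Qed.

Let measurable_repeats d (X : measurableType d) m (phi : X -> seq R) s :
  (forall x, size (phi x) = m) ->
  (forall i, (i < m)%N -> measurable_fun setT (fun x => nth 0 (phi x) i : R)) ->
  measurable_fun setT (fun x => repeats s (phi x)).
Proof.
move=> sphi mphi; apply: measurable_fun_ifT; [|exact: measurable_cst|exact: measurable_cst].
apply: (@measurable_uniq_seq _ _ (m + size s)) => [x|i _]; first by rewrite size_cat sphi.
under eq_fun do rewrite nth_cat sphi.
by have [im|_] := ltnP i m; [exact: mphi|exact: measurable_cst].
Qed.

(** A new coordinate x has to avoid only the entries of [s], a finite and hence null set; outside it
    [x :: s] is again free of repetitions and serves as the list of the induction hypothesis. *)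
Let itint_repeats m s : uniq s -> itint m (repeats s) = 0%E.
Proof.
elim: m s => [|m IH] s us /=; first by rewrite /repeats /= us.
rewrite (@ge0_negligible_integral _ _ _ leb setT [set` s])//.
- rewrite -[RHS](integral0 leb (setT `\` [set` s])); apply: eq_integral => x.
  rewrite inE => -[_ /= /negP xs].
  rewrite -(IH (x :: s)); last by rewrite /= xs.
  apply: eq_itint => t _.
  by rewrite /repeats (uniq_catCA [:: x] t s : uniq ((x :: t) ++ s) = uniq (t ++ x :: s)).
- apply: countable_measurable; last exact/finite_set_countable/finite_seq.
  exact: measurable_set1.
- apply: (measurable_itint (f := fun x t => repeats s (x :: t)) (Z := T)) => //.
  apply: (@measurable_repeats _ _ m.+1) => [x|[_|i im]] /=; first by rewrite size_tuple.
    exact: measurable_fst.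
  exact: (measurable_nth_comp (phi := snd)).
- by move=> x _; exact: itint_ge0.
- exact/countable_lebesgue_measure0/finite_set_countable/finite_seq.
Qed.

Lemma ae_uniq m s : uniq s ->
  measurable [set t : m.-tuple T | ~~ uniq ((t : seq R) ++ s)] /\
  @tuple_lebesgue R m [set t | ~~ uniq ((t : seq R) ++ s)] = 0%E.
Proof.
move=> us; set N := [set t | _].
have mr : seq_measurable m (repeats s).
  by apply: measurable_repeats => [t|i _]; [exact: size_tuple|exact: measurable_nth].
have NE : N = (fun t : m.-tuple T => repeats s t) @^-1` [set 1%E].
  apply/seteqP; split=> t /=; rewrite /repeats /N /=; case: ifP => //= _.
  by move=> /eqP; rewrite eq_sym onee_eq0.
have mN : measurable N by rewrite NE -[X in measurable X]setTI; exact: mr.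
split=> //.
transitivity (\int[@tuple_lebesgue R m]_t (\1_N t)%:E)%E; first by rewrite integral_indic// setIT.
rewrite -[RHS](itint_repeats m us) -itintE//.
apply: eq_integral => t _; rewrite indicE /repeats.
rewrite (_ : (t \in N) = ~~ uniq ((t : seq R) ++ s)); first by case: ifP.
by apply/idP/idP; rewrite inE.
Qed.

End generic_triangles.

(** * From strict triangles to all Rayleigh triangles *)

Section rayleigh_triangles.
Variable R : realType.
Local Notation C := R[i].
Local Notation Re := (@complex.Re R).
Local Notation Im := (@complex.Im R).
Local Notation T := (measurableTypeR R).

Lemma has_cint_ae d (X : measurableType d) (mu : {measure set X -> \bar R})
    (N : set X) (f g : X -> C) v :
  measurable N -> mu N = 0%E -> cmeasurable g -> (forall x, ~ N x -> f x = g x) ->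
  has_cint mu f v -> has_cint mu g v.
Proof.
move=> mN muN mg fg hf; have mf := abs_integrable_cmeasurable hf.1.
apply: has_cint_transfer (mg) _ hf => b1 b2.
rewrite (@ge0_negligible_integral _ _ _ mu setT N)//; last 2 first.
  by apply/measurable_EFinP; exact: measurable_cpart.
  by move=> x _; rewrite lee_fin cpart_ge0.
rewrite [RHS](@ge0_negligible_integral _ _ _ mu setT N)//; last 2 first.
  by apply/measurable_EFinP; exact: measurable_cpart.
  by move=> x _; rewrite lee_fin cpart_ge0.
by apply: eq_integral => x; rewrite inE => -[_ /= Nx]; rewrite fg.
Qed.

(** A finite conjunction of comparisons, for the sake of measurability. The column index is shifted
    by one, so that the entries of row j are those with k < j. *)
Definition rayleighb n (L : seq R) : bool :=
  (\big[andb/true]_(j <- iota 0 n) \big[andb/true]_(k <- iota 0 j)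
     ((seq_entry L j.+1 k.+1 <= seq_entry L j k.+1) &&
      (seq_entry L j k.+1 <= seq_entry L j.+1 k.+2))) &&
  (\big[andb/true]_(j <- iota 0 n.+1) \big[andb/true]_(k <- iota 0 j)
     (0 <= seq_entry L j k.+1)).

Lemma rayleighP n (L : triangle R n) : rayleigh_nneg L <-> rayleighb n L.
Proof.
have E j k : entry L j k = seq_entry L j k by [].
split=> [[h1 h2]|/andP[h1 h2]].
  apply/andP; split; rewrite big_all; apply/allP => j; rewrite mem_iota add0n => /andP[_ jn];
    rewrite big_all; apply/allP => k; rewrite mem_iota add0n => /andP[_ kj].
    by apply: h1 => //; rewrite -ltnS prednK// (leq_ltn_trans _ jn).
  exact: h2.
move: h1 h2; rewrite !big_all => /allP h1 /allP h2.
split=> j k /andP[k0 kj] jn.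
  have jn' : (j < n)%N by case: n L h1 h2 E jn => [|n] L _ _ _ //; case: j kj => //; case: k k0.
  have := h1 j; rewrite mem_iota add0n => /(_ jn'); rewrite big_all => /allP /(_ k.-1).
  by rewrite mem_iota add0n prednK// => /(_ kj).
have := h2 j; rewrite mem_iota add0n => /(_ jn); rewrite big_all => /allP /(_ k.-1).
by rewrite mem_iota add0n prednK// => /(_ kj).
Qed.

Lemma measurable_rayleighb M n : measurable_fun setT (fun L : M.-tuple T => rayleighb n L).
Proof.
have me j k : measurable_fun setT (fun L : M.-tuple T => seq_entry L j k : R).
  exact: measurable_nth.
apply: measurable_and; apply: measurable_big_andb => j _; apply: measurable_big_andb => k _.
  by apply: measurable_and; exact: measurable_fun_ler.
by apply: measurable_fun_ler => //; exact: measurable_cst.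
Qed.

Lemma strict_triangleE n (L : seq R) : strict_triangle n L = all (fun j =>
  all (fun i => (nth 0 (0 :: seq_row j L) i < seq_entry L j.+1 i.+1) &&
    ((i < j)%N ==> (seq_entry L j.+1 i.+1 < seq_entry L j i.+1))) (iota 0 j.+1)) (iota 0 n).
Proof.
rewrite /strict_triangle big_all; apply: eq_in_all => j _.
rewrite interlaced_index; last by rewrite size_seq_row -[in LHS](size_seq_row j L).
rewrite [size (0 :: _)]/= size_seq_row.
apply: eq_in_all => i; rewrite mem_iota add0n => /andP[_ ij].
rewrite [nth 0 (seq_row j.+1 L) i]nth_mkseq// ltnS; congr (_ && _).
by case ij' : (i < j)%N => //; rewrite [nth 0 (0 :: _) i.+1]nth_mkseq.
Qed.

(** With 0 appended, the absence of repetitions also says that no entry vanishes; every weak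
    inequality is then strict. *)
Lemma rayleighb_strict n (L : seq R) : size L = 'C(n.+1, 2) -> uniq (L ++ [:: 0]) ->
  rayleighb n L = strict_triangle n L.
Proof.
move=> sL uL.
have ne0 j k : (0 < k <= j)%N -> (j <= n)%N -> seq_entry L j k != 0.
  move=> kj jn; move: uL; rewrite cats1 rcons_uniq => /andP[+ _].
  apply: contraNneq => <-; apply: mem_nth.
  by rewrite sL triangle_index.
have ne j k k' : (0 < k <= j)%N -> (0 < k' <= j.+1)%N -> (j < n)%N ->
    seq_entry L j k != seq_entry L j.+1 k'.
  move=> kj kj' jn; move: uL; rewrite cats1 rcons_uniq => /andP[_ uL].
  rewrite nth_uniq ?sL ?triangle_index// ?(ltnW jn)//.
  by rewrite ltn_eqF// (leq_trans (triangle_index kj (leqnn j)))// leq_addr.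
apply/idP/idP; last first.
  move=> st; rewrite /rayleighb !big_all; apply/andP; split; apply/allP => j;
    rewrite mem_iota add0n => /andP[_ jn]; rewrite big_all; apply/allP => k;
    rewrite mem_iota add0n => /andP[_ kj].
    move: st; rewrite strict_triangleE => /allP /(_ j).
    rewrite mem_iota add0n => /(_ jn) /allP st.
    have := st k; rewrite mem_iota add0n ltnS (ltnW kj) kj => /(_ erefl) /andP[_ /= /ltW ->].
    have := st k.+1; rewrite mem_iota add0n ltnS kj => /(_ erefl) /andP[+ _].
    by rewrite [nth _ _ _]nth_mkseq// => /ltW ->.
  have /sorted_gt /(nth_gt (i := k)) := strict_triangle_sorted st jn.
  by rewrite size_seq_row nth_mkseq// => /(_ kj) /ltW.
rewrite /rayleighb !big_all => /andP[/allP h1 /allP h2].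
have h0 j k : (k < j)%N -> (j <= n)%N -> 0 <= seq_entry L j k.+1.
  move=> kj jn; have := h2 j; rewrite mem_iota add0n => /(_ jn).
  by rewrite big_all => /allP /(_ k); rewrite mem_iota add0n => /(_ kj).
have hi j k : (k < j)%N -> (j < n)%N ->
    (seq_entry L j.+1 k.+1 <= seq_entry L j k.+1) &&
    (seq_entry L j k.+1 <= seq_entry L j.+1 k.+2).
  move=> kj jn; have := h1 j; rewrite mem_iota add0n => /(_ jn).
  by rewrite big_all => /allP /(_ k); rewrite mem_iota add0n => /(_ kj).
rewrite strict_triangleE; apply/allP => j; rewrite mem_iota add0n => /andP[_ jn].
apply/allP => i; rewrite mem_iota add0n ltnS => /andP[_ ij]; apply/andP; split.
  case: i ij => [|i] ij; first by rewrite lt_neqAle eq_sym ne0// h0.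
  rewrite [nth _ _ _]nth_mkseq// lt_neqAle ne//.
  by have /andP[] := hi j i ij jn.
apply/implyP => {}ij; rewrite lt_neqAle eq_sym ne ?ltnS ?(ltnW ij)//.
by have /andP[] := hi j i ij jn.
Qed.

End rayleigh_triangles.

Theorem mainTheorem1 (R : realType) (n : nat)
    (sigma tau : nat -> R[i]) (theta : nat -> nat -> R[i])
    (n_ge1 : (1 <= n)%N)
    (Re_theta : forall j a, (1 <= a <= j)%N -> (j <= n.-1)%N ->
       0 < complex.Re (theta j a))
    (Re_sigma : forall j, (1 <= j <= n)%N -> 0 < complex.Re (sigma j))
    (Re_tau : forall j, (1 <= j <= n)%N ->
       complex.Re (sigma j) + \sum_(1 <= a < j) complex.Re (theta j.-1 a)
         < complex.Re (tau j)) :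
  abs_integrable (@tuple_lebesgue R 'C(n.+1, 2)) (@rayleigh_nneg R n)
    (rayleigh_integrand sigma tau theta) /\
  cintegral (@tuple_lebesgue R 'C(n.+1, 2)) (@rayleigh_nneg R n)
    (rayleigh_integrand sigma tau theta)
  = rayleigh_beta_value n sigma tau theta.
Proof.
have mb := @measurable_rayleighb R 'C(n.+1, 2) n.
have mD : measurable (@rayleigh_nneg R n).
  rewrite (_ : rayleigh_nneg (n:=n) = (fun L : triangle R n => rayleighb n L) @^-1` [set true]).
    by rewrite -[X in measurable X]setTI; exact: mb.
  by apply/seteqP; split => L /rayleighP.
apply/(has_cint_on _ _ _ mD (@rayleighP R n)).
(* The triangles with a repeated entry or an entry 0: outside this null set the strict triangles and
   the Rayleigh triangles coincide. *)
have [mN N0] := ae_uniq 'C(n.+1, 2) (isT : uniq [:: 0 : R]).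
apply: has_cint_ae mN N0 _ _ (tcint_strict_triangle Re_theta Re_sigma Re_tau).
  by apply: cmeasurable_if0 => //; exact: cmeasurable_triangle_integrand.
by move=> L /= /negP; rewrite negbK => uL; rewrite rayleighb_strict ?size_tuple.
Qed.
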